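(* Fix $q\in[0,\infty)$ and $x\in\mathbb N_0$. Under $\mathsf P_x$, $G_{\mathsf e_q}$ and $\mathsf e_q-G_{\mathsf e_q}$ are conditionally independent given $X_{G_{\mathsf e_q}}$. Assume now $q\ge\mu(\tilde r(\varphi)-1)$, i.e. $\phi_q\le\varphi$, and let $k\in\{0,\dots,x\}$. Then $$\mathsf P_x(X_{G_{\mathsf e_q}}=k)=\frac{\Phi_q(x)}{\Phi_q(k)}-\frac{\Phi_q(x)}{\Phi_q(k-1)}\mathbf 1_{\mathbb N}(k).$$ Moreover, provided $\mathsf P_x(X_{G_{\mathsf e_q}}=k)>0$, for further $\alpha\in[0,\infty)$: $$\mathsf P_x[e^{-\alpha G_{\mathsf e_q}}\mid X_{G_{\mathsf e_q}}=k]=\frac{\Phi_{q+\alpha}(x)}{\Phi_q(x)}\frac{\Phi_q(k)}{\Phi_{q+\alpha}(k)};$$ hence, when $q>0$, $$\mathsf P_x[e^{-\alpha(\mathsf e_q-G_{\mathsf e_q})}\mid X_{G_{\mathsf e_q}}=k]=\frac{q}{q+\alpha}\,\frac{1-\frac{\Phi_{q+\alpha}(k)}{\Phi_{q+\alpha}(k-1)}\mathbf 1_{\mathbb N}(k)}{1-\frac{\Phi_q(k)}{\Phi_q(k-1)}\mathbf 1_{\mathbb N}(k)}.$$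
   Context: Setting. $\mathbb N=\{1,2,\dots\}$, $\mathbb N_0=\mathbb N\cup\{0\}$. Fix $\lambda\in(0,\infty)$, $\mu\in[0,\infty)$, a probability distribution $p=(p_k)_{k\in\mathbb N_0}$ with $p_0>0$ and $p_1=0$, and a probability distribution $r=(r_k)_{k\in\{-1\}\cup\mathbb N}$ (put $r_0:=0$). Assume that $\mu r_k>0$ for some $k\in\mathbb N$ or $p_0<1$. Under probabilities $(\mathsf P_x)_{x\in\mathbb N_0}$, $X=(X_t)_{t\in[0,\infty)}$ is a minimal càdlàg continuous-time Markov chain with state space $\mathbb N_0$, started from $x$ under $\mathsf P_x$, with explosion time (lifetime) $\zeta$, $X$ being set equal to $\infty$ on $[\zeta,\infty)$, and with conservative generator matrix $(Q_{ij})$: $Q_{00}=0$ (state $0$ is absorbing) and, for $n\in\mathbb N$, $-Q_{nn}=\lambda n+\mu$, $Q_{n(n+m)}=p_{m+1}\lambda n+r_m\mu$ for $m\in\mathbb N\cup\{-1\}$. $\mathsf e_1$ is a unit-rate exponential time independent of $X$; $\mathsf e_q:=\mathsf e_1/q$ (so $\mathsf e_0=\infty$). $\mathsf P_x[\cdot]$ denotes expectation under $\mathsf P_x$. For $t\in(0,\infty]$, $G_t:=\sup\{u\in[0,t):X\text{ attains a strict new minimum at time }u\}$, where time $0$ is considered to be a time at which a strict new minimum occurs. ($G_{\mathsf e_q}<\infty$ a.s. even for $q=0$.) Generating functions and roots. For $z\in(0,1]$, $\tilde p(z):=\sum_{k=0}^\infty p_kz^k$ and $\tilde r(z):=\sum_{k=-1}^\infty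 r_kz^k$. $\varphi$ is the smallest root of $\tilde p(z)=z$ in $z\in(0,1]$. If $\mu r_{-1}>0$, then for $q\in(0,\infty)$, $\phi_q$ is the unique root of $q=\mu(\tilde r(z)-1)$ in $z\in(0,1)$, and $\phi$ is the smallest root of $\tilde r(z)=1$ in $z\in(0,1]$; if $\mu r_{-1}=0$, then $\phi_q:=\phi:=0$. Put $\phi_0:=\phi$. The functions $\Phi_q:\mathbb N_0\to(0,\infty)$. For $q\in(0,\infty)$: if $\phi_q<\varphi$, $\Phi_q(x):=q\int_0^\varphi\frac{\exp\{-\int_{\phi_q}^v\gamma_q(w)\mathrm dw\}}{\rho(v)}v^x\mathrm dv$, where $\rho(v):=\lambda|\tilde p(v)-v|$ and $\gamma_q(v):=\frac{q+\mu(1-\tilde r(v))}{\rho(v)}$; if $\phi_q=\varphi$, $\Phi_q(x):=\varphi^x$. For $q=0$ (when $\phi\le\varphi$): $$\Phi_0(x):=\mu\int_0^\varphi\frac{\exp\left\{-\int_\phi^v\frac{\mu(1-\tilde r(w))}{\lambda(\tilde p(w)-w)}\mathrm dw\right\}}{\lambda(\tilde p(v)-v)}v^x\,\mathrm dv$$ if either $\mu(1-\tilde r(\varphi))>0$, or $\mu>0$, $\phi<1=\varphi$ and $\int_0^1\frac{\exp\{-\int_\phi^v\frac{\mu(1-\tilde r(w))}{\lambda(\tilde p(w)-w)}\mathrm dw\}}{\lambda(\tilde p(v)-v)}\mathrm dv<\infty$; and $\Phi_0(x):=\varphi^x$ otherwise. Terms multiplied by $\mathbf 1_{\mathbb N}(k)$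 are understood to be $0$ when $k=0$. *)

(* Defs.v *)
From HB Require Import structures.
From mathcomp Require Export all_boot all_order all_algebra.
From mathcomp Require Export all_classical all_reals all_analysis.
From mathcomp Require Export measurable_realfun.
Set Implicit Arguments.
Unset Strict Implicit.
Unset Printing Implicit Defensive.
Import Order.TTheory GRing.Theory Num.Theory.
Import numFieldNormedType.Exports.
Local Open Scope classical_set_scope.
Local Open Scope ring_scope.

(** States are elements of [option nat]: [Some n] is the state n of N_0 and
    [None] is the cemetery state, written ∞ on paper.  A process is a function
    [X : R -> Omega -> option nat], only used at times t >= 0. *)

(** Continuous-time Markov chains with a given generator are defined through
    their jump chain and holding times, as in Norris, Markov Chains, Sections
    2.2 and 2.6. *)

Section Paths.
Context {R : realType} {Omega : Type}.
Variable X : R -> Omega -> option nat.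

(** J_0 = 0 and J_(n+1) = inf {s >= J_n : X_s <> X_(J_n)}, with inf of the
    empty set equal to +oo; once J_n = +oo the set below is empty. *)
Fixpoint jump_time (n : nat) (w : Omega) : \bar R :=
  if n is m.+1 then
    ereal_inf [set s%:E | s in
      [set s : R | (jump_time m w <= s%:E)%E /\
                   X s w <> X (fine (jump_time m w)) w]]
  else 0%E.

(** Y_n = X_(J_n), with X_(+oo) the last value taken when there are only
    finitely many jumps. *)
Fixpoint jump_chain (n : nat) (w : Omega) : option nat :=
  if jump_time n w is t%:E then X t w
  else if n is m.+1 then jump_chain m w else None.

(** The time spent in the state Y_n (this is S_(n+1) in Norris). *)
Definition holding_time (n : nat) (w : Omega) : \bar R :=
  if jump_time n w is t%:E then (jump_time n.+1 w - t%:E)%E else +oo%E.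

Definition explosion_time (w : Omega) : \bar R :=
  ereal_sup (range (jump_time ^~ w)).

(** Càdlàg for the discrete topology on the state space up to explosion, and
    equal to ∞ from explosion on. *)
Definition minimal_cadlag : Prop :=
  forall w : Omega,
    [/\ forall t, 0 <= t -> \forall s \near t^'+, X s w = X t w,
        forall t, 0 < t -> (t%:E < explosion_time w)%E ->
          exists y, \forall s \near t^'-, X s w = y
      & forall t, 0 <= t -> (X t w = None <-> (explosion_time w <= t%:E)%E)].

End Paths.

Definition jump_matrix {R : realType} (Q : nat -> nat -> R) (i j : nat) : R :=
  if Q i i == 0 then (i == j)%:R
  else if i == j then 0 else Q i j / - Q i i.

Record minimal_chain {R : realType} {d : measure_display}
    {Omega : measurableType d} (Q : nat -> nat -> R)
    (P : nat -> probability Omega R) (X : R -> Omega -> option nat) : Prop := {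
  chain_measurable : forall (t : R) (n : nat), 0 <= t ->
    measurable [set w | X t w = Some n];
  chain_path : minimal_cadlag X;
  chain_jump : forall (x n : nat) (i : nat -> nat),
    P x [set w | forall k, (k <= n)%N -> jump_chain X k w = Some (i k)] =
    ((i 0%N == x)%:R * \prod_(k < n) jump_matrix Q (i k) (i k.+1))%:E;
  (* Given Y_0, ..., Y_n, the first n+1 holding times are independent and
     exponential with parameters - Q_(Y_k, Y_k). *)
  chain_holding : forall (x n : nat) (i : nat -> nat) (t : nat -> R),
    (forall k, 0 <= t k) ->
    P x [set w | forall k, (k <= n)%N ->
           jump_chain X k w = Some (i k) /\ ((t k)%:E < holding_time X k w)%E] =
    (P x [set w | forall k, (k <= n)%N -> jump_chain X k w = Some (i k)] *
     (\prod_(k < n.+1) expR (Q (i k) (i k) * t k))%:E)%E }.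

(** Off the diagonal Q_(i,i+m) = p_(m+1) lam i + r_m mu for m >= -1, here with
    m = j - i. *)
Definition generator {R : realType} (lam mu : R) (p : nat -> R) (r : int -> R)
    (i j : nat) : R :=
  if i == 0%N then 0
  else if j == i then - (lam * i%:R + mu)
  else if (i <= j.+1)%N then
    p (j.+1 - i)%N * lam * i%:R + r (j%:Z - i%:Z) * mu
  else 0.

Definition independent_of_process {R : realType} {d : measure_display}
    {Omega : measurableType d} (P : probability Omega R)
    (X : R -> Omega -> option nat) (e : Omega -> R) : Prop :=
  forall (A : set Omega) (B : set R),
    <<s [set C | exists t y, 0 <= t /\ C = [set w | X t w = y]] >> A ->
    measurable B ->
    P (A `&` e @^-1` B) = (P A * P (e @^-1` B))%E.

Definition is_unit_exponential {R : realType} {d : measure_display}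
    {Omega : measurableType d} (P : probability Omega R)
    (e : {mfun Omega >-> R}) : Prop :=
  forall B : set R, measurable B -> distribution P e B = exponential_prob 1 B.

Definition exp_time {R : realType} {Omega : Type} (e1 : Omega -> R) (q : R)
    (w : Omega) : \bar R :=
  if q == 0 then +oo%E else (e1 w / q)%:E.

Definition state_lt (a b : option nat) : bool :=
  match a, b with
  | Some m, Some n => (m < n)%N
  | Some _, None => true
  | None, _ => false
  end.

(** Vacuously true at u = 0.  As the states are integers, a value below all the
    previous ones is a value below their infimum. *)
Definition strict_new_min {R : realType} {Omega : Type}
    (X : R -> Omega -> option nat) (w : Omega) (u : R) : Prop :=
  forall s, 0 <= s < u -> state_lt (X u w) (X s w).

Definition last_min_time {R : realType} {Omega : Type}
    (X : R -> Omega -> option nat) (t : \bar R) (w : Omega) : \bar R :=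
  ereal_sup [set u%:E | u in
    [set u : R | [/\ 0 <= u, (u%:E < t)%E & strict_new_min X w u]]].

Definition G_e {R : realType} {Omega : Type} (X : R -> Omega -> option nat)
    (e1 : Omega -> R) (q : R) (w : Omega) : \bar R :=
  last_min_time X (exp_time e1 q w) w.

Definition post_G_e {R : realType} {Omega : Type}
    (X : R -> Omega -> option nat) (e1 : Omega -> R) (q : R) (w : Omega)
    : \bar R :=
  (exp_time e1 q w - G_e X e1 q w)%E.

(** [fine] is harmless: a path has finitely many strict new minima. *)
Definition X_G_e {R : realType} {Omega : Type} (X : R -> Omega -> option nat)
    (e1 : Omega -> R) (q : R) (w : Omega) : option nat :=
  X (fine (G_e X e1 q w)) w.

Definition cond_proba {R : realType} {d : measure_display}
    {Omega : measurableType d} (P : probability Omega R) (A B : set Omega) : R :=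
  fine (P (A `&` B)) / fine (P B).

Definition cond_expect {R : realType} {d : measure_display}
    {Omega : measurableType d} (P : probability Omega R)
    (Z : Omega -> \bar R) (B : set Omega) : R :=
  fine (\int[P]_(w in B) Z w)%E / fine (P B).

(** Conditional independence of U and V given a variable W that takes
    countably many values. *)
Definition cond_independent {R : realType} {d : measure_display}
    {Omega : measurableType d} (P : probability Omega R)
    (U V : Omega -> \bar R) (W : Omega -> option nat) : Prop :=
  forall (y : option nat), (0 < P (W @^-1` [set y]))%E ->
  forall A B : set (\bar R), measurable A -> measurable B ->
    cond_proba P (U @^-1` A `&` V @^-1` B) (W @^-1` [set y]) =
    cond_proba P (U @^-1` A) (W @^-1` [set y]) *
    cond_proba P (V @^-1` B) (W @^-1` [set y]).

Definition gen_p {R : realType} (p : nat -> R) (z : R) : R :=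
  limn (pseries p z).

Definition gen_r {R : realType} (r : int -> R) (z : R) : R :=
  r (-1) / z + limn (pseries (fun k : nat => r k%:Z) z).

(** The least element of [A] (a junk value if there is none). *)
Definition least {R : realType} (A : set R) : R := get (A `&` lbound A).

Definition varphi {R : realType} (p : nat -> R) : R :=
  least [set z | 0 < z <= 1 /\ gen_p p z = z].

Definition phi {R : realType} (mu : R) (r : int -> R) (q : R) : R :=
  if 0 < mu * r (-1) then
    if q == 0 then least [set z | 0 < z <= 1 /\ gen_r r z = 1]
    else get [set z | 0 < z < 1 /\ q = mu * (gen_r r z - 1)]
  else 0.

(** The oriented integral: the lower bound may exceed the upper one. *)
Definition oint {R : realType} (a b : R) (f : R -> R) : R :=
  if a <= b then \int[lebesgue_measure]_(w in `[a, b]) f w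
  else - \int[lebesgue_measure]_(w in `[b, a]) f w.

Definition rho {R : realType} (lam : R) (p : nat -> R) (v : R) : R :=
  lam * `|gen_p p v - v|.

Definition gamma {R : realType} (lam mu : R) (p : nat -> R) (r : int -> R)
    (q v : R) : R :=
  (q + mu * (1 - gen_r r v)) / rho lam p v.

Definition density_pos {R : realType} (lam mu : R) (p : nat -> R)
    (r : int -> R) (q v : R) : R :=
  expR (- oint (phi mu r q) v (gamma lam mu p r q)) / rho lam p v.

Definition density_0 {R : realType} (lam mu : R) (p : nat -> R)
    (r : int -> R) (v : R) : R :=
  expR (- oint (phi mu r 0) v
            (fun w => mu * (1 - gen_r r w) / (lam * (gen_p p w - w)))) /
  (lam * (gen_p p v - v)).

Definition Phi_pos {R : realType} (lam mu : R) (p : nat -> R) (r : int -> R)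
    (q : R) (x : nat) : R :=
  if phi mu r q < varphi p then
    q * \int[lebesgue_measure]_(v in `]0, varphi p[)
          (density_pos lam mu p r q v * v ^+ x)
  else varphi p ^+ x.

Definition Phi_0_integral_case {R : realType} (lam mu : R) (p : nat -> R)
    (r : int -> R) : Prop :=
  0 < mu * (1 - gen_r r (varphi p)) \/
  [/\ 0 < mu, phi mu r 0 < 1, varphi p = 1 &
      (\int[lebesgue_measure]_(v in `]0%R, 1%R[)
          (density_0 lam mu p r v)%:E < +oo)%E].

Definition Phi_0 {R : realType} (lam mu : R) (p : nat -> R) (r : int -> R)
    (x : nat) : R :=
  if `[< Phi_0_integral_case lam mu p r >] then
    mu * \int[lebesgue_measure]_(v in `]0, varphi p[)
           (density_0 lam mu p r v * v ^+ x)
  else varphi p ^+ x.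

(** Only meaningful when [phi mu r q <= varphi p]. *)
Definition Phi {R : realType} (lam mu : R) (p : nat -> R) (r : int -> R)
    (q : R) (x : nat) : R :=
  if q == 0 then Phi_0 lam mu p r x else Phi_pos lam mu p r q x.

(* Main.v *)
From HB Require Import structures.
From mathcomp Require Import ring lra.
Require Import Defs.
Set Implicit Arguments.
Unset Strict Implicit.
Unset Printing Implicit Defensive.
Import Order.TTheory GRing.Theory Num.Theory.
Import numFieldNormedType.Exports.
Local Open Scope classical_set_scope.
Local Open Scope ring_scope.

(** The chain never jumps down by more than one unit.  So the value of the path
    at its last strict minimum before the exponential time [e] is the lowest
    level [k] visited before [e], the time of this minimum is the hitting time
    [T] of [k], and this happens if and only if [T < e <= T + Z], where [Z] is
    the delay between the first visit of [k] and the first visit of [k - 1].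
    Lack of memory of [e] at time [T] together with the strong Markov property
    at [T] factorizes the expectation of a function of [T] times a function of
    [e - T] on this event ([last_min_factorization]).  The conditional
    independence follows, and so do the three transforms ([XG_law],
    [XG_time_transform], [XG_after_transform]) in terms of the Laplace transform
    [hit_transform] of hitting times, where [b >= 0] and [k <= x]:
    [h b k x = E_x (expR (- b T_k))].  What is left is to prove
    [h b k x = Phi b x / Phi b k] ([hit_transform_Phi]).

    As a function of [x], the transform solves the first-step equation
    [sum_j (rate x j * f (x - 1 + j)) = (lam x + mu + b) f x] on [x > k].  It is
    the least nonnegative solution with value [1] at [k]
    ([hit_transform_upper]), and by a maximum principle it dominates every
    subsolution that vanishes at infinity ([hit_transform_lower]).  Hence it
    suffices to find a positive solution on [x > 0] that vanishes at infinity
    ([hit_transform_solution]).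

    Powers [v ^+ x] are mapped by the left-hand side to
    [lam x v ^+ (x - 1) p~(v) + mu v ^+ x r~(v)], which exceeds the right-hand
    side by [x v ^+ (x - 1) rho v - (b + mu (1 - r~(v))) v ^+ x].  If [E] is the
    integrating factor, [E' = - gamma E], then this excess times [E / rho] is
    the derivative of [E v ^+ x].  So the moments of the density [E / rho] on
    [(0, varphi)] solve the equation up to boundary terms.  The one at [0]
    vanishes since [E <= 1].  The one at [varphi] vanishes as soon as the
    density is integrable, because [rho] vanishes at most linearly there
    ([factor_cvg0]).  The sign of [gamma], hence the bound on [E], comes from
    the convexity of [r~] ([drift_le0], [drift_chord]).

    The definition of [Phi] distinguishes three cases ([Phi_cases]).  If the
    density is integrable, [Phi] is a multiple of its moment sequence.  If the
    two drifts vanish together at [varphi < 1], powers of [varphi] solve the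
    equation.  The remaining case is [b = 0], [varphi = 1], [Phi = 1], and says
    that all lower levels are hit almost surely: here subsolutions close to
    [1] are powers of [z < 1] ([hit_ge_subpower]), or else moments of the
    density truncated near [1], where its infinite mass is concentrated
    ([hit_transform_ge_power]). *)


(** * Paths and their jump records *)

Section JumpRecord.
Context {R : realType}.

(** A path is encoded by its successive states paired with the times spent in
    them; all laws below are laws on this space of sequences. *)
Definition record := nat -> nat * \bar R.

(** The absolute value is the identity on holding times; it keeps the
    functionals below nonnegative on all records. *)
Definition elapsed (n : nat) (s : record) : \bar R :=
  (\sum_(j < n) `|(s j).2|)%E.

Definition first_hit (k n : nat) : set record :=
  [set s | (s n).1 = k /\ forall m, (m < n)%N -> (s m).1 <> k].

Definition hit_time (k : nat) (s : record) : \bar R :=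
  ereal_inf [set elapsed m s | m in [set m | (s m).1 = k]].

(** The time at which a record started from [k] goes below [k], provided it
    never goes down by more than one unit at a time. *)
Definition undershoot_time (k : nat) (s : record) : \bar R :=
  if k is k'.+1 then hit_time k' s else +oo%E.

Definition shift (n : nat) (s : record) : record := fun m => s (n + m)%N.

(** Jump chains of minimal paths have no value [None], so the default [0] is
    never read. *)
Definition jump_record {Omega : Type} (X : R -> Omega -> option nat) (w : Omega)
  : record := fun n => (odflt 0%N (jump_chain X n w), holding_time X n w).

Lemma elapsed_ge0 n s : (0 <= elapsed n s)%E.
Proof. by apply: sume_ge0 => i _; exact: abse_ge0. Qed.

Lemma elapsedS n s : elapsed n.+1 s = (elapsed n s + `|(s n).2|)%E.
Proof. by rewrite /elapsed big_ord_recr. Qed.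

Lemma elapsedD m n s : elapsed (n + m) s = (elapsed n s + elapsed m (shift n s))%E.
Proof.
elim: m => [|m IH]; first by rewrite addn0 {3}/elapsed big_ord0 adde0.
by rewrite addnS !elapsedS IH addeA.
Qed.

Lemma elapsed_le m n s : (m <= n)%N -> (elapsed m s <= elapsed n s)%E.
Proof.
move=> /subnKC <-; rewrite elapsedD leeDl//.
exact: elapsed_ge0.
Qed.

Lemma shiftD m n s : shift m (shift n s) = shift (n + m) s.
Proof. by apply/funext => i; rewrite /shift addnA. Qed.

End JumpRecord.

Section MinimalPaths.
Context {R : realType} {Omega : Type} (X : R -> Omega -> option nat).
Hypothesis Xpath : minimal_cadlag X.
Variable w : Omega.
Local Notation J n := (jump_time X n w).
Local Notation Y n := (jump_chain X n w).

Lemma jump_timeE n : J n.+1 = ereal_inf [set s%:E | s in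
  [set s : R | (J n <= s%:E)%E /\ X s w <> X (fine (J n)) w]].
Proof. by []. Qed.

Lemma jump_time_ge n : (J n <= J n.+1)%E.
Proof. by apply: le_ereal_inf_tmp => _ [s [+ _]] <-. Qed.

Lemma jump_time_ge0 n : (0 <= J n)%E.
Proof. by elim: n => // n IH; apply: le_trans (jump_time_ge n). Qed.

Lemma jump_time_le m n : (m <= n)%N -> (J m <= J n)%E.
Proof.
elim: n => [|n IH]; first by rewrite leqn0 => /eqP->.
rewrite leq_eqVlt => /predU1P[->//|]; rewrite ltnS => /IH h.
exact: le_trans h (jump_time_ge n).
Qed.

(** Right-continuity forbids instantaneous jumps. *)
Lemma jump_time_lt n t : J n = t%:E -> (t%:E < J n.+1)%E.
Proof.
move=> Jn; have t0 : 0 <= t by rewrite -lee_fin -Jn jump_time_ge0.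
have [/(_ t t0) rc _ _] := Xpath w.
have [e /= e0 He] := rc.
apply: (@lt_le_trans _ _ (t + e)%:E); first by rewrite lte_fin ltrDl.
apply: le_ereal_inf_tmp => _ [s [+ sX]] <-.
rewrite Jn lee_fin in sX * => ts; rewrite lee_fin.
rewrite leNgt; apply/negP => ste; apply: sX.
have [<-//|ts'] := eqVneq t s.
apply: He; last by rewrite lt_neqAle ts'.
by rewrite /= distrC ger0_norm ?subr_ge0// ltrBlDl.
Qed.

Lemma jump_chainE n t : J n = t%:E -> Y n = X t w.
Proof. by case: n => [[<-]|n /= ->]. Qed.

Lemma jump_chain_stop n : J n.+1 = +oo%E -> Y n.+1 = Y n.
Proof. by move=> /= ->. Qed.

Lemma state_between n t s : J n = t%:E -> t <= s -> (s%:E < J n.+1)%E ->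
  X s w = Y n.
Proof.
move=> Jn ts sJ; rewrite (jump_chainE Jn).
apply: contrapT => ne; move: sJ; rewrite ltNge => /negP; apply.
by rewrite jump_timeE; apply: ereal_inf_lbound; exists s => //; rewrite /= Jn lee_fin.
Qed.

Lemma jump_before_explosion n t : J n = t%:E -> (t%:E < explosion_time X w)%E.
Proof.
move=> Jn; apply: lt_le_trans (jump_time_lt Jn) _.
by apply: ereal_sup_ubound; exists n.+1.
Qed.

(** Jump times are followed by strictly later ones, hence precede the
    explosion. *)
Lemma jump_chain_some n : exists i, Y n = Some i.
Proof.
elim: n => [|n [i IH]].
  case E: (Y 0) => [i|]; first by exists i.
  have [_ _ /(_ 0 (lexx _)) [+ _]] := Xpath w.
  move/(_ E); rewrite leNgt => /negP; case.
  exact: (@jump_before_explosion 0).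
case E : (J n.+1) => [t||].
- rewrite (jump_chainE E); case F: (X t w) => [j|]; first by exists j.
  have t0 : 0 <= t by rewrite -lee_fin -E jump_time_ge0.
  have [_ _ /(_ t t0) [/(_ F) + _]] := Xpath w.
  by rewrite leNgt (jump_before_explosion E).
- by exists i; rewrite jump_chain_stop.
- by have := jump_time_ge0 n.+1; rewrite E.
Qed.

Lemma jump_cover t : 0 <= t -> (t%:E < explosion_time X w)%E ->
  exists n u, [/\ J n = u%:E, u <= t & (t%:E < J n.+1)%E].
Proof.
move=> t0 /ereal_sup_gt[_ [m _ <-] tJ].
have ex : exists m, `[< (t%:E < J m)%E >] by exists m; exact/asboolP.
case: (ex_minnP ex) => -[|n] /asboolP tn minn.
  by move: tn; rewrite /= lte_fin ltNge t0.
have Jt : (J n <= t%:E)%E.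
  rewrite leNgt; apply/negP => /asboolP/minn; by rewrite ltnn.
case E : (J n) Jt => [u||] // Jt; last by have := jump_time_ge0 n; rewrite E.
by exists n, u; split.
Qed.

Lemma state_someP t i : 0 <= t -> X t w = Some i ->
  exists n u, [/\ J n = u%:E, u <= t, (t%:E < J n.+1)%E & Y n = Some i].
Proof.
move=> t0 Xt.
have /(jump_cover t0) [n [u [Jn ut tJ]]] : (t%:E < explosion_time X w)%E.
  rewrite ltNge; apply/negP => h; have [_ _ /(_ t t0)[_ /(_ h)]] := Xpath w.
  by rewrite Xt.
by exists n, u; split => //; rewrite -Xt (state_between Jn ut tJ).
Qed.

Lemma holding_time_gt0 n : (0 < holding_time X n w)%E.
Proof.
rewrite /holding_time; case E: (J n) => [t||]//.
by rewrite sube_gt0; exact: jump_time_lt.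
Qed.

Lemma jump_timeS n : J n.+1 = (J n + holding_time X n w)%E.
Proof.
rewrite /holding_time; case E: (J n) => [t||].
- by rewrite addeC subeK.
- by have := jump_time_ge n; rewrite E leye_eq => /eqP.
- by have := jump_time_ge0 n; rewrite E.
Qed.

Lemma elapsed_jump_record n : elapsed n (jump_record X w) = J n.
Proof.
elim: n => [|n IH]; first by rewrite /elapsed big_ord0.
by rewrite elapsedS IH jump_timeS gee0_abs// ltW// holding_time_gt0.
Qed.

(** The strict new minima of a path that is constant between its jumps occur at
    jump times; the last one before [e] is the first visit of the lowest state
    visited before [e]. *)
Lemma last_min_at k n (e : \bar R) : Y n = Some k ->
  (forall m i, (m < n)%N -> Y m = Some i -> (k < i)%N) -> (J n < e)%E ->
  (forall m i, (i < k)%N -> Y m = Some i -> (e <= J m)%E) ->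
  last_min_time X e w = J n /\ X (fine (J n)) w = Some k.
Proof.
move=> Yn above Jne h.
case E : (J n) => [u||]; last 2 first.
- by move: Jne; rewrite E ltNge leey.
- by have := jump_time_ge0 n; rewrite E.
have u0 : 0 <= u by rewrite -lee_fin -E jump_time_ge0.
have Xu : X u w = Some k by rewrite -(jump_chainE E).
split => //; apply/eqP; rewrite eq_le; apply/andP; split.
- apply: ge_ereal_sup => _ [t [t0 te tmin] <-].
  rewrite leNgt; apply/negP; rewrite lte_fin => ut.
  have := tmin u; rewrite u0 ut Xu => /(_ isT).
  case Xt : (X t w) => [i|]//= ik.
  have [m [v [Jm vt tJ Ym]]] := state_someP t0 Xt.
  have := h _ _ ik Ym; rewrite Jm leNgt => /negP; apply.
  by apply: le_lt_trans te; rewrite lee_fin.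
- apply: ereal_sup_ubound; exists u => //; split => //; first by rewrite -E.
  move=> s /andP[s0 su]; rewrite Xu.
  have sz : (s%:E < explosion_time X w)%E.
    by apply: lt_trans (jump_before_explosion E); rewrite lte_fin.
  have [m [v [Jm vs sJ]]] := jump_cover s0 sz.
  rewrite (state_between Jm vs sJ); have [i Yi] := jump_chain_some m; rewrite Yi /=.
  apply: (above m) => //.
  rewrite ltnNge; apply/negP => /jump_time_le; rewrite E Jm lee_fin => uv.
  by move: su; rewrite ltNge (le_trans uv).
Qed.

(** The lowest level visited before [e] exists because levels are natural
    numbers, and the minimum occurs at its first visit. *)
Lemma last_min_exists (e : \bar R) : (0 < e)%E -> exists k n,
  [/\ Y n = Some k, forall m i, (m < n)%N -> Y m = Some i -> (k < i)%N,
      (J n < e)%E & forall m i, (i < k)%N -> Y m = Some i -> (e <= J m)%E].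
Proof.
move=> e0.
pose A k := `[< exists2 n, Y n = Some k & (J n < e)%E >].
have [x Y0] := jump_chain_some 0.
have Ax : A x by apply/asboolP; exists 0%N.
case: (ex_minnP (ex_intro _ x Ax)) => k /asboolP[n0 Yn0 Jn0] kmin.
have ex : exists n, Y n == Some k by exists n0; apply/eqP.
case: (ex_minnP ex) => n /eqP Yn nmin.
have Jne : (J n < e)%E by apply: le_lt_trans Jn0; apply/jump_time_le/nmin/eqP.
exists k, n; split => // m i.
- move=> mn Ym; rewrite ltn_neqAle; apply/andP; split.
    apply/eqP => ki; have /nmin : Y m == Some k by rewrite Ym ki.
    by rewrite leqNgt mn.
  apply: kmin; apply/asboolP; exists m => //.
  by apply: le_lt_trans Jne; apply: jump_time_le; exact: ltnW.
- move=> ik Ym; rewrite leNgt; apply/negP => Jme.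
  have /kmin : A i by apply/asboolP; exists m.
  by rewrite leqNgt ik.
Qed.

(** A jump at time [+oo] does not change the state, so a state entered for the
    first time is entered in finite time. *)
Lemma first_hit_finite k n : first_hit k n (jump_record X w) -> (J n < +oo)%E.
Proof.
case: n => [|n] [sn hit]; first by rewrite ltry.
rewrite ltey; apply/eqP => Jn; apply: (hit n) => //; rewrite -sn.
rewrite -[LHS]/(odflt 0%N (Y n)) -[RHS]/(odflt 0%N (Y n.+1)).
by rewrite (jump_chain_stop Jn).
Qed.

Section SkipFree.
Variable x : nat.
Hypothesis Y0 : Y 0 = Some x.
Hypothesis skipfree : forall n i j, Y n = Some i -> Y n.+1 = Some j ->
  (i <= j.+1)%N.

(** The step that leaves the states above [k] cannot overshoot [k]. *)
Lemma skipfree_hits m n i j k : (m <= n)%N -> Y m = Some i -> Y n = Some j ->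
  (j <= k <= i)%N -> exists2 l, (m <= l <= n)%N & Y l = Some k.
Proof.
move=> mn; elim: n mn j => [|n IH] mn j Ym Yn /andP[jk ki].
  exists 0%N; first by rewrite mn.
  move: mn Ym; rewrite leqn0 => /eqP->; rewrite Yn => -[ij].
  by congr Some; apply/eqP; rewrite eqn_leq jk /= ij.
move: mn; rewrite leq_eqVlt => /predU1P[mn|].
  exists n.+1; first by rewrite mn leqnn.
  move: Ym; rewrite mn Yn => -[ij].
  by congr Some; apply/eqP; rewrite eqn_leq jk /= ij.
rewrite ltnS => mn; have [h Yh] := jump_chain_some n.
have [hk|kh] := leqP h k.
  have [l /andP[ml ln] Yl] := IH mn h Ym Yh (introT andP (conj hk ki)).
  by exists l => //; rewrite ml leqW.
have := skipfree Yh Yn => hj; exists n.+1; first by rewrite leqnn (leq_trans mn).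
by rewrite Yn; congr Some; apply/eqP; rewrite eqn_leq jk -ltnS (leq_trans kh).
Qed.

Lemma first_hit_chain k n : first_hit k n (jump_record X w) ->
  Y n = Some k /\ forall m, (m < n)%N -> Y m <> Some k.
Proof.
move=> [] /=; have [i ->] := jump_chain_some n => /= -> h; split=> // m /h.
by move=> + E; rewrite /= E.
Qed.

Lemma first_hit_above k n : (k <= x)%N -> first_hit k n (jump_record X w) ->
  forall m i, (m < n)%N -> Y m = Some i -> (k < i)%N.
Proof.
move=> kx /first_hit_chain[Yn hit] m i mn Ym.
rewrite ltnNge; apply/negP => ik.
have [l /andP[_ lm] Yl] := skipfree_hits (leq0n m) Y0 Ym (introT andP (conj ik kx)).
exact: hit (leq_ltn_trans lm mn) Yl.
Qed.

(** The lower levels are reached through [k - 1], so that [undershoot_time] is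
    the delay between the first visit of [k] and the first visit of any of
    them. *)
Lemma before_undershootP k n (e : \bar R) : (k <= x)%N ->
  first_hit k n (jump_record X w) -> (J n < e)%E ->
  ((e <= J n + undershoot_time k (shift n (jump_record X w)))%E <->
   forall m i, (i < k)%N -> Y m = Some i -> (e <= J m)%E).
Proof.
move=> kx hit Jne; have [Yn _] := first_hit_chain hit.
have Jfin : J n \is a fin_num.
  by rewrite ge0_fin_numE ?jump_time_ge0// (lt_le_trans Jne) ?leey.
case: k => [|k] in kx hit Yn *; first by rewrite /= addey ?leey//; case: (J n) Jfin.
rewrite /= -leeBlDl//; split => [h m i ik Ym|h].
- have nm : (n <= m)%N.
    rewrite leqNgt; apply/negP => mn; have := first_hit_above kx hit mn Ym.
    by rewrite ltnNge ltnW.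
  have [l /andP[nl lm] Yl] := skipfree_hits (k:=k) nm Yn Ym ltac:(by rewrite -ltnS ik leqnSn).
  apply: le_trans (jump_time_le lm).
  move: h; rewrite leeBlDl// => h; apply: le_trans h _.
  rewrite -[in leRHS](subnKC nl) -[in leRHS]elapsed_jump_record elapsedD.
  rewrite elapsed_jump_record leeD2l//; apply: ereal_inf_lbound.
  by exists (l - n)%N => //=; rewrite subnKC// Yl.
- apply: le_ereal_inf_tmp => _ [m /= Ym] <-.
  rewrite leeBlDl// -elapsed_jump_record -elapsedD elapsed_jump_record.
  apply: (h _ k) => //; case: (jump_chain_some (n + m)) Ym => i Ei.
  by rewrite Ei /= => <-.
Qed.

(** The last minimum is thereby described by a first hitting time and by a
    functional of the future after it, which is the form that the Markov
    property requires. *)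
Lemma last_min_skipfree k n (e : \bar R) : (k <= x)%N ->
  (Y n = Some k /\ (forall m i, (m < n)%N -> Y m = Some i -> (k < i)%N) /\
   (J n < e)%E /\ (forall m i, (i < k)%N -> Y m = Some i -> (e <= J m)%E)) <->
  [/\ first_hit k n (jump_record X w), (J n < e)%E &
      (e <= J n + undershoot_time k (shift n (jump_record X w)))%E].
Proof.
move=> kx; split=> [[Yn [above [Jne h]]]|[hit Jne h]].
  have hit : first_hit k n (jump_record X w).
    split; first by rewrite /= Yn.
    move=> m mn /=; have [i Ei] := jump_chain_some m; rewrite Ei /= => ik.
    by have := above m i mn Ei; rewrite ik ltnn.
  by split => //; apply/before_undershootP.
split; first by case: (first_hit_chain hit).
split; first exact: (first_hit_above kx hit).
by split => //; apply/(before_undershootP kx hit Jne).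
Qed.

End SkipFree.
End MinimalPaths.

(** * Measurability of the jump record *)

Section RecordSpace.
Context {R : realType}.

(** These sets form a pi-system on which the law of the jump chain and of the
    holding times is prescribed; it generates the sigma-algebra of the records.
    A negative [t k] puts no constraint on the k-th holding time. *)
Definition cylinder (n : nat) (i : nat -> nat) (t : nat -> R) : set (@record R) :=
  [set s | forall k, (k < n)%N ->
     (s k).1 = i k /\ ((t k)%:E < `|(s k).2|)%E].

Definition cylinders : set (set (@record R)) :=
  [set C | C = set0 \/ exists n i t, C = cylinder n i t].

Definition record_space := g_sigma_algebraType cylinders.

Lemma setI_closed_cylinders : setI_closed cylinders.
Proof.
move=> A B [->|[n [i [t ->]]]]; first by rewrite set0I; left.
case=> [->|[m [j [u ->]]]]; first by rewrite setI0; left.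
have [E|/asboolPn ne] := pselect (forall k, (k < minn n m)%N -> i k = j k); last first.
  left; rewrite -subset0 => s [/= sn sm]; move: ne => /asboolPn; apply => k.
  by rewrite leq_min => /andP[/sn[<- _] /sm[<- _]].
right; exists (maxn n m), (fun k => if (k < n)%N then i k else j k),
  (fun k => Num.max (if (k < n)%N then t k else u k)
                    (if (k < m)%N then u k else t k)).
apply/seteqP; split=> [s [/= sn sm] k|s /= h].
  rewrite leq_max; case: ifPn => [kn _|nk /= km].
    have [-> tk] := sn _ kn; split => //.
    case: ifPn => [/sm[_ uk]|_]; last by rewrite maxxx.
    by rewrite EFin_max gt_max tk uk.
  by have [-> uk] := sm _ km; split => //; rewrite km maxxx.
split=> k k_lt; have := h k; rewrite leq_max k_lt ?orbT /= => /(_ isT)[-> H]; split => //.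
  by apply: le_lt_trans H; rewrite lee_fin le_max lexx.
case: ifPn => // kn; apply: E; first by rewrite leq_min kn.
by apply: le_lt_trans H; rewrite lee_fin le_max lexx orbT.
Qed.

Lemma measurable_cylinder n i t : measurable (cylinder n i t : set record_space).
Proof. by apply: sub_sigma_algebra; right; exists n, i, t. Qed.

Lemma measurable_coord_gt n i (c : R) :
  measurable [set s : record_space | (s n).1 = i /\ (c%:E < `|(s n).2|)%E].
Proof.
pose F (l : seq nat) : set record_space :=
  cylinder n.+1 (fun k => if k == n then i else nth 0%N l k)
                (fun k => if k == n then c else -1).
rewrite (_ : [set _ | _] = \bigcup_l F l).
  by apply: countable_bigcupT_measurable => [|l]; [exact: countableP|exact: measurable_cylinder].
apply/seteqP; split=> [s /= [si sc]|s [l _]].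
  exists (mkseq (fun k => (s k).1) n) => //= k; rewrite ltnS => kn.
  have [->//|nk] := eqVneq k n.
  rewrite nth_mkseq; last by rewrite ltn_neqAle nk.
  by split => //; apply: lt_le_trans (abse_ge0 _); rewrite lte_fin ltrN10.
by move/(_ n (leqnn _)); rewrite eqxx.
Qed.

Lemma measurable_coord_state n (B : set nat) :
  measurable [set s : record_space | B (s n).1].
Proof.
rewrite (_ : [set _ | _] = \bigcup_(i in B)
   [set s : record_space | (s n).1 = i /\ ((-1)%:E < `|(s n).2|)%E]).
  by apply: bigcup_measurable => i _; exact: measurable_coord_gt.
apply/seteqP; split=> [s /= Bs|s [i Bi [/= -> _]]//].
by exists (s n).1 => //; split => //; apply: lt_le_trans (abse_ge0 _); rewrite lte_fin ltrN10.
Qed.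

Lemma measurable_coord_time n :
  measurable_fun setT (fun s : record_space => `|(s n).2|%E : \bar R).
Proof.
apply: (measurability _ (ErealGenOInfty.measurableE R)) => _ /= -[_ [c ->] <-].
rewrite setTI.
rewrite (_ : _ @^-1` _ = \bigcup_i
   [set s : record_space | (s n).1 = i /\ (c%:E < `|(s n).2|)%E]).
  by apply: bigcup_measurable => i _; exact: measurable_coord_gt.
apply/seteqP; split=> [s /=|s [i _ [_]]] /=; rewrite in_itv/= andbT //.
by exists (s n).1.
Qed.

Lemma measurable_elapsed n : measurable_fun setT (elapsed n : record_space -> \bar R).
Proof.
by apply: emeasurable_sum => j; exact: measurable_coord_time.
Qed.

Lemma measurable_first_hit k n : measurable (first_hit k n : set record_space).
Proof.
rewrite (_ : first_hit k n = [set s | [set k] (s n).1] `&`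
   \bigcap_(m in `I_n) [set s : record_space | (~` [set k]) (s m).1]).
  apply: measurableI; first exact: (@measurable_coord_state n [set k]).
  by apply: bigcap_measurableType => m _; exact: measurable_coord_state.
by apply/seteqP; split=> s [].
Qed.

Lemma measurable_hit_time k : measurable_fun setT (hit_time k : record_space -> \bar R).
Proof.
apply: (measurability _ (ErealGenInftyO.measurableE R)) => _ /= -[_ [c ->] <-].
rewrite setTI.
rewrite (_ : _ @^-1` _ = \bigcup_m
   ([set s : record_space | [set k] (s m).1] `&` [set s | elapsed m s < c%:E]%E)).
  apply: bigcup_measurable => m _; apply: measurableI.
    exact: measurable_coord_state.
  rewrite -[X in measurable X]setTI; apply: emeasurable_fun_infty_o => //.
  exact: measurable_elapsed.
apply/seteqP; split=> [s /=|s [m _ [/= sm sc]]] /=; rewrite in_itv/=.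
  by move=> /ereal_inf_lt[_ [m /= sm <-] sc]; exists m.
by apply: le_lt_trans sc; apply: ereal_inf_lbound; exists m.
Qed.

Lemma measurable_undershoot_time k :
  measurable_fun setT (undershoot_time k : record_space -> \bar R).
Proof. by case: k => [|k]; [exact: measurable_cst|exact: measurable_hit_time]. Qed.

(** A cylinder is a finite intersection of constraints on single coordinates. *)
Lemma measurable_to_record d (T : measurableType d) (f : T -> record_space) :
  (forall n i (c : R), measurable [set w | (f w n).1 = i /\ (c%:E < `|(f w n).2|)%E]) ->
  measurable_fun setT f.
Proof.
move=> mf; apply: (@measurability _ _ _ _ setT f cylinders) => //.
move=> _ [_ [->|[n [i [t ->]]]] <-]; first by rewrite preimage_set0 setI0.
rewrite setTI (_ : _ @^-1` _ = \bigcap_(k in `I_n)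
  [set w | (f w k).1 = i k /\ ((t k)%:E < `|(f w k).2|)%E]) //.
by apply: bigcap_measurableType => k _; exact: mf.
Qed.

Lemma measurable_shift n : measurable_fun setT (shift n : record_space -> record_space).
Proof. by apply: measurable_to_record => m i c; exact: measurable_coord_gt. Qed.

End RecordSpace.

Section ChainMeasurability.
Context {R : realType} {d : measure_display} {Omega : measurableType d}.
Variable X : R -> Omega -> option nat.
Hypothesis Xpath : minimal_cadlag X.
Hypothesis Xm : forall t n, 0 <= t -> measurable [set w | X t w = Some n].

Let X_right w t : 0 <= t -> exists2 e, 0 < e &
  forall s, t <= s < t + e -> X s w = X t w.
Proof.
move=> t0; have [/(_ t t0) [e /= e0 He] _ _] := Xpath w.
exists e => // s /andP[ts se]; have [->//|ne] := eqVneq s t.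
apply: He; last by rewrite lt_neqAle eq_sym ne.
by rewrite /= distrC ger0_norm ?subr_ge0// ltrBlDl.
Qed.

(** Reading a right-continuous path at a random time only takes rational times. *)
Let state_at_rat w t i : 0 <= t -> X t w = i <->
  exists2 q : rat, t < ratr q &
    forall r : rat, (t < ratr r) && (ratr r < ratr q :> R) -> X (ratr r) w = i.
Proof.
move=> t0; have [e e0 He] := X_right w t0; split=> [<-|[q tq Hq]].
  have /rat_in_itvoo[q] : t < t + e by rewrite ltrDl.
  rewrite in_itv/= => /andP[tq qe]; exists q => // r /andP[tr rq].
  by apply: He; rewrite ltW//= (lt_trans rq).
have /rat_in_itvoo[r] : t < Num.min (t + e) (ratr q) by rewrite lt_min ltrDl e0.
rewrite in_itv/= lt_min => /and3P[tr re rq].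
by rewrite -(Hq r) ?tr// He// (ltW tr).
Qed.

Lemma measurable_state_at (tau : Omega -> \bar R) i :
  measurable_fun setT tau -> (forall w, 0 <= tau w)%E ->
  measurable [set w | exists2 t, tau w = t%:E & X t w = Some i].
Proof.
move=> mtau tau0.
have mlt (r : R) : measurable [set w | (tau w < r%:E)%E].
  by rewrite -[X in measurable X]setTI; exact: emeasurable_fun_infty_o.
rewrite (_ : [set _ | _] = \bigcup_(q : rat) ([set w | (tau w < (ratr q : R)%:E)%E] `&`
  ~` (\bigcup_(r : rat) ([set w | (tau w < (ratr r : R)%:E)%E] `&`
      (if (ratr r < ratr q :> R) && (0 <= ratr r :> R)
       then ~` [set w | X (ratr r) w = Some i] else set0))))).
  apply: bigcupT_measurable_rat => q; apply: measurableI => //.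
  apply: measurableC; apply: bigcupT_measurable_rat => r; apply: measurableI => //.
  by case: ifPn => // /andP[_ r0]; apply: measurableC; exact: Xm.
apply/seteqP; split=> w /=.
  move=> [t Et Xt]; have t0 : 0 <= t by rewrite -lee_fin -Et.
  have [q tq Hq] := (state_at_rat w _ t0).1 Xt.
  exists q => //; split; first by rewrite /= Et lte_fin.
  move=> [r _ [/=]]; rewrite Et lte_fin => tr.
  by case: ifPn => // /andP[rq _] /=; apply; apply: Hq; rewrite tr.
move=> [q _ [/= tq H]]; case Et : (tau w) tq => [t||]// tq; last first.
  by have := tau0 w; rewrite Et.
have t0 : 0 <= t by rewrite -lee_fin -Et.
exists t => //; apply/(state_at_rat w _ t0); exists q; first by rewrite -lte_fin.
move=> r /andP[tr rq]; apply: contrapT => ne; apply: H; exists r => //; split.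
  by rewrite /= Et lte_fin.
by rewrite rq (ltW (le_lt_trans t0 tr)).
Qed.

(** Joint induction on the jump times and the states between them: the next jump
    time is below [c] if and only if the path has left its state at some
    rational time below [c]. *)
Lemma measurable_jump n :
  measurable_fun setT (jump_time X n) /\
  forall i, measurable [set w | jump_chain X n w = Some i].
Proof.
elim: n => [|n [mJ mY]]; first by split=> [|i]; [exact: measurable_cst|exact: Xm].
have mJS : measurable_fun setT (jump_time X n.+1).
  apply: (measurability _ (ErealGenInftyO.measurableE R)) => _ /= -[_ [c ->] <-].
  have -> : `]-oo, c%:E[%classic = [set y : \bar R | (y < c%:E)%E].
    by apply/seteqP; split=> y; rewrite /= in_itv.
  rewrite setTI.
  rewrite (_ : _ @^-1` _ = \bigcup_(q : rat)
    (if (ratr q < c) && (0 <= ratr q :> R) then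
      [set w | (jump_time X n w < (ratr q : R)%:E)%E] `&`
      \bigcup_i ([set w | jump_chain X n w = Some i] `\` [set w | X (ratr q) w = Some i])
     else set0)).
    apply: bigcupT_measurable_rat => q; case: ifPn => // /andP[_ q0].
    apply: measurableI.
      by rewrite -[X in measurable X]setTI; exact: emeasurable_fun_infty_o.
    by apply: bigcup_measurable => i _; apply: measurableD; [exact: mY|exact: Xm].
  apply/seteqP; split=> w.
    move=> /ereal_inf_lt[_ [s [Js Xs] <-]].
    rewrite lte_fin => sc.
    case E : (jump_time X n w) Js => [t||]//; last first.
      by have := jump_time_ge0 X w n; rewrite E.
    rewrite lee_fin => ts.
    have t0 : 0 <= t by rewrite -lee_fin -E jump_time_ge0.
    have s0 := le_trans t0 ts.
    have [e e0 He] := X_right w s0.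
    have /rat_in_itvoo[q] : s < Num.min (s + e) c by rewrite lt_min ltrDl e0.
    rewrite in_itv/= lt_min => /and3P[sq qe qc].
    exists q => //; rewrite qc (le_trans s0 (ltW sq)); split.
      by rewrite /= E lte_fin (le_lt_trans ts).
    have [i Yi] := jump_chain_some Xpath w n; exists i => //; split => //= Xq.
    apply: Xs; rewrite E /= -(jump_chainE E) Yi -Xq He//.
    by rewrite ltW.
  case=> q _; case: ifPn => // /andP[qc q0] [/= Jq [i _ [/= Yi Xi]]].
  apply: (@le_lt_trans _ _ (ratr q)%:E); last by rewrite lte_fin.
  apply: ereal_inf_lbound; exists (ratr q) => //; split; first exact: ltW.
  case E : (jump_time X n w) Jq => [t||]// Jq; last first.
    by have := jump_time_ge0 X w n; rewrite E.
  by rewrite /= -(jump_chainE E) Yi.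
split => // i.
rewrite (_ : [set _ | _] =
  [set w | exists2 t, jump_time X n.+1 w = t%:E & X t w = Some i] `|`
  ([set w | jump_time X n.+1 w = +oo%E] `&` [set w | jump_chain X n w = Some i])).
  apply: measurableU; last first.
    by apply: measurableI => //; rewrite -[X in measurable X]setTI; exact: (mJS _ [set +oo%E]).
  by apply: measurable_state_at => // w; exact: jump_time_ge0.
apply/seteqP; split=> w.
  move=> Yi; case E : (jump_time X n.+1 w) => [t||].
  - by left; exists t => //; rewrite -(jump_chainE E).
  - by right; split => //=; rewrite -(jump_chain_stop E).
  - by have := jump_time_ge0 X w n.+1; rewrite E.
case=> [[t Jt Xt]|[Jt Yt]]; first by rewrite /mkset (jump_chainE Jt).
by rewrite /mkset (jump_chain_stop Jt).
Qed.

Lemma measurable_holding_time n : measurable_fun setT (holding_time X n).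
Proof.
rewrite (_ : holding_time X n =
  fun w => if (jump_time X n w == +oo)%E then +oo%E
           else (jump_time X n.+1 w - jump_time X n w)%E).
  apply: measurable_fun_ifT => //.
    rewrite (_ : (fun _ => _) = (fun y : \bar R => y == +oo%E) \o jump_time X n) //.
    apply: measurableT_comp; last exact: (measurable_jump n).1.
    apply: (measurable_fun_bool true); rewrite setTI.
    rewrite (_ : _ @^-1` _ = [set +oo%E]); first exact: emeasurable_set1.
    by apply/seteqP; split=> y /= /eqP.
  by apply: emeasurable_funB; exact: (measurable_jump _).1.
apply/funext => w; rewrite /holding_time; case E: (jump_time X n w) => [t||]//.
by have := jump_time_ge0 X w n; rewrite E.
Qed.

(** Stated for an arbitrary sigma-algebra that makes the states measurable, so
    that it also applies to the sigma-algebra generated by the process. *)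
Lemma measurable_jump_record :
  measurable_fun setT (jump_record X : Omega -> record_space).
Proof.
apply: measurable_to_record => n i c /=.
apply: measurableI; last first.
  rewrite -[X in measurable X]setTI; apply: emeasurable_fun_o_infty => //.
  by apply: measurableT_comp => //; exact: measurable_holding_time.
rewrite [X in measurable X](_ : _ = [set w | jump_chain X n w = Some i]).
  exact: (measurable_jump n).2.
apply/seteqP; split=> w /=; last by move=> ->.
by have [j ->] := jump_chain_some Xpath w n => /= ->.
Qed.

End ChainMeasurability.

(** * Independence and exponential times *)

Section GenericMeasure.
Local Open Scope ereal_scope.
Context {R : realType}.

Lemma ray_measure_unique (m1 m2 : {measure set (\bar R) -> \bar R}) :
  m1 setT < +oo -> m1 setT = m2 setT ->
  (forall t : R, m1 [set u | t%:E < u] = m2 [set u | t%:E < u]) ->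
  forall A, measurable A -> m1 A = m2 A.
Proof.
move=> fin mT mray A mA.
pose G : set (set \bar R) :=
  [set A | A = setT \/ exists t : R, A = [set u | t%:E < u]].
have GE : @measurable _ (\bar R) = <<s G >>.
  apply/seteqP; split.
    rewrite [X in X `<=` _](ErealGenOInfty.measurableE R).
    apply: smallest_sub; first exact: smallest_sigma_algebra.
    move=> _ [t ->]; apply: sub_sigma_algebra; right; exists t.
    by apply/seteqP; split=> u /=; rewrite in_itv/= andbT.
  apply: smallest_sub; first exact: sigma_algebra_measurable.
  move=> _ [->|[t ->]] //.
  rewrite (_ : [set _ | _] = `]t%:E, +oo[%classic); first exact: emeasurable_itv.
  by apply/seteqP; split=> u /=; rewrite in_itv/= andbT.
apply: (measure_unique G (fun=> setT)) => //.
- move=> B C [->|[t ->]] [->|[s ->]]; rewrite ?setTI ?setIT.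
  + by left.
  + by right; exists s.
  + by right; exists t.
  + right; exists (Num.max t s); apply/seteqP; split=> u /=.
      by move=> [tu su]; rewrite EFin_max gt_max tu su.
    by rewrite EFin_max gt_max => /andP.
- by move=> _; left.
- by apply/seteqP; split=> // x _; exists 0%N.
- by move=> B [->|[t ->]].
Qed.

Lemma measurable_expeR : measurable_fun setT (@expeR R).
Proof.
apply: (measurability _ (ErealGenOInfty.measurableE R)) => _ /= -[_ [c ->] <-].
rewrite setTI.
have [c0|c0] := ltP c 0%R.
  rewrite (_ : _ @^-1` _ = setT) //; apply/seteqP; split=> // u _ /=.
  by rewrite in_itv/= andbT (lt_le_trans _ (expeR_ge0 _)).
have /expeR_total[y Ey] : 0 <= c%:E by rewrite lee_fin.
rewrite (_ : _ @^-1` _ = `]y, +oo[%classic); first exact: emeasurable_itv.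
by apply/seteqP; split=> u /=; rewrite !in_itv/= !andbT -Ey lte_expeR.
Qed.

Context d (T : measurableType d).

Lemma integral_mrestr (m : {measure set T -> \bar R}) (D : set T)
    (mD : measurable D) (f : T -> \bar R) :
  measurable_fun setT f -> (forall x, 0 <= f x) ->
  \int[mrestr m mD]_x f x = \int[m]_(x in D) f x.
Proof.
move=> mf f0; rewrite -(setUv D) ge0_integral_setU//=; last 3 first.
- exact: measurableC.
- by rewrite setUv.
- exact/disj_setPCl.
rewrite [X in X + _](eq_measure_integral m); last first.
  by move=> A mA AD; rewrite /= /mrestr setIidl.
rewrite [X in _ + X](eq_measure_integral mzero); last first.
  by move=> A mA AD; rewrite /= /mrestr /mzero; apply/(@eq_trans _ _ (m set0));
    [congr (m _); apply/disjoints_subset|rewrite measure0].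
by rewrite integral_measure_zero adde0.
Qed.

(** The joint law of independent variables is the product of their laws, and
    Tonelli's theorem applies to the latter. *)
Lemma integral_independent (m : probability T R) d1 d2
    (T1 : measurableType d1) (T2 : measurableType d2) (U : T -> T1) (V : T -> T2)
    (F : T1 * T2 -> \bar R) :
  measurable_fun setT U -> measurable_fun setT V ->
  (forall A B, measurable A -> measurable B ->
     m (U @^-1` A `&` V @^-1` B) = m (U @^-1` A) * m (V @^-1` B)) ->
  measurable_fun setT F -> (forall z, 0 <= F z) ->
  \int[m]_w F (U w, V w) = \int[m]_w \int[m]_w' F (U w, V w').
Proof.
move=> mU mV mUV mF F0.
pose U' : {mfun T >-> T1} := HB.pack U (isMeasurableFun.Build _ _ _ _ U mU).
pose V' : {mfun T >-> T2} := HB.pack V (isMeasurableFun.Build _ _ _ _ V mV).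
pose W w := (U w, V w).
have mW : measurable_fun setT W by exact: measurable_fun_pair.
pose W' : {mfun T >-> (T1 * T2)%type} := HB.pack W (isMeasurableFun.Build _ _ _ _ W mW).
transitivity (\int[distribution m W']_z F z).
  by rewrite ge0_integral_distribution.
have WE A : measurable A -> (distribution m U' \x distribution m V') A = distribution m W' A.
  by apply: product_measure_unique => B C mB mC; exact: mUV.
rewrite (eq_measure_integral (distribution m U' \x distribution m V')); last first.
  by move=> A mA _; rewrite /= -WE.
rewrite fubini_tonelli1//= ge0_integral_distribution//=; last 2 first.
- exact: measurable_fun_fubini_tonelli_F.
- by move=> y; apply: integral_ge0.
apply: eq_integral => w _; rewrite /= /fubini_F ge0_integral_distribution//=.
exact: measurableT_comp.
Qed.

End GenericMeasure.

(** Exponential times are given by their tails, so that [c = 0] stands for an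
    infinite time. *)
Section ExponentialLaw.
Local Open Scope ereal_scope.
Context {R : realType} d (T : measurableType d) (m : probability T R).
Variables (c : R) (U : T -> \bar R).
Hypothesis c_ge0 : (0 <= c)%R.
Hypothesis mU : measurable_fun setT U.
Hypothesis tailU : forall t : R, (0 <= t)%R ->
  m [set w | t%:E < U w] = (expR (- c * t))%:E.

(** Two finite measures on the extended line are compared here on the rays
    [t < u], where the identity is the functional equation of the exponential. *)
Lemma memoryless (z : R) (phi : \bar R -> \bar R) : (0 <= z)%R ->
  measurable_fun setT phi -> (forall u, 0 <= phi u) ->
  \int[m]_(w in [set w | z%:E < U w]) phi (U w - z%:E) =
  (expR (- c * z))%:E * \int[m]_(w in [set w | 0 < U w]) phi (U w).
Proof.
move=> z0 mphi phi0.
have mgt (t : \bar R) : measurable [set w | t < U w].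
  by rewrite -[X in measurable X]setTI; exact: emeasurable_fun_o_infty.
have mUz : measurable_fun setT (fun w => U w - z%:E).
  by apply: emeasurable_funB => //; exact: measurable_cst.
rewrite -(integral_mrestr m (mgt z%:E)); last 2 first.
- exact: measurableT_comp.
- by move=> w.
rewrite -(integral_mrestr m (mgt 0)); last 2 first.
- exact: measurableT_comp.
- by move=> w.
rewrite -[LHS](ge0_integral_pushforward mUz (mrestr m (mgt z%:E)) measurableT mphi)//.
rewrite -[X in _ * X](ge0_integral_pushforward mU (mrestr m (mgt 0)) measurableT mphi)//.
have e0 : (0 <= expR (- c * z))%R by exact: expR_ge0.
rewrite -[(expR _)]/((NngNum e0)%:num)%R.
rewrite -ge0_integral_mscale//.
apply: eq_measure_integral => A mA _; apply: ray_measure_unique mA.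
- rewrite /= /pushforward /mrestr /= preimage_setT setTI.
  by rewrite tailU// ltry.
- rewrite /= /pushforward /mscale /mrestr /= /mrestr !preimage_setT !setTI.
  by rewrite /pushforward preimage_setT setTI !tailU// mulr0 expR0 mule1.
- move=> t; rewrite /= /pushforward /mscale /mrestr /= /mrestr /pushforward.
  rewrite (_ : _ `&` _ = [set w | (Num.max t 0 + z)%:E < U w]); last first.
    apply/seteqP; split=> w /=; rewrite EFinN lteBrDr// -EFinD addr_maxl add0r;
      rewrite EFin_max gt_max; first by move=> [-> ->].
    by move=> /andP.
  rewrite (_ : _ `&` _ = [set w | (Num.max t 0)%:E < U w]); last first.
    apply/seteqP; split=> w /=; rewrite EFin_max gt_max; first by move=> [-> ->].
    by move=> /andP.
  have t0 : (0 <= Num.max t 0)%R by rewrite le_max lexx orbT.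
  by rewrite !tailU ?addr_ge0// -EFinM -expRD -mulrDr addrC.
Qed.

End ExponentialLaw.

Lemma is_derive_expR_scale {R : realType} (b x : R) :
  is_derive x 1 (fun t : R => - expR (- b * t)) (b * expR (- b * x)).
Proof.
have D : is_derive x 1 (fun t : R => - b * t) (- b).
  have := is_deriveZ (f:=id) (- b) (x:=x) (v:=1) (df:=1).
  by rewrite /GRing.scale /= mulr1; apply; exact: is_derive_id.
have := is_derive1_comp (is_derive_expR (- b * x)) D.
move=> /is_deriveN h; apply: (is_derive_eq h).
by rewrite /GRing.scale /=; ring.
Qed.

Lemma integral_exp_ray {R : realType} (b a : R) : 0 < b ->
  (\int[lebesgue_measure]_(t in `[a, +oo[) (b * expR (- b * t))%:E =
   (expR (- b * a))%:E)%E.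
Proof.
move=> b0.
have ce : continuous (fun t : R => expR (- b * t)).
  move=> z; apply: continuous_comp; last exact: continuous_expR.
  exact: mulrl_continuous.
rewrite (@ge0_continuous_FTC2y _ _ (fun t => - expR (- b * t)) _ 0).
- by rewrite sub0e EFinN oppeK.
- by move=> t _; rewrite mulr_ge0 ?expR_ge0// ltW.
- apply: continuous_subspaceT => t.
  by apply: cvgM; [exact: cvg_cst|exact: ce].
- rewrite -oppr0; apply: cvgN.
  rewrite (_ : (fun t => expR (- b * t)) =
    (fun z => expR (- z)) \o (fun z => b * z)); last by apply/funext => t /=; rewrite mulNr.
  apply: (@cvg_comp _ _ _ _ _ _ (pinfty_nbhs R)); last exact: cvgr_expR.
  exact: gt0_cvgMry.
- by move=> t _; have [] := is_derive_expR_scale b t.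
- by apply: cvgN; apply: cvg_at_right_filter; exact: ce.
- move=> t _; rewrite derive1E; have [_ ->] := is_derive_expR_scale b t; done.
Qed.

Section ExponentialLaplace.
Local Open Scope ereal_scope.
Context {R : realType} d (T : measurableType d) (m : probability T R).
Variables (c : R) (U : T -> \bar R).
Hypothesis c_gt0 : (0 < c)%R.
Hypothesis mU : measurable_fun setT U.
Hypothesis tailU : forall t : R, (0 <= t)%R ->
  m [set w | t%:E < U w] = (expR (- c * t))%:E.

Lemma measurable_expeR_scale (b : R) :
  measurable_fun setT (fun u : \bar R => expeR (- (b%:E * u))).
Proof.
apply: measurableT_comp; first exact: measurable_expeR.
apply: measurableT_comp; first exact: oppe_measurable.
exact: emeasurable_funM.
Qed.

Let mgt (t : \bar R) : measurable [set w | t < U w].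
Proof. by rewrite -[X in measurable X]setTI; exact: emeasurable_fun_o_infty. Qed.

Let mle (t : \bar R) : measurable [set w | U w <= t].
Proof. by rewrite -[X in measurable X]setTI; exact: emeasurable_fun_infty_c. Qed.

Lemma exp_law_pos : m (~` [set w | 0 < U w]) = 0.
Proof. by rewrite probability_setC// tailU// mulr0 expR0 subee. Qed.

Lemma exp_law_pos_integral (f : T -> \bar R) : measurable_fun setT f ->
  (forall w, 0 <= f w) -> \int[m]_(w in [set w | 0 < U w]) f w = \int[m]_w f w.
Proof.
move=> mf f0; rewrite [RHS](@ge0_negligible_integral _ _ _ m setT (~` [set w | 0 < U w])) //.
- by rewrite setTD setCK.
- exact: measurableC.
- exact: exp_law_pos.
Qed.

Let mU_le (t : R) : (0 <= t)%R ->
  m [set w | U w <= t%:E] = (1 - expR (- c * t))%:E.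
Proof.
move=> t0; rewrite (_ : [set w | U w <= t%:E] = ~` [set w | t%:E < U w]).
  by rewrite probability_setC// tailU.
by apply/seteqP; split=> w /=; [rewrite leNgt => /negP|move/negP; rewrite -leNgt].
Qed.

(** Writing [expR (- b U)] as the integral of [b expR (- b t)] over the [t >= U]
    and exchanging the integrals only involves the tail of [U]. *)
Let laplace_gt0 (b : R) : (0 < b)%R ->
  \int[m]_(w in [set w | 0 < U w]) expeR (- (b%:E * U w)) = (c / (c + b))%:E.
Proof.
move=> b0.
pose S : set (T * R) := [set z | (0 <= z.2)%R /\ U z.1 <= z.2%:E].
pose g (z : T * R) : \bar R := (b * expR (- b * z.2))%:E.
have g0 z : 0 <= (g \_ S) z.
  by apply: erestrict_ge0 => y _; rewrite lee_fin mulr_ge0 ?expR_ge0// ltW.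
have mS : measurable S.
  have -> : S = (setT `*` `[0%R, +oo[%classic) `&` [set z : T * R | U z.1 - z.2%:E <= 0].
    by apply/seteqP; split=> z /=; rewrite /S /= in_itv/= andbT EFinN leeBlDr// add0e; tauto.
  apply: measurableI; first exact: measurableX.
  rewrite -[X in measurable X]setTI; apply: emeasurable_fun_infty_c => //.
  apply: emeasurable_funB; first exact: measurableT_comp.
  by apply: measurableT_comp; [exact: EFin_measurable|exact: measurable_snd].
have mg : measurable_fun setT g.
  apply: measurableT_comp; first exact: EFin_measurable.
  apply: (measurableT_comp (f := fun t : R => (b * expR (- b * t))%R)); last exact: measurable_snd.
  apply: measurable_funM => //; apply: measurableT_comp; first exact: measurable_expR.
  exact: measurable_funM.
have mgS : measurable_fun setT (g \_ S) by apply/(measurable_restrictT g mS); exact: measurable_funTS.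
have := fubini_tonelli (m1 := m) (m2 := lebesgue_measure) _ mgS g0.
have -> : \int[m]_x \int[lebesgue_measure]_y (g \_ S) (x, y) =
    \int[m]_(w in [set w | 0 < U w]) expeR (- (b%:E * U w)).
  rewrite -exp_law_pos_integral; last 2 first.
  - exact: (@measurable_fun_fubini_tonelli_F _ _ _ _ _ lebesgue_measure _ mgS g0).
  - by move=> w; apply: integral_ge0 => t _.
  apply: eq_integral => w; rewrite inE /= => Uw.
  rewrite (_ : (fun y => _) = (fun t => (b * expR (- b * t))%:E) \_ [set t | S (w, t)]); last first.
    by apply/funext => t; rewrite /patch; congr (if _ then _ else _);
       apply/idP/idP; rewrite !inE.
  rewrite -integral_mkcond; case E : (U w) Uw => [u||]// Uw.
  - rewrite /= -mulNr -(integral_exp_ray u b0); congr (integral _ _ _).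
    apply/seteqP; split=> t; rewrite /S /= E in_itv/= andbT lee_fin; first by case.
    by move=> ut; split => //; apply: le_trans ut; rewrite ltW.
  - rewrite gt0_muley ?lte_fin//= (_ : [set t | _] = set0) ?integral_set0//.
    by apply/seteqP; split=> t //=; rewrite /S /= E => -[_]; rewrite leye_eq.
move=> ->.
have -> : \int[lebesgue_measure]_y \int[m]_x (g \_ S) (x, y) =
   \int[lebesgue_measure]_(t in `[0%R, +oo[) (b * expR (- b * t) * (1 - expR (- c * t)))%:E.
  rewrite [RHS]integral_mkcond; apply: eq_integral => t _.
  rewrite patchE; case: ifPn => [|]; rewrite ?inE ?notin_setE /= in_itv/= andbT.
    move=> t0.
    rewrite (_ : (fun x => _) = (fun w => (b * expR (- b * t))%:E * (\1_[set w : T | (U w <= t%:E)%E] w)%:E)).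
      rewrite ge0_integralZl_EFin//=; last 2 first.
      - by apply/measurable_EFinP; exact: measurable_indic.
      - by rewrite mulr_ge0 ?expR_ge0// ltW.
      rewrite integral_indic// setIT [in RHS]EFinM; congr (_ * _).
      exact: mU_le.
    apply/funext => w; rewrite /patch indicE.
    rewrite (_ : ((w, t) \in S) = (w \in [set w | U w <= t%:E])).
      by case: (_ \in _); rewrite ?mule1 ?mule0.
    by apply/idP/idP; rewrite !inE /S /=; [case|].
  move=> t0; rewrite (_ : (fun x => _) = cst 0) ?integral0//.
  by apply/funext => w; rewrite patchE ifF//; apply/negP; rewrite inE => -[/t0].
have ray (r : R) : (0 < r)%R ->
    \int[lebesgue_measure]_(t in `[0%R, +oo[) (r * expR (- r * t))%:E = 1.
  by move=> r0; rewrite integral_exp_ray// mulr0 expR0.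
have mexp (r s : R) : measurable_fun (`[0%R, +oo[%classic : set R) (fun t : R => (r * expR (- s * t))%:E).
  apply: measurable_funTS; apply: measurableT_comp; first exact: EFin_measurable.
  apply: measurable_funM => //; apply: measurableT_comp; first exact: measurable_expR.
  exact: measurable_funM.
have := ray b b0.
rewrite (_ : (fun t => _) = (fun t => (b * expR (- b * t) * (1 - expR (- c * t)))%:E
    + (b * expR (- (c + b) * t))%:E)); last first.
  by apply/funext => t; rewrite -EFinD opprD mulrDl expRD; congr EFin; ring.
have t1 (t : R) : (0 <= t)%R -> (0 <= 1 - expR (- c * t))%R.
  by move=> t0; rewrite subr_ge0 -expR0 ler_expR mulNr oppr_le0 mulr_ge0// ltW.
rewrite ge0_integralD//=; last 4 first.
- by move=> t; rewrite /= in_itv/= andbT => t0; rewrite lee_fin mulr_ge0 ?t1// mulr_ge0 ?expR_ge0// ltW.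
- rewrite (_ : (fun t => _) = (fun t => (b * expR (- b * t))%:E + (- b * expR (- (c + b) * t))%:E)).
    by have := emeasurable_funD (mexp b b) (mexp (- b)%R (c + b)%R).
  by apply/funext => t; rewrite -EFinD opprD mulrDl expRD; congr EFin; ring.
- by move=> t _; rewrite lee_fin mulr_ge0 ?expR_ge0// ltW.
- exact: mexp.
have cb0 : (0 < c + b)%R by rewrite addr_gt0.
rewrite (_ : (fun t => (b * expR (- (c + b) * t))%:E) =
   fun t => (b / (c + b))%:E * ((c + b) * expR (- (c + b) * t))%:E); last first.
  by apply/funext => t; rewrite -EFinM; congr EFin; field; rewrite gt_eqF.
rewrite ge0_integralZl_EFin//=; last 3 first.
- by move=> t _; rewrite lee_fin mulr_ge0 ?expR_ge0// ltW.
- exact: mexp.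
- by rewrite divr_ge0// ltW.
rewrite ray// mule1 => /esym/eqP; rewrite -sube_eq//; last by rewrite fin_num_adde_defl.
move=> /eqP <-; rewrite -EFinB; congr EFin; field; by rewrite gt_eqF.
Qed.

Lemma exp_law_laplace (b : R) : (0 <= b)%R ->
  \int[m]_(w in [set w | 0 < U w]) expeR (- (b%:E * U w)) = (c / (c + b))%:E.
Proof.
rewrite le_eqVlt => /predU1P[<-|]; last exact: laplace_gt0.
under eq_integral do rewrite mul0e oppe0 expeR0.
rewrite integral_cst//= mul1e addr0 divff ?gt_eqF//.
by rewrite tailU// mulr0 expR0.
Qed.

(** The part of the transform beyond [z] is, by lack of memory, a multiple of
    the whole transform. *)
Lemma exp_law_laplace_le (b : R) (z : \bar R) : (0 <= b)%R -> 0 <= z ->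
  \int[m]_(w in [set w | 0 < U w /\ U w <= z]) expeR (- (b%:E * U w)) =
  (c / (c + b))%:E * (1 - expeR (- ((c + b)%:E * z))).
Proof.
move=> b0 z0; have cb0 : (0 < c + b)%R by rewrite ltr_pwDl.
have mf : measurable_fun setT (fun w => expeR (- (b%:E * U w))).
  by apply: (measurableT_comp (measurable_expeR_scale b)).
case: z z0 => [z||]// z0; last first.
  rewrite gt0_muley ?lte_fin//= sube0 mule1 -(exp_law_laplace b0).
  congr (integral _ _ _); apply/seteqP; split=> w /=; first by case.
  by move=> ->; rewrite leey.
rewrite lee_fin in z0.
have := exp_law_laplace b0.
rewrite (_ : [set w | 0 < U w] = [set w | 0 < U w /\ U w <= z%:E] `|` [set w | z%:E < U w]); last first.
  apply/seteqP; split=> w /=.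
    by move=> Uw; have [|] := leP (U w) z%:E; [left|right].
  by move=> [[]//|]; apply: le_lt_trans; rewrite lee_fin.
rewrite ge0_integral_setU//=; last 4 first.
- exact: (measurableI _ _ (mgt 0) (mle z%:E)).
- exact: measurable_funTS.
- by move=> w _; exact: expeR_ge0.
- rewrite disj_set2E; apply/eqP/seteqP; split=> w //= [[_ h1] h2].
  by move: h1; rewrite leNgt h2.
have -> : \int[m]_(w in [set w | z%:E < U w]) expeR (- (b%:E * U w)) =
    (expR (- (c + b) * z))%:E * (c / (c + b))%:E.
  transitivity (\int[m]_(w in [set w | z%:E < U w])
      (fun u => (expR (- b * z))%:E * expeR (- (b%:E * u))) (U w - z%:E)).
    apply: eq_integral => w; rewrite inE /= => zU.
    case: (U w) zU => [u||]//= zu.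
      by rewrite -EFinM -expRD; congr EFin; congr expR; ring.
    move: b0; rewrite le_eqVlt => /predU1P[<-|b0].
      by rewrite !mul0e oppe0 oppr0 mul0r expeR0 expR0 mule1.
    by rewrite !gt0_muley ?lte_fin//= mule0.
  pose phi (u : \bar R) := (expR (- b * z))%:E * expeR (- (b%:E * u)).
  have mphi : measurable_fun setT phi.
    by apply: emeasurable_funM => //; exact: measurable_expeR_scale.
  have phi0 u : 0 <= phi u by rewrite mule_ge0 ?expeR_ge0// lee_fin expR_ge0.
  rewrite -[LHS]/(\int[m]_(w in [set w | z%:E < U w]) phi (U w - z%:E)).
  rewrite (memoryless mU tailU z0 mphi phi0) /phi.
  rewrite ge0_integralZl_EFin//=; last 2 first.
  - by move=> w _; exact: expeR_ge0.
  - exact: measurable_funTS.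
  by rewrite exp_law_laplace// muleA -EFinM -expRD opprD mulrDl.
move/esym/eqP; rewrite -sube_eq//; last by rewrite fin_num_adde_defl.
by move=> /eqP <-; rewrite -!EFinM; congr EFin; rewrite mulNr; ring.
Qed.

End ExponentialLaplace.

(** * The Markov property of the jump record *)

Local Notation image_measure m mf :=
  (measure_function_pushforward__canonical__measure_function_Measure m mf).

(** The law of a jump chain with transition matrix [Pi] together with
    exponential holding times of rates [c]; the maximum with [0] reflects that
    negative thresholds are no constraint. *)
Definition record_law {R : realType} (Pi : nat -> nat -> R) (c : nat -> R)
    (QQ : nat -> probability (@record_space R) R) : Prop :=
  forall x n (i : nat -> nat) (t : nat -> R),
  QQ x (cylinder n.+1 i t) =
  ((i 0%N == x)%:R * \prod_(k < n) Pi (i k) (i k.+1) *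
   \prod_(k < n.+1) expR (- c (i k) * Num.max 0 (t k)))%:E.

Section RecordLaw.
Local Open Scope ereal_scope.
Context {R : realType} (Pi : nat -> nat -> R) (c : nat -> R).
Variable QQ : nat -> probability (@record_space R) R.
Hypothesis Pi_ge0 : forall x y, (0 <= Pi x y)%R.
Hypothesis QQE : record_law Pi c QQ.

Local Notation rec := (@record_space R).

Definition first_holding (s : rec) : \bar R := `|(s 0%N).2|.

Lemma measurable_first_holding : measurable_fun setT first_holding.
Proof. exact: measurable_coord_time. Qed.

Let mhold (t : R) : measurable [set s : rec | t%:E < first_holding s].
Proof.
rewrite -[X in measurable X]setTI; apply: emeasurable_fun_o_infty => //.
exact: measurable_first_holding.
Qed.

Let mstate n y : measurable [set s : rec | (s n).1 = y].
Proof. exact: (measurable_coord_state n [set y]). Qed.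

Let maxN1 : (Num.max 0 (-1) = 0 :> R)%R.
Proof. by rewrite max_l// lerN10. Qed.

Lemma record_measure_unique (m1 m2 : {measure set rec -> \bar R}) :
  m1 setT < +oo -> m1 setT = m2 setT ->
  (forall n i t, m1 (cylinder n.+1 i t) = m2 (cylinder n.+1 i t)) ->
  forall H, measurable H -> m1 H = m2 H.
Proof.
move=> fin mT mC H mH; have C0 i t : cylinder 0 i t = setT :> set (@record R).
  by apply/seteqP; split=> // s _ k.
apply: (@measure_unique _ R rec (@cylinders R) (fun=> setT)) => //.
- exact: setI_closed_cylinders.
- move=> _; right; exists 0%N, (fun=> 0%N), (fun=> 0%R); by rewrite C0.
- by apply/seteqP; split=> // s _; exists 0%N.
- by move=> _ [->|[[|n] [i [t ->]]]]; rewrite ?measure0 ?C0.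
Qed.

Lemma record_start_eq1 x : QQ x [set s | (s 0%N).1 = x] = 1.
Proof.
rewrite (_ : [set _ | _] = cylinder 1 (fun=> x) (fun=> (-1)%R)).
  rewrite QQE big_ord0 big_ord_recl big_ord0 eqxx !mul1r mulr1.
  by rewrite maxN1 mulr0 expR0.
apply/seteqP; split=> s /=; last by move/(_ 0%N erefl) => [].
move=> sx [|//] _; split => //.
by apply: lt_le_trans (abse_ge0 _); rewrite lte_fin ltrN10.
Qed.

Lemma record_start x (A : set rec) : measurable A ->
  QQ x A = QQ x (A `&` [set s | (s 0%N).1 = x]).
Proof.
move=> mA; rewrite -[in LHS](setIT A) -(setUv [set s : rec | (s 0%N).1 = x]).
have mS := mstate 0 x.
rewrite setIUr measureU; last 3 first.
- exact: measurableI.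
- by apply: measurableI => //; exact: measurableC.
- by rewrite setIACA setICr setI0.
rewrite [X in _ + X](_ : _ = 0) ?adde0//.
apply/eqP; rewrite -measure_le0.
apply: (@le_trans _ _ (QQ x (~` [set s | (s 0%N).1 = x]))).
  have mSC := measurableC mS.
  by apply: le_measure; rewrite ?inE//; exact: measurableI.
by rewrite probability_setC// record_start_eq1 subee.
Qed.

Lemma record_start_integral x (f : rec -> \bar R) : measurable_fun setT f ->
  (forall s, 0 <= f s) ->
  \int[QQ x]_s f s = \int[QQ x]_(s in [set s | (s 0%N).1 = x]) f s.
Proof.
move=> mf f0; rewrite -(integral_mrestr _ (mstate 0 x))//.
by apply: eq_measure_integral => A mA _; rewrite /= /mrestr -record_start.
Qed.

Lemma first_holding_tail x (t : R) :
  QQ x [set s | t%:E < first_holding s] = (expR (- c x * Num.max 0 t))%:E.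
Proof.
rewrite record_start// (_ : _ `&` _ = cylinder 1 (fun=> x) (fun=> t)).
  by rewrite QQE big_ord0 big_ord_recl big_ord0 eqxx !mul1r mulr1.
apply/seteqP; split=> s /=; last by move/(_ 0%N erefl) => [].
by move=> [sx st] [|].
Qed.

Let mshift := @measurable_shift R 1.

(** The defining formula is multiplicative in the first coordinate. *)
Lemma record_cons x n i u (t : R) :
  QQ x ([set s | t%:E < first_holding s] `&` shift 1 @^-1` cylinder n.+1 i u) =
  (expR (- c x * Num.max 0 t) * Pi x (i 0%N))%:E * QQ (i 0%N) (cylinder n.+1 i u).
Proof.
rewrite record_start; last first.
  by apply: measurableI => //; rewrite -[X in measurable X]setTI;
    apply: mshift => //; exact: measurable_cylinder.
rewrite (_ : _ `&` _ = cylinder n.+2 (fun k => if k is k'.+1 then i k' else x)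
                                (fun k => if k is k'.+1 then u k' else t)).
  rewrite !QQE big_ord_recl [X in (_ * X)%R]big_ord_recl /= !eqxx !mul1r -EFinM.
  by congr EFin; ring.
apply/seteqP; split=> s /=.
  by move=> [[st h] sx] [|k] kn; [split|have := h k kn].
move=> h; split; last by have [] := h 0%N erefl.
by split; [have [] := h 0%N erefl|move=> k kn; exact: (h k.+1 kn)].
Qed.

(** With the first holding time restricted to a ray, both sides are finite
    measures of the shifted record that agree on cylinders; then with the
    shifted record fixed, both sides are finite measures of the first holding
    time that agree on rays. *)
Lemma first_holding_shift_indep x (A : set (\bar R)) (H : set rec) : measurable A -> measurable H ->
  QQ x (first_holding @^-1` A `&` shift 1 @^-1` H) =
  QQ x (first_holding @^-1` A) * QQ x (shift 1 @^-1` H).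
Proof.
move=> mA mH.
have ray t : QQ x ([set s | t%:E < first_holding s] `&` shift 1 @^-1` H) =
    (expR (- c x * Num.max 0 t))%:E * QQ x (shift 1 @^-1` H).
  have e0 : (0 <= expR (- c x * Num.max 0 t))%R by exact: expR_ge0.
  have := @record_measure_unique
    (image_measure (mrestr (QQ x) (mhold t)) mshift)
    (mscale (NngNum e0) (image_measure (QQ x) mshift)).
  rewrite /= /mscale /= /pushforward /mrestr /= => h; rewrite setIC h//; clear h.
  - by rewrite preimage_setT setTI first_holding_tail ltry.
  - by rewrite preimage_setT setTI first_holding_tail probability_setT mule1.
  - move=> n i u; rewrite setIC record_cons EFinM -muleA; congr (_ * _).
    have := record_cons x n i u (-1).
    rewrite maxN1 mulr0 expR0 mul1r => <-.
    congr (QQ x _); apply/seteqP; split=> s /=; first by case.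
    by move=> h; split => //; apply: lt_le_trans (abse_ge0 _); rewrite lte_fin ltrN10.
have mH' : measurable (shift 1 @^-1` H : set rec).
  by rewrite -[X in measurable X]setTI; exact: mshift.
have fin : QQ x (shift 1 @^-1` H) \is a fin_num by exact: fin_num_measure.
have q0 : (0 <= fine (QQ x (shift 1 @^-1` H)))%R by exact: fine_ge0.
have := @ray_measure_unique R
  (image_measure (mrestr (QQ x) mH') measurable_first_holding)
  (mscale (NngNum q0) (image_measure (QQ x) measurable_first_holding)).
rewrite /= /mscale /= /pushforward /mrestr /= fineK// => /(_ _ _ _ A mA) ->//.
- by rewrite muleC.
- by rewrite preimage_setT setTI ltey_eq fin.
- by rewrite preimage_setT setTI probability_setT mule1.
- by move=> t; rewrite [LHS]ray [LHS]muleC -first_holding_tail.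
Qed.

(** The Markov property at the first jump, checked on cylinders. *)
Lemma next_state x y (H : set rec) : measurable H ->
  QQ x (shift 1 @^-1` H `&` [set s | (s 1%N).1 = y]) = (Pi x y)%:E * QQ y H.
Proof.
move=> mH.
have nxt : QQ x [set s | (s 1%N).1 = y] = (Pi x y)%:E.
  have := record_cons x 0 (fun=> y) (fun=> -1)%R (-1)%R.
  rewrite !QQE maxN1 !mulr0 expR0 mul1r.
  rewrite big_ord0 big_ord_recl big_ord0 eqxx !mulr1 mule1 => <-.
  congr (QQ x _); apply/seteqP; split=> s /=; last by case=> _ /(_ 0%N erefl)[].
  move=> sy; split; first by apply: lt_le_trans (abse_ge0 _); rewrite lte_fin ltrN10.
  move=> [|//] _; split => //.
  by apply: lt_le_trans (abse_ge0 _); rewrite lte_fin ltrN10.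
have := @record_measure_unique
  (image_measure (mrestr (QQ x) (mstate 1 y)) mshift)
  (mscale (NngNum (Pi_ge0 x y)) (QQ y)).
rewrite /= /mscale /= /pushforward /mrestr /= => /(_ _ _ _ H mH) ->//.
- by rewrite preimage_setT setTI nxt ltry.
- by rewrite preimage_setT setTI nxt probability_setT mule1.
- move=> n i u; have [iy|iy] := eqVneq (i 0%N) y; last first.
    rewrite (_ : _ `&` _ = set0) ?measure0 ?QQE ?(negbTE iy) ?mul0r ?mule0//.
    apply/seteqP; split=> s //= [/(_ 0%N erefl)[]] /= h _ h'.
    by move: iy; rewrite -h -h' eqxx.
  have := record_cons x n i u (-1)%R.
  rewrite maxN1 !mulr0 expR0 mul1r iy => <-.
  congr (QQ x _); apply/seteqP; split=> s [] /=.
    by move=> h sy; split => //; apply: lt_le_trans (abse_ge0 _); rewrite lte_fin ltrN10.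
  by move=> _ h; split => //; rewrite -iy; have [] := h 0%N erefl.
Qed.

Lemma next_integral x (f : rec -> \bar R) : measurable_fun setT f ->
  (forall s, 0 <= f s) ->
  \int[QQ x]_s f (shift 1 s) = \sum_(0 <= y <oo) (Pi x y)%:E * \int[QQ y]_s f s.
Proof.
move=> mf f0.
have mfs : measurable_fun setT (fun s : rec => f (shift 1 s)) by exact: (measurableT_comp mf mshift).
have cover : \bigcup_y [set s : rec | (s 1%N).1 = y] = setT.
  by apply/seteqP; split=> // s _; exists (s 1%N).1.
rewrite -{1}cover ge0_integral_bigcup//; last 2 first.
- by rewrite cover.
- by apply/trivIsetP => i j _ _ /eqP ij; apply/seteqP; split=> s //= [-> /ij].
apply: eq_eseriesr => y _.
rewrite -(integral_mrestr _ (mstate 1 y))//.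
rewrite -[LHS](ge0_integral_pushforward mshift (mrestr (QQ x) (mstate 1 y)) measurableT mf)//.
rewrite -[(Pi x y)]/((NngNum (Pi_ge0 x y))%:num)%R -ge0_integral_mscale//.
apply: eq_measure_integral => H mH _; rewrite /= /pushforward /mrestr /mscale /=.
exact: next_state.
Qed.

Lemma record_first_step x (Phi : \bar R * rec -> \bar R) :
  measurable_fun setT Phi -> (forall z, 0 <= Phi z) ->
  \int[QQ x]_s Phi (first_holding s, shift 1 s) =
  \sum_(0 <= y <oo) (Pi x y)%:E *
     \int[QQ x]_s \int[QQ y]_s' Phi (first_holding s, s').
Proof.
move=> mPhi Phi0.
rewrite (integral_independent measurable_first_holding mshift)//; last first.
  by move=> A H mA mH; exact: first_holding_shift_indep.
under eq_integral => s _.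
  rewrite (@next_integral x (fun s' => Phi (first_holding s, s'))); last 2 first.
  - exact: measurableT_comp.
  - by move=> s'.
  over.
have mI y : measurable_fun setT (fun s => \int[QQ y]_s' Phi (first_holding s, s')).
  by apply: (measurableT_comp (measurable_fun_fubini_tonelli_F (m2 := QQ y) _ mPhi Phi0));
    exact: measurable_first_holding.
rewrite integral_nneseries//; last 2 first.
- by move=> y; apply: emeasurable_funM => //; exact: measurable_cst.
- by move=> y s _; rewrite mule_ge0 ?lee_fin//; exact: integral_ge0.
apply: eq_eseriesr => y _; rewrite ge0_integralZl_EFin//.
by move=> s _; exact: integral_ge0.
Qed.

(** The first visit of [k] is followed through the number of jumps that it
    takes: passing to the shifted record lowers this number by one. *)
Section FirstHit.
Variable k : nat.

Lemma first_hitS n (s : rec) :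
  first_hit k n.+1 s <-> (s 0%N).1 <> k /\ first_hit k n (shift 1 s).
Proof.
split=> [[sk h]|[s0 [sk h]]].
  by split; [exact: (h 0%N)|split => // m mn; exact: (h m.+1)].
by split => // -[|m] mn; [|exact: h].
Qed.

Lemma elapsed_first_step n (s : rec) :
  elapsed n.+1 s = first_holding s + elapsed n (shift 1 s).
Proof. by rewrite -add1n elapsedD /elapsed big_ord_recl big_ord0 adde0. Qed.

Lemma first_hit_start n x f : measurable_fun setT f -> (forall s, 0 <= f s) ->
  \int[QQ x]_(s in first_hit k n) f s =
  \int[QQ x]_(s in first_hit k n `&` [set s | (s 0%N).1 = x]) f s.
Proof.
move=> mf f0; have mF := @measurable_first_hit R k n.
rewrite -(integral_mrestr _ mF)// -(integral_mrestr _ (measurableI _ _ mF (mstate 0 x)))//.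
apply: eq_measure_integral => A mA _; rewrite /= /mrestr [in RHS]setIA.
by apply: record_start; exact: measurableI.
Qed.

Lemma first_hit_step n x (Phi : \bar R * rec -> \bar R) : x <> k ->
  measurable_fun setT Phi -> (forall z, 0 <= Phi z) ->
  \int[QQ x]_(s in first_hit k n.+1) Phi (first_holding s, shift 1 s) =
  \sum_(0 <= y <oo) (Pi x y)%:E *
     \int[QQ x]_s \int[QQ y]_(s' in first_hit k n) Phi (first_holding s, s').
Proof.
move=> xk mPhi Phi0; have mF := @measurable_first_hit R k n.
pose D : set (\bar R * rec) := [set z | first_hit k n z.2].
have mD : measurable D.
  rewrite -[X in measurable X]setTI; exact: (@measurable_snd _ _ (\bar R) rec measurableT _ mF).
have mPhiD : measurable_fun setT (Phi \_ D).
  by apply/(measurable_restrictT _ mD); exact: measurable_funTS.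
have PhiD0 z : 0 <= (Phi \_ D) z by apply: erestrict_ge0.
rewrite first_hit_start; last 2 first.
- by apply: (measurableT_comp mPhi); apply: measurable_fun_pair;
    [exact: measurable_first_holding|exact: mshift].
- by move=> s.
rewrite (_ : _ `&` _ = [set s | first_hit k n (shift 1 s)] `&` [set s | (s 0%N).1 = x]); last first.
  apply/seteqP; split=> s [] /=; first by move=> /first_hitS[].
  by move=> h sx; split => //; apply/first_hitS; rewrite sx.
rewrite integral_mkcondl.
rewrite -[LHS](@record_start_integral x); last 2 first.
- rewrite (_ : _ \_ _ = fun s => (Phi \_ D) (first_holding s, shift 1 s)).
    by apply: (measurableT_comp mPhiD); apply: measurable_fun_pair;
      [exact: measurable_first_holding|exact: mshift].
  by apply/funext => s; rewrite /patch; congr (if _ then _ else _); apply/idP/idP; rewrite !inE.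
- by move=> s; apply: erestrict_ge0.
rewrite (_ : _ \_ _ = fun s => (Phi \_ D) (first_holding s, shift 1 s)); last first.
  by apply/funext => s; rewrite /patch; congr (if _ then _ else _); apply/idP/idP; rewrite !inE.
rewrite (record_first_step x mPhiD PhiD0).
apply: eq_eseriesr => y _; congr (_ * _).
apply: eq_integral => s _; rewrite [RHS]integral_mkcond; apply: eq_integral => s' _.
by rewrite /patch; congr (if _ then _ else _); apply/idP/idP; rewrite !inE.
Qed.

Lemma first_hit_atS n f : measurable_fun setT f -> (forall s, 0 <= f s) ->
  \int[QQ k]_(s in first_hit k n.+1) f s = 0.
Proof.
move=> mf f0; rewrite first_hit_start// (_ : _ `&` _ = set0) ?integral_set0//.
by apply/seteqP; split=> s //= [/first_hitS[h _] h']; exact: h.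
Qed.

(** The strong Markov property at the first visit of [k], by induction on the
    number of jumps.  The statement is general in [F] because the first holding
    time is absorbed into [F] in the induction step. *)
Lemma first_hit_markov n x (Z : rec -> \bar R) (F : \bar R * \bar R -> \bar R) :
  measurable_fun setT Z -> measurable_fun setT F -> (forall z, 0 <= F z) ->
  \int[QQ x]_(s in first_hit k n) F (elapsed n s, Z (shift n s)) =
  \int[QQ x]_(s in first_hit k n) \int[QQ k]_s' F (elapsed n s, Z s').
Proof.
move=> mZ mF F0.
have mE m := @measurable_elapsed R m.
have mS m := @measurable_shift R m.
have mL m G : measurable_fun setT G ->
    measurable_fun setT (fun s : rec => G (elapsed m s, Z (shift m s)) : \bar R).
  move=> mG; apply: (measurableT_comp mG); apply: measurable_fun_pair; first exact: mE.
  exact: (measurableT_comp mZ (mS m)).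
have mI G : measurable_fun setT G -> (forall z, 0 <= G z) ->
    measurable_fun setT (fun u : \bar R => \int[QQ k]_s' G (u, Z s')).
  move=> mG G0; apply: (@measurable_fun_fubini_tonelli_F _ _ _ _ _ (QQ k)
    (fun z => G (z.1, Z z.2)) _ _) => //.
  apply: (measurableT_comp mG); apply: measurable_fun_pair; first exact: measurable_fst.
  by apply: measurableT_comp => //; exact: measurable_snd.
have I0 G u : (forall z, 0 <= G z) -> 0 <= \int[QQ k]_s' G (u, Z s').
  by move=> G0; apply: integral_ge0 => s' _.
have mR m G : measurable_fun setT G -> (forall z, 0 <= G z) ->
    measurable_fun setT (fun s : rec => \int[QQ k]_s' G (elapsed m s, Z s')).
  by move=> mG G0; exact: (measurableT_comp (mI _ mG G0) (mE m)).
elim: n x F mF F0 => [|n IH] x F mF F0.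
  have [<-|xk] := pselect (x = k); last first.
    have e : first_hit k 0 `&` [set s : rec | (s 0%N).1 = x] = set0.
      by apply/seteqP; split=> s //= [[h _]]; rewrite h => /esym.
    rewrite (first_hit_start 0 x (mL 0%N F mF)); last by move=> s; exact: F0.
    rewrite (first_hit_start 0 x (mR 0%N F mF F0)); last by move=> s; exact: I0.
    by rewrite e !integral_set0.
  have e : first_hit x 0 = [set s : rec | (s 0%N).1 = x].
    by apply/seteqP; split=> s; [case|split].
  have e0 s : elapsed 0 s = 0 :> \bar R by rewrite /elapsed big_ord0.
  rewrite e; under [RHS]eq_integral do rewrite e0.
  rewrite integral_cst//= record_start_eq1 mule1.
  rewrite -(record_start_integral x (mL 0%N F mF)); last by move=> s; exact: F0.
  by apply: eq_integral => s _; rewrite e0.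
have [->|xk] := pselect (x = k).
  rewrite (first_hit_atS n (mL n.+1 F mF)); last by move=> s; exact: F0.
  by rewrite (first_hit_atS n (mR n.+1 F mF F0))// => s; exact: I0.
have mplus : measurable_fun setT (fun z : \bar R * rec => z.1 + elapsed n z.2).
  apply: emeasurable_funD; first exact: measurable_fst.
  by apply: measurableT_comp => //; exact: measurable_snd.
pose Phi1 (z : \bar R * rec) := F (z.1 + elapsed n z.2, Z (shift n z.2)).
pose Phi2 (z : \bar R * rec) := \int[QQ k]_s' F (z.1 + elapsed n z.2, Z s').
have mPhi1 : measurable_fun setT Phi1.
  apply: (measurableT_comp mF); apply: measurable_fun_pair => //.
  by apply: (measurableT_comp mZ); apply: (measurableT_comp (mS n)); exact: measurable_snd.
have mPhi2 : measurable_fun setT Phi2 by exact: (measurableT_comp (mI _ mF F0) mplus).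
have Phi10 z : 0 <= Phi1 z by exact: F0.
have Phi20 z : 0 <= Phi2 z by exact: I0.
transitivity (\int[QQ x]_(s in first_hit k n.+1) Phi1 (first_holding s, shift 1 s)).
  by apply: eq_integral => s _; rewrite /Phi1 /= elapsed_first_step shiftD.
transitivity (\int[QQ x]_(s in first_hit k n.+1) Phi2 (first_holding s, shift 1 s)); last first.
  by apply: eq_integral => s _; rewrite /Phi2 /= elapsed_first_step.
rewrite (first_hit_step n xk mPhi1 Phi10) (first_hit_step n xk mPhi2 Phi20).
apply: eq_eseriesr => y _; congr (_ * _); apply: eq_integral => s _.
have mF' : measurable_fun setT (fun z : \bar R * \bar R => F (first_holding s + z.1, z.2)).
  apply: (measurableT_comp mF); apply: measurable_fun_pair; last exact: measurable_snd.
  by apply: emeasurable_funD; [exact: measurable_cst|exact: measurable_fst].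
exact: (IH y _ mF').
Qed.

End FirstHit.

Lemma expeR_scaleD (q : R) (u v : \bar R) : (0 <= q)%R -> 0 <= u -> 0 <= v ->
  expeR (- (q%:E * (u + v))) = expeR (- (q%:E * u)) * expeR (- (q%:E * v)).
Proof.
move=> q0 u0 v0; rewrite -expeRD ge0_muleDr//; congr expeR.
move: q0; rewrite le_eqVlt => /predU1P[<-|q0]; first by rewrite !mul0e adde0 oppe0 adde0.
case: u u0 => [u||]// u0; case: v v0 => [v||]// v0;
  rewrite ?gt0_muley ?lte_fin//= ?opprD//.
Qed.

Lemma hit_timeE k n (s : rec) : first_hit k n s -> hit_time k s = elapsed n s.
Proof.
move=> [sn h]; apply/eqP; rewrite eq_le; apply/andP; split.
  by apply: ereal_inf_lbound; exists n.
apply: le_ereal_inf_tmp => _ [m /= sm <-]; apply: elapsed_le.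
by rewrite leqNgt; apply/negP => /h.
Qed.

Section HitTransform.
Variables (q : R) (k : nat).
Hypothesis q_ge0 : (0 <= q)%R.

(** The Laplace transform of the hitting time of [k], restricted to the records
    that hit [k] for the first time after exactly [n] jumps.  At [q = 0] the
    sum over [n] is the probability of ever hitting [k]. *)
Definition hit_transform_at n x : \bar R :=
  \int[QQ x]_(s in first_hit k n) expeR (- (q%:E * elapsed n s)).

Lemma hit_transform_at_ge0 n x : 0 <= hit_transform_at n x.
Proof. by apply: integral_ge0 => s _; exact: expeR_ge0. Qed.

Lemma hit_transform_at0 x : hit_transform_at 0 x = (x == k)%:R%:E.
Proof.
have m0 : measurable_fun setT (fun s : rec => expeR (- (q%:E * elapsed 0 s))).
  by apply: (measurableT_comp (measurable_expeR_scale q)); exact: measurable_elapsed.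
rewrite /hit_transform_at first_hit_start//; last by move=> s; exact: expeR_ge0.
have [->|xk] := eqVneq x k; last first.
  rewrite (_ : _ `&` _ = set0) ?integral_set0//.
  by apply/seteqP; split=> s //= [[h _]]; rewrite h => e; rewrite e eqxx in xk.
under eq_integral do rewrite /elapsed big_ord0 mule0 oppe0 expeR0.
rewrite (_ : _ `&` _ = [set s : rec | (s 0%N).1 = k]).
  by rewrite integral_cst//= mul1e record_start_eq1.
by apply/seteqP; split=> s [].
Qed.

Lemma hit_transform_at_self n : hit_transform_at n.+1 k = 0.
Proof.
apply: first_hit_atS; last by move=> s; exact: expeR_ge0.
by apply: (measurableT_comp (measurable_expeR_scale q)); exact: measurable_elapsed.
Qed.

(** The first-step equation: an exponential holding time of rate [c x] survives
    killing at rate [q] with probability [c x / (c x + q)]. *)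
Lemma hit_transform_atS n x : x <> k -> (0 < c x)%R ->
  hit_transform_at n.+1 x =
  \sum_(0 <= y <oo) (Pi x y * (c x / (c x + q)))%:E * hit_transform_at n y.
Proof.
move=> xk cx0; rewrite /hit_transform_at.
pose e (u : \bar R) := expeR (- (q%:E * u)).
have me : measurable_fun setT e by exact: measurable_expeR_scale.
have e0 u : 0 <= e u by exact: expeR_ge0.
have mel m : measurable_fun setT (fun s : rec => e (elapsed m s)).
  by apply: (measurableT_comp me); exact: measurable_elapsed.
have meh : measurable_fun setT (fun s : rec => e (first_holding s)).
  by apply: (measurableT_comp me); exact: measurable_first_holding.
pose Phi (z : \bar R * rec) := e z.1 * e (elapsed n z.2).
have mPhi : measurable_fun setT Phi.
  apply: emeasurable_funM; first exact: (measurableT_comp me measurable_fst).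
  exact: (measurableT_comp (mel n) measurable_snd).
have Phi0 z : 0 <= Phi z by rewrite mule_ge0.
transitivity (\int[QQ x]_(s in first_hit k n.+1) Phi (first_holding s, shift 1 s)).
  apply: eq_integral => s _; rewrite /Phi /= elapsed_first_step /e.
  exact: (expeR_scaleD q_ge0 (abse_ge0 _) (elapsed_ge0 _ _)).
rewrite (first_hit_step n xk mPhi Phi0).
apply: eq_eseriesr => y _; rewrite EFinM -muleA; congr (_ * _).
have mF := @measurable_first_hit R k n.
transitivity (\int[QQ x]_s (e (first_holding s) *
    \int[QQ y]_(s' in first_hit k n) e (elapsed n s'))).
  apply: eq_integral => s _; rewrite -(ge0_integralZl (QQ y) mF (measurable_funTS (mel n)))//.
rewrite (ge0_integralZr (QQ x) measurableT meh)//; last by exact: integral_ge0.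
congr (_ * _).
have tail t : (0 <= t)%R -> QQ x [set s | t%:E < first_holding s] = (expR (- c x * t))%:E.
  by move=> t0; rewrite first_holding_tail max_r.
rewrite -(exp_law_pos_integral measurable_first_holding tail)//.
exact: (exp_law_laplace cx0 measurable_first_holding tail q_ge0).
Qed.

Definition hit_transform x : \bar R := \sum_(0 <= n <oo) hit_transform_at n x.

Lemma trivIset_first_hit : trivIset setT (fun n => first_hit k n : set rec).
Proof.
apply/trivIsetP => i j _ _ ij; apply/seteqP; split=> s //= [[si hi] [sj hj]].
have [ij'|ji'|e] := ltngtP i j; [exact: hj ij' si|exact: hi ji' sj|].
by rewrite e eqxx in ij.
Qed.

Lemma hit_transformE x : hit_transform x =
  \int[QQ x]_(s in \bigcup_n first_hit k n) expeR (- (q%:E * hit_time k s)).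
Proof.
have me : measurable_fun setT (fun s : rec => expeR (- (q%:E * hit_time k s))).
  by apply: (measurableT_comp (measurable_expeR_scale q)); exact: measurable_hit_time.
rewrite ge0_integral_bigcup//.
- apply: eq_eseriesr => n _; apply: eq_integral => s.
  by rewrite inE => /hit_timeE ->.
- by move=> n; exact: measurable_first_hit.
- exact: measurable_funTS.
- by move=> s _; exact: expeR_ge0.
- exact: trivIset_first_hit.
Qed.

Lemma hit_transform_le1 x : hit_transform x <= 1.
Proof.
have mU : measurable (\bigcup_n first_hit k n : set rec).
  by apply: bigcup_measurable => n _; exact: measurable_first_hit.
rewrite hit_transformE; apply: (@le_trans _ _ (\int[QQ x]_(s in \bigcup_n first_hit k n) 1)).
  apply: ge0_le_integral => //.
  - by move=> s _; exact: expeR_ge0.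
  - apply: measurable_funTS.
    by apply: (measurableT_comp (measurable_expeR_scale q)); exact: measurable_hit_time.
  - move=> s _; rewrite -expeR0 lee_expeR oppe_le0 mule_ge0 ?lee_fin//.
    by apply: le_ereal_inf_tmp => _ [m _ <-]; exact: elapsed_ge0.
by rewrite integral_cst// mul1e probability_le1.
Qed.

Lemma hit_transform_ge0 x : 0 <= hit_transform x.
Proof. by apply: nneseries_ge0 => n _ _; exact: hit_transform_at_ge0. Qed.

Lemma hit_transform_self : hit_transform k = 1.
Proof.
rewrite /hit_transform nneseries_recl; [|move=> *; exact: hit_transform_at_ge0|by []].
rewrite hit_transform_at0 eqxx eseries0 ?adde0//; case=> [//|n _ _].
exact: hit_transform_at_self.
Qed.

End HitTransform.

Lemma next_null (H : set rec) : measurable H -> (forall y, QQ y H = 0) ->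
  forall x, QQ x (shift 1 @^-1` H) = 0.
Proof.
move=> mH H0 x.
have mH' : measurable (shift 1 @^-1` H : set rec).
  by rewrite -[X in measurable X]setTI; exact: mshift.
transitivity (\int[QQ x]_s (\1_H (shift 1 s))%:E).
  by rewrite -(setIT (_ @^-1` _)) -integral_indic.
have mI : measurable_fun setT (fun s : rec => (\1_H s)%:E : \bar R).
  by apply/measurable_EFinP; exact: measurable_indic.
rewrite (next_integral x mI); last by move=> s; rewrite lee_fin.
apply: eseries0 => y _ _.
have -> : \int[QQ y]_s (\1_H s)%:E = QQ y H by rewrite integral_indic// setIT.
by rewrite H0 mule0.
Qed.

Definition skipfree_record : set rec := [set s | forall n, ((s n).1 <= (s n.+1).1.+1)%N].

Let mjump n : measurable [set s : rec | ((s n).1 <= (s n.+1).1.+1)%N].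
Proof.
rewrite (_ : [set _ | _] = \bigcup_i ([set s : rec | (s n).1 = i] `&`
   [set s : rec | [set j | (i <= j.+1)%N] (s n.+1).1])).
  apply: bigcup_measurable => i _; apply: measurableI; first exact: mstate.
  exact: (measurable_coord_state n.+1 [set j | (i <= j.+1)%N]).
by apply/seteqP; split=> s /=; [move=> h; exists (s n).1|move=> [i _ [/= <-]]].
Qed.

Lemma measurable_skipfree_record : measurable skipfree_record.
Proof.
rewrite (_ : skipfree_record =
    \bigcap_n [set s : rec | ((s n).1 <= (s n.+1).1.+1)%N]).
  by apply: bigcapT_measurable => n; exact: mjump.
by apply/seteqP; split=> s h n; [move=> _; exact: h|exact: (h n I)].
Qed.

(** A forbidden jump at step [n] is a forbidden first jump of the record shifted
    by [n], and there are countably many steps. *)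
Lemma skipfree_record_as : (forall i j, (j.+1 < i)%N -> Pi i j = 0%R) ->
  forall x, QQ x (~` skipfree_record) = 0.
Proof.
move=> Pi0 x.
have jump n y : QQ y (~` [set s | ((s n).1 <= (s n.+1).1.+1)%N]) = 0.
  elim: n y => [|n IH] y; last first.
    have := @next_null _ (measurableC (mjump n)) IH y; apply: etrans.
    by congr (QQ y _).
  rewrite record_start; last exact: measurableC.
  rewrite (_ : _ `&` _ = \bigcup_(j in [set j | (j.+1 < y)%N])
     ([set s | (s 0%N).1 = y] `&` [set s | (s 1%N).1 = j])); last first.
    apply/seteqP; split=> s /=.
      by move=> [/negP + sy]; rewrite -ltnNge => h; exists (s 1%N).1; rewrite /= -?sy.
    by move=> [j /= jy [sy sj]]; split => //; rewrite sy sj; apply/negP; rewrite -ltnNge.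
  apply/eqP; rewrite -measure_le0 bigcup_mkcond.
  apply: (le_trans (measure_sigma_subadditive (QQ y) (F := _) _ _ (@subset_refl _ _))).
  - by move=> j; case: ifPn => // _; exact: measurableI.
  - apply: bigcupT_measurable => j; case: ifPn => // _; exact: measurableI.
  rewrite eseries0// => j _ _; case: ifPn; rewrite ?inE ?measure0//= => jy.
  rewrite setIC -record_start//.
  have := @next_state y j setT measurableT.
  by rewrite preimage_setT setTI Pi0// mul0e => ->.
rewrite (_ : ~` _ = \bigcup_n ~` [set s : rec | ((s n).1 <= (s n.+1).1.+1)%N]); last first.
  by rewrite -setC_bigcap; congr (~` _); apply/seteqP; split=> s h n; [move=> _; exact: h|exact: (h n I)].
apply/eqP; rewrite -measure_le0.
apply: (le_trans (measure_sigma_subadditive (QQ x) (F := _) _ _ (@subset_refl _ _))).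
- by move=> n; exact: measurableC.
- by apply: bigcupT_measurable => n; exact: measurableC.
by rewrite eseries0// => n _ _; exact: jump.
Qed.

End RecordLaw.

(** * The last strict minimum before an independent exponential time *)

Section ChainRecord.
Context {R : realType} {d : measure_display} {Omega : measurableType d}.
Variables (Q : nat -> nat -> R) (P : nat -> probability Omega R).
Variable X : R -> Omega -> option nat.
Hypothesis X_chain : minimal_chain Q P X.

Let mrec := measurable_jump_record (chain_path X_chain) (chain_measurable X_chain).

Definition chain_record : {mfun Omega >-> @record_space R} :=
  HB.pack (jump_record X : Omega -> @record_space R)
    (isMeasurableFun.Build _ _ _ _ (jump_record X : Omega -> @record_space R) mrec).

Definition chain_law (x : nat) : probability (@record_space R) R :=
  distribution (P x) chain_record.

Lemma chain_record_law :
  record_law (jump_matrix Q) (fun i => - Q i i) chain_law.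
Proof.
move=> x n i t; rewrite /= /distribution /pushforward /=.
have m0 k : 0 <= Num.max 0 (t k) by rewrite le_max lexx.
transitivity (P x [set w | forall k, (k <= n)%N -> jump_chain X k w = Some (i k) /\
    ((Num.max 0 (t k))%:E < holding_time X k w)%E]); last first.
  rewrite (chain_holding X_chain x n i m0) (chain_jump X_chain) -EFinM.
  by congr (_ * _)%:E; apply: eq_bigr => k _; rewrite opprK.
congr (P x _); apply/seteqP; split=> w h k kn; have := h k kn; rewrite /= => -[].
  have hp := holding_time_gt0 (chain_path X_chain) w k.
  have [j Ej] := jump_chain_some (chain_path X_chain) w k; rewrite Ej /= => -> tk.
  by split => //; rewrite EFin_max gt_max hp; rewrite gee0_abs ?ltW// in tk.
move=> -> /=; rewrite EFin_max gt_max => /andP[hp tk]; split => //.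
by rewrite gee0_abs ?ltW.
Qed.

End ChainRecord.

Section LastMinimum.
Local Open Scope ereal_scope.
Context {R : realType} {d : measure_display} {Omega : measurableType d}.
Variables (Q : nat -> nat -> R) (P : nat -> probability Omega R).
Variable X : R -> Omega -> option nat.
Hypothesis X_chain : minimal_chain Q P X.
Hypothesis Q_diag : forall i, (Q i i <= 0)%R.
Hypothesis Q_offdiag : forall i j, i <> j -> (0 <= Q i j)%R.
Hypothesis Q_skipfree : forall i j, (j.+1 < i)%N -> Q i j = 0%R.

Lemma jump_matrix_ge0 i j : (0 <= jump_matrix Q i j)%R.
Proof.
rewrite /jump_matrix; case: ifPn => // _; case: eqVneq => // /eqP ij.
by rewrite divr_ge0 ?Q_offdiag// oppr_ge0.
Qed.

Lemma jump_matrix_skipfree i j : (j.+1 < i)%N -> jump_matrix Q i j = 0%R.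
Proof.
move=> ji; have ij : (i == j) = false by apply/eqP => e; move: ji; rewrite e ltnNge leqnSn.
by rewrite /jump_matrix ij (Q_skipfree ji) mul0r; case: ifP.
Qed.

Local Notation Theta := (chain_record X_chain).
Local Notation QQ := (chain_law X_chain).
Local Notation rec := (@record_space R).

Let Xpath := chain_path X_chain.
Let QQlaw := chain_record_law X_chain.

Variables (q : R) (e : Omega -> \bar R).
Hypothesis q_ge0 : (0 <= q)%R.
Hypothesis me : measurable_fun setT e.
Hypothesis e_tail : forall x (t : R), (0 <= t)%R ->
  P x [set w | t%:E < e w] = (expR (- q * t))%:E.
Hypothesis e_indep : forall x (H : set rec) (B : set (\bar R)),
  measurable H -> measurable B ->
  P x (Theta @^-1` H `&` e @^-1` B) = P x (Theta @^-1` H) * P x (e @^-1` B).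

Let G w := last_min_time X (e w) w.
Let XG w := X (fine (G w)) w.
Let pairing w := (Theta w : rec, e w).

(** The event that the last minimum before [e] has the value [k] and occurs at
    the n-th jump, as a set of pairs of a record and a time; [hit_slice] is its
    form for skip-free records. *)
Definition min_slice (k n : nat) : set (rec * \bar R) :=
  [set z | [/\ (z.1 n).1 = k, forall m, (m < n)%N -> (k < (z.1 m).1)%N,
     elapsed n z.1 < z.2 & forall m, ((z.1 m).1 < k)%N -> z.2 <= elapsed m z.1]].

Definition hit_slice (k n : nat) : set (rec * \bar R) :=
  [set z | [/\ first_hit k n z.1, elapsed n z.1 < z.2 &
     z.2 <= elapsed n z.1 + undershoot_time k (shift n z.1)]].

Let mpairing : measurable_fun setT pairing.
Proof. by apply: measurable_fun_pair => //; exact: measurable_funP. Qed.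

Let m_elapsed1 n : measurable_fun setT (fun z : rec * \bar R => elapsed n z.1).
Proof. exact: (measurableT_comp (measurable_elapsed n) measurable_fst). Qed.

Let m_state1 n (B : set nat) : measurable [set z : rec * \bar R | B (z.1 n).1].
Proof.
rewrite -[X in measurable X]setTI.
exact: (@measurable_fst _ _ rec (\bar R) measurableT _ (measurable_coord_state n B)).
Qed.

Lemma measurable_min_slice k n : measurable (min_slice k n).
Proof.
rewrite (_ : min_slice k n = [set z | [set k] (z.1 n).1] `&`
  \bigcap_(m in `I_n) [set z | [set i | (k < i)%N] (z.1 m).1] `&`
  [set z | elapsed n z.1 < z.2] `&`
  \bigcap_m ([set z | [set i | (k <= i)%N] (z.1 m).1] `|` [set z | z.2 <= elapsed m z.1])).
  apply: measurableI; last first.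
    apply: bigcapT_measurable => m; apply: measurableU.
      exact: (m_state1 m [set i | (k <= i)%N]).
    by rewrite -[X in measurable X]setTI; apply: measurable_lee => //; exact: measurable_snd.
  apply: measurableI; last first.
    by rewrite -[X in measurable X]setTI; apply: measurable_lte => //; exact: measurable_snd.
  apply: measurableI; first exact: (m_state1 n [set k]).
  by apply: bigcap_measurableType => m _; exact: (m_state1 m [set i | (k < i)%N]).
apply/seteqP; split=> z /=.
  move=> [zn above ze below]; split; first by split.
  by move=> m _; have [km|mk] := leqP k (z.1 m).1; [left|right; exact: below].
move=> [[[zn above] ze] below]; split => // m mk.
by have [/=|//] := below m I; rewrite leqNgt mk.
Qed.

Lemma measurable_hit_slice k n : measurable (hit_slice k n).
Proof.
rewrite (_ : hit_slice k n = [set z | first_hit k n z.1] `&`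
  [set z | elapsed n z.1 < z.2] `&`
  [set z | z.2 <= elapsed n z.1 + undershoot_time k (shift n z.1)]); last first.
  by apply/seteqP; split=> z /=; [case|case=> -[]].
apply: measurableI; first apply: measurableI.
- rewrite -[X in measurable X]setTI.
  exact: (@measurable_fst _ _ rec (\bar R) measurableT _ (measurable_first_hit k n)).
- by rewrite -[X in measurable X]setTI; apply: measurable_lte => //; exact: measurable_snd.
- rewrite -[X in measurable X]setTI; apply: measurable_lee => //.
  apply: emeasurable_funD => //.
  apply: (measurableT_comp (measurable_undershoot_time k)).
  exact: (measurableT_comp (measurable_shift n) measurable_fst).
Qed.

Let ThetaE w n i : ((Theta w n).1 = i) <-> jump_chain X n w = Some i.
Proof.
rewrite /=; have [j ->] := jump_chain_some Xpath w n.
by split=> [/= ->|[]].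
Qed.

Lemma min_sliceP k n w : min_slice k n (pairing w) <->
  (jump_chain X n w = Some k /\
   (forall m i, (m < n)%N -> jump_chain X m w = Some i -> (k < i)%N) /\
   jump_time X n w < e w /\
   (forall m i, (i < k)%N -> jump_chain X m w = Some i -> e w <= jump_time X m w)).
Proof.
rewrite /min_slice /pairing /mkset.
have E m : elapsed m (Theta w) = jump_time X m w := elapsed_jump_record Xpath w m.
split=> [[/ThetaE Yn above Jn below]|[Yn [above [Jn below]]]].
  split => //; split=> [m i mn /ThetaE <-|]; first exact: above.
  split=> [|m i ik /ThetaE Ym]; first by rewrite -E.
  by rewrite -E; apply: below; rewrite Ym.
split; [exact/ThetaE|move=> m mn|by rewrite E|move=> m mk]; rewrite ?E.
  by apply: (above m) => //; exact/ThetaE.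
by apply: (below m _ mk); exact/ThetaE.
Qed.

Lemma min_slice_last k n w : min_slice k n (pairing w) ->
  G w = elapsed n (Theta w) /\ XG w = Some k.
Proof.
move=> /min_sliceP[Yn [above [Jn below]]].
have [Gw Xw] := last_min_at Xpath Yn above Jn below.
have E : elapsed n (Theta w) = jump_time X n w := elapsed_jump_record Xpath w n.
by rewrite /XG E /G Gw.
Qed.

Lemma min_slice_exists w : 0 < e w -> exists k n, min_slice k n (pairing w).
Proof.
move=> /(last_min_exists Xpath w)[k [n [Yn above Jn below]]].
by exists k, n; apply/min_sliceP.
Qed.

Lemma last_min_nonpos w : e w <= 0 -> G w = -oo.
Proof.
move=> e0; rewrite /G /last_min_time (_ : [set _ | _ in _] = set0) ?ereal_sup0//.
apply/seteqP; split=> // _ [u [u0 ue _] _] /=.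
by have := lt_le_trans ue e0; rewrite lte_fin ltNge u0.
Qed.

Let mslice k n : measurable [set w | min_slice k n (pairing w)].
Proof. by rewrite -[X in measurable X]setTI; apply: mpairing => //; exact: measurable_min_slice. Qed.

Let mnonpos : measurable [set w | e w <= 0].
Proof. by rewrite -[X in measurable X]setTI; exact: emeasurable_fun_infty_c. Qed.

Lemma measurable_last_min : measurable_fun setT G.
Proof.
move=> _ A mA; rewrite setTI.
rewrite (_ : _ @^-1` _ = (\bigcup_k \bigcup_n ([set w | min_slice k n (pairing w)] `&`
    [set w | A (elapsed n (Theta w))])) `|`
  ([set w | e w <= 0] `&` [set w | A -oo])).
  apply: measurableU; last first.
    have [mN|nA] := pselect (A -oo); first by rewrite (_ : [set w | A -oo] = setT) ?setIT//;
      apply/seteqP; split.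
    by rewrite (_ : [set w | A -oo] = set0) ?setI0//; apply/seteqP; split.
  apply: bigcup_measurable => k _; apply: bigcup_measurable => n _; apply: measurableI => //.
  rewrite -[X in measurable X]setTI.
  have mET : measurable_fun setT (fun w => elapsed n (Theta w)).
    by apply: (measurableT_comp (measurable_elapsed n)); exact: measurable_funP.
  exact: mET.
apply/seteqP; split=> w /=.
  have [e0 Aw|e0 Aw] := leP (e w) 0.
    by right; split => //=; rewrite -(last_min_nonpos e0).
  have [k [n h]] := min_slice_exists e0; left; exists k => //; exists n => //; split => //=.
  by rewrite -(min_slice_last h).1.
case=> [[k _ [n _ [/= h Aw]]]|[/= e0 Aw]]; first by rewrite (min_slice_last h).1.
by rewrite last_min_nonpos.
Qed.

Lemma XG_some w : XG w <> None.
Proof.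
have [e0|e0] := leP (e w) 0.
  rewrite /XG last_min_nonpos//=; have [j] := jump_chain_some Xpath w 0.
  by rewrite /= => ->.
by have [k [n h]] := min_slice_exists e0; rewrite (min_slice_last h).2.
Qed.

Lemma XGP k w : 0 < e w -> XG w = Some k <-> exists n, min_slice k n (pairing w).
Proof.
move=> e0; split=> [Xk|[n h]]; last by rewrite (min_slice_last h).2.
have [j [n h]] := min_slice_exists e0; exists n.
by move: (h); have [_] := min_slice_last h; rewrite Xk => -[->].
Qed.

Lemma measurable_XG k : measurable [set w | XG w = Some k].
Proof.
rewrite (_ : [set _ | _] = (\bigcup_n [set w | min_slice k n (pairing w)]) `|`
  ([set w | e w <= 0] `&` [set w | X 0 w = Some k])).
  apply: measurableU; first exact: bigcup_measurable.
  by apply: measurableI => //; exact: (chain_measurable X_chain).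
apply/seteqP; split=> w /=.
  have [e0|e0] := leP (e w) 0; first by rewrite /XG last_min_nonpos//=; right.
  by move=> /(XGP _ e0)[n h]; left; exists n.
case=> [[n _ /= h]|[e0 Xk]]; first by rewrite (min_slice_last h).2.
by rewrite /XG last_min_nonpos.
Qed.

(** The properties that hold almost surely under [P x] and on which the pathwise
    description of the last minimum relies. *)
Definition regular x : set Omega := [set w | [/\ (Theta w 0%N).1 = x,
  skipfree_record (Theta w : rec) & 0 < e w]].

Lemma measurable_regular x : measurable (regular x).
Proof.
rewrite (_ : regular x = (Theta @^-1` ([set s | (s 0%N).1 = x] `&` @skipfree_record R))
    `&` [set w | 0 < e w]); last first.
  by apply/seteqP; split=> w /=; [case|case=> -[]].
apply: measurableI; last first.
  by rewrite -[X in measurable X]setTI; exact: emeasurable_fun_o_infty.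
rewrite -[X in measurable X]setTI; apply: measurable_funP => //.
apply: measurableI; last exact: measurable_skipfree_record.
exact: (measurable_coord_state 0 [set x]).
Qed.

Lemma regular_as x : P x (~` regular x) = 0.
Proof.
have m0 : measurable [set s : rec | (s 0%N).1 = x] := measurable_coord_state 0 [set x].
have mS := @measurable_skipfree_record R.
have mT (H : set rec) : measurable H -> measurable (Theta @^-1` H).
  by move=> mH; rewrite -[X in measurable X]setTI; exact: (measurable_funP Theta).
have mp : measurable [set w | 0 < e w].
  by rewrite -[X in measurable X]setTI; exact: emeasurable_fun_o_infty.
apply: (@subset_measure0 _ _ _ (P x) _ ((Theta @^-1` (~` [set s | (s 0%N).1 = x]) `|`
   Theta @^-1` (~` (@skipfree_record R))) `|` ~` [set w | 0 < e w])).
- by apply: measurableC; exact: measurable_regular.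
- apply: measurableU; last exact: measurableC.
  by apply: measurableU; apply: mT; exact: measurableC.
- move=> w nw; have [h1|h1] := pselect ((Theta w 0%N).1 = x); last by left; left.
  have [h2|h2] := pselect (skipfree_record (Theta w : rec)); last by left; right.
  by right => h3; apply: nw; split.
- have n1 : P x (Theta @^-1` (~` [set s | (s 0%N).1 = x])) = 0.
    by have := probability_setC (QQ x) m0; rewrite (record_start_eq1 QQlaw) subee.
  have n2 : P x (Theta @^-1` (~` (@skipfree_record R))) = 0.
    exact: (skipfree_record_as jump_matrix_ge0 QQlaw jump_matrix_skipfree x).
  have n3 : P x (~` [set w | 0 < e w]) = 0.
    by rewrite probability_setC// e_tail// mulr0 expR0 subee.
  have mA1 := mT _ (measurableC m0); have mA2 := mT _ (measurableC mS).
  apply: etrans n1; apply: etrans (measureU0 (mu := P x) mA1 mA2 n2).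
  exact: (measureU0 (mu := P x) (measurableU _ _ mA1 mA2) (measurableC mp) n3).
Qed.

Lemma regular_slice k n x w : (k <= x)%N -> regular x w ->
  min_slice k n (pairing w) <-> hit_slice k n (pairing w).
Proof.
move=> kx [/ThetaE Y0 sf e0].
have sf' m i j : jump_chain X m w = Some i -> jump_chain X m.+1 w = Some j ->
    (i <= j.+1)%N by move=> /ThetaE <- /ThetaE <-; exact: sf.
apply: (iff_trans (min_sliceP k n w)).
apply: (iff_trans (last_min_skipfree Xpath Y0 sf' n (e w) kx)).
have E : elapsed n (Theta w) = jump_time X n w := elapsed_jump_record Xpath w n.
by rewrite /hit_slice /pairing /mkset /fst /snd E.
Qed.

(** A minimum is at most the initial state, because time [0] counts. *)
Lemma XG_above x k : (x < k)%N -> P x [set w | XG w = Some k] = 0.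
Proof.
move=> xk; apply: (@subset_measure0 _ _ _ (P x) _ (~` regular x)).
- exact: measurable_XG.
- by apply: measurableC; exact: measurable_regular.
- move=> w /= Xk [w0 _ e0]; have [n [wn above _ _]] := (XGP k e0).1 Xk.
  case: n wn above => [|n] wn above.
    by move: xk; rewrite -w0 -wn ltnn.
  by have := above 0%N isT; rewrite [X in (_ < X)%N]w0 ltnNge ltnW.
- exact: regular_as.
Qed.

Section Factorization.
Variables (x k : nat) (phi psi : \bar R -> \bar R).
Hypothesis kx : (k <= x)%N.
Hypothesis mphi : measurable_fun setT phi.
Hypothesis mpsi : measurable_fun setT psi.
Hypothesis phi0 : forall u, 0 <= phi u.
Hypothesis psi0 : forall u, 0 <= psi u.

(** The contribution of the time after the last minimum when the chain takes
    [z] units of time to go below it. *)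
Definition after_min (z : \bar R) : \bar R :=
  \int[P x]_(w in [set w | 0 < e w /\ e w <= z]) psi (e w).

Let after_min_ge0 z : 0 <= after_min z.
Proof. exact: integral_ge0. Qed.

Let mgt (t : \bar R) : measurable [set w | t < e w].
Proof. by rewrite -[X in measurable X]setTI; exact: emeasurable_fun_o_infty. Qed.

Lemma measurable_after_min : measurable_fun setT after_min.
Proof.
pose D : set (\bar R * Omega) := [set z | 0 < e z.2 /\ e z.2 <= z.1].
have mD : measurable D.
  have m2 : measurable_fun setT (fun z : \bar R * Omega => e z.2).
    exact: (measurableT_comp me measurable_snd).
  rewrite (_ : D = (setT `&` [set z | 0 < e z.2]) `&` (setT `&` [set z | e z.2 <= z.1])).
    apply: measurableI; first exact: emeasurable_fun_o_infty.
    by apply: measurable_lee => //; exact: measurable_fst.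
  by apply/seteqP; split=> z; rewrite !setTI.
pose f (z : \bar R * Omega) := psi (e z.2).
have mf : measurable_fun setT (f \_ D).
  apply/(measurable_restrictT f mD); apply: measurable_funTS.
  exact: (measurableT_comp mpsi (measurableT_comp me measurable_snd)).
have f0 z : 0 <= (f \_ D) z by apply: erestrict_ge0 => y _; exact: psi0.
rewrite (_ : after_min = fubini_F (P x) (f \_ D)).
  exact: (measurable_fun_fubini_tonelli_F _ mf f0).
apply/funext => z; rewrite /after_min integral_mkcond; apply: eq_integral => w _.
by rewrite /patch; congr (if _ then _ else _); apply/idP/idP; rewrite !inE.
Qed.

Let after_shift (t : R) z : (0 <= t)%R ->
  \int[P x]_(w in [set w | t%:E < e w /\ e w <= t%:E + z]) psi (e w - t%:E) =
  (expR (- q * t))%:E * after_min z.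
Proof.
move=> t0.
pose D := [set u : \bar R | u <= z].
have mD : measurable D.
  rewrite (_ : D = `]-oo, z]%classic); first exact: emeasurable_itv.
  by apply/seteqP; split=> u; rewrite /= in_itv.
have mf : measurable_fun setT (psi \_ D).
  by apply/(measurable_restrictT psi mD); exact: measurable_funTS.
have f0 u : 0 <= (psi \_ D) u by apply: erestrict_ge0 => y _; exact: psi0.
have := memoryless me (e_tail x) t0 mf f0.
have restr (A : set Omega) (g : Omega -> \bar R) :
    \int[P x]_(w in A) (psi \_ D) (g w) = \int[P x]_(w in A `&` [set w | g w <= z]) psi (g w).
  rewrite integral_mkcondr; apply: eq_integral => w _.
  by rewrite /patch; congr (if _ then _ else _); apply/idP/idP; rewrite !inE.
rewrite !restr => h; apply: (etrans _ h); congr (integral _ _ _).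
by apply/seteqP; split=> w /=; rewrite EFinN leeBlDl.
Qed.

(** If [k] is reached for the first time at [T] and left downwards after a
    further delay [Z], then [X_G = k] means [T < e <= T + Z].  Lack of memory of
    [e] at [T] turns the remaining time into a fresh exponential time at the
    price of a factor [expR (- q T)], and the strong Markov property makes [Z]
    independent of [T]: so [G = T] and [e - G] enter through separate factors. *)
Lemma last_min_factorization :
  \int[P x]_(w in [set w | XG w = Some k]) (phi (G w) * psi (e w - G w)) =
  \sum_(0 <= n <oo) (\int[QQ x]_(s in first_hit k n)
      (phi (elapsed n s) * expeR (- (q%:E * elapsed n s)))) *
    \int[QQ k]_s after_min (undershoot_time k s).
Proof.
have mG := measurable_last_min.
have mV : measurable_fun setT (fun w => e w - G w) by exact: emeasurable_funB.
pose f w := phi (G w) * psi (e w - G w).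
have mf : measurable_fun setT f.
  by apply: emeasurable_funM; [exact: measurableT_comp|exact: (measurableT_comp mpsi mV)].
have f0 w : 0 <= f w by exact: mule_ge0.
have mX := measurable_XG k.
have mR := measurable_regular x; have mN := measurableC mR.
have mTheta : measurable_fun setT Theta by exact: measurable_funP.
have mJ n : measurable_fun setT (fun w => elapsed n (Theta w)).
  exact: (measurableT_comp (measurable_elapsed n) mTheta).
pose B n := [set w | hit_slice k n (pairing w)].
have mB n : measurable (B n).
  by rewrite -[X in measurable X]setTI; apply: mpairing => //; exact: measurable_hit_slice.
pose g n (z : rec * \bar R) := phi (elapsed n z.1) * psi (z.2 - elapsed n z.1).
have mg n : measurable_fun setT (g n).
  apply: emeasurable_funM; first exact: (measurableT_comp mphi (m_elapsed1 n)).
  apply: (measurableT_comp mpsi); apply: emeasurable_funB => //; exact: measurable_snd.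
have g0 n z : 0 <= g n z by exact: mule_ge0.
have mgp n : measurable_fun setT (fun w => g n (pairing w)).
  exact: (measurableT_comp (mg n) mpairing).
rewrite (ge0_negligible_integral mN mX (measurable_funTS mf))//; last exact: regular_as.
rewrite setDE setCK.
have -> : [set w | XG w = Some k] `&` regular x = \bigcup_n (B n `&` regular x).
  apply/seteqP; split=> w.
    move=> [Xk rw]; have [_ _ e0] := rw; have [n h] := (XGP k e0).1 Xk.
    by exists n => //; split => //; exact: (regular_slice n kx rw).1.
  move=> [n _ [h rw]]; split => //; have [_ _ e0] := rw.
  by apply/(XGP k e0); exists n; exact: (regular_slice n kx rw).2.
have mBR n : measurable (B n `&` regular x) by exact: measurableI.
rewrite (@ge0_integral_bigcup _ _ _ (P x) (fun n => B n `&` regular x) f mBR); last 3 first.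
- exact: measurable_funTS.
- by move=> w _; exact: f0.
- apply/trivIsetP => i j _ _ ij; apply/seteqP; split=> w //= [[[hi _ _] _] [[hj _ _] _]].
  have E := (trivIsetP.1 (@trivIset_first_hit R k)) i j I I ij.
  by have : (first_hit k i `&` first_hit k j) (Theta w : rec) by []; rewrite E.
apply: eq_eseriesr => n _.
transitivity (\int[P x]_(w in B n) g n (pairing w)).
  rewrite [RHS](ge0_negligible_integral mN (mB n) (measurable_funTS (mgp n)))//; last exact: regular_as.
  rewrite setDE setCK; apply: eq_integral => w; rewrite inE => -[h rw].
  have [Gw _] := min_slice_last ((regular_slice n kx rw).2 h).
  by rewrite /f /g Gw.
pose h := g n \_ (hit_slice k n).
have mh : measurable_fun setT h.
  by apply/(measurable_restrictT _ (measurable_hit_slice k n)); exact: measurable_funTS.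
have h0 z : 0 <= h z by apply: erestrict_ge0.
transitivity (\int[P x]_w h (Theta w, e w)).
  rewrite integral_mkcond; apply: eq_integral => w _.
  by rewrite /h /patch; congr (if _ then _ else _); apply/idP/idP; rewrite !inE.
rewrite (integral_independent mTheta me _ mh h0); last by move=> H A mH mA; exact: e_indep.
pose F (z : \bar R * \bar R) := phi z.1 * expeR (- (q%:E * z.1)) * after_min z.2.
have mF : measurable_fun setT F.
  apply: emeasurable_funM; last exact: (measurableT_comp measurable_after_min measurable_snd).
  apply: emeasurable_funM; first exact: (measurableT_comp mphi measurable_fst).
  exact: (measurableT_comp (measurable_expeR_scale q) measurable_fst).
have F0 z : 0 <= F z by rewrite !mule_ge0// expeR_ge0.
have mFs : measurable_fun setT (fun s : rec => F (elapsed n s, undershoot_time k (shift n s))).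
  apply: (measurableT_comp mF); apply: measurable_fun_pair; first exact: measurable_elapsed.
  exact: (measurableT_comp (measurable_undershoot_time k) (measurable_shift n)).
have mfh := @measurable_first_hit R k n.
transitivity (\int[QQ x]_(s in first_hit k n) F (elapsed n s, undershoot_time k (shift n s))).
  rewrite [RHS]integral_mkcond ge0_integral_distribution; last 2 first.
  - by apply/(measurable_restrictT _ mfh); exact: measurable_funTS.
  - by move=> s; apply: erestrict_ge0 => y _; exact: F0.
  apply: eq_integral => w _; rewrite [RHS]/= patchE; case: ifPn; rewrite ?inE ?notin_setE => hit.
  - have Jlt : elapsed n (Theta w) < +oo.
      have -> : elapsed n (Theta w) = jump_time X n w by exact: (elapsed_jump_record Xpath w n).
      exact: (first_hit_finite hit).
    have fin : elapsed n (Theta w) \is a fin_num by rewrite ge0_fin_numE ?elapsed_ge0.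
    case E : (elapsed n (Theta w)) fin => [t||]// _.
    have t0 : (0 <= t)%R by rewrite -lee_fin -E elapsed_ge0.
    set z := undershoot_time k (shift n (Theta w)).
    transitivity (\int[P x]_(w' in [set w' | t%:E < e w' /\ e w' <= t%:E + z])
        (phi t%:E * psi (e w' - t%:E))).
      rewrite [RHS]integral_mkcond; apply: eq_integral => w' _.
      rewrite /h /patch /g /= E; congr (if _ then _ else _).
      apply/idP/idP; rewrite !inE /hit_slice /=.
        by move=> [_]; rewrite E.
      by move=> [h1 h2]; split => //; rewrite E.
    rewrite ge0_integralZl//; last first.
    + apply: measurable_funTS; apply: (measurableT_comp mpsi); apply: emeasurable_funB => //.
    + rewrite -(setTI [set _ | _]) -[[set _ | _]]/([set w' | t%:E < e w'] `&` [set w' | e w' <= t%:E + z]).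
      rewrite setTI; apply: measurableI => //.
      by rewrite -[X in measurable X]setTI; exact: emeasurable_fun_infty_c.
    transitivity (F (t%:E, z)); last by rewrite -E.
    by rewrite after_shift// /F /= muleA mulNr.
  - rewrite integral0_eq// => w' _; rewrite /h /patch ifF//.
    by apply/negP; rewrite inE => -[].
rewrite (first_hit_markov jump_matrix_ge0 QQlaw k n x (measurable_undershoot_time k) mF F0).
have mU : measurable_fun setT (fun s : rec => after_min (undershoot_time k s)).
  exact: (measurableT_comp measurable_after_min (measurable_undershoot_time k)).
have mpe : measurable_fun setT (fun s : rec => phi (elapsed n s) * expeR (- (q%:E * elapsed n s))).
  apply: emeasurable_funM; first exact: (measurableT_comp mphi (measurable_elapsed n)).
  exact: (measurableT_comp (measurable_expeR_scale q) (measurable_elapsed n)).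
rewrite -(ge0_integralZr (QQ x) mfh (measurable_funTS mpe)); last 2 first.
- by move=> s _; rewrite mule_ge0 ?expeR_ge0.
- by apply: integral_ge0 => s _.
apply: eq_integral => s _; rewrite /F /=.
rewrite (ge0_integralZl (QQ k) measurableT mU)//.
by rewrite mule_ge0 ?expeR_ge0.
Qed.

End Factorization.

(** The transform of the time to go from [k] to the level below it, which does
    not exist for [k = 0]. *)
Let below (b : R) (k : nat) : \bar R :=
  if k is k'.+1 then hit_transform QQ b k' k else 0.

Let hitU k : set rec := \bigcup_n first_hit k n.

Let ge01 (u : \bar R) : (0 : \bar R) <= 1.
Proof. exact: lee01. Qed.

Let mhitU k : measurable (hitU k).
Proof. by apply: bigcup_measurable => n _; exact: measurable_first_hit. Qed.

Let hitUP k (s : rec) : ~ hitU k s -> hit_time k s = +oo.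
Proof.
move=> nh; rewrite /hit_time (_ : [set _ | _ in _] = set0) ?ereal_inf0//.
apply/seteqP; split=> // _ [m /= sm _].
have ex : exists m, (s m).1 == k by exists m; apply/eqP.
case: (ex_minnP ex) => n /eqP sn nmin; apply: nh; exists n => //; split => // i ni si.
by move: ni; rewrite ltnNge nmin// si.
Qed.

Let hitU_finite k w : hitU k (Theta w) -> hit_time k (Theta w) < +oo.
Proof.
move=> [n _ h]; rewrite (hit_timeE h).
have -> : elapsed n (Theta w) = jump_time X n w by exact: (elapsed_jump_record Xpath w n).
exact: (first_hit_finite h).
Qed.

Let mexp_hit (b : R) k : measurable_fun setT (fun s : rec => expeR (- (b%:E * hit_time k s))).
Proof. exact: (measurableT_comp (measurable_expeR_scale b) (measurable_hit_time k)). Qed.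

(** A record that never reaches the level has an infinite hitting time, whose
    exponential vanishes at positive rates. *)
Lemma undershoot_transform (b : R) k : (0 < b)%R ->
  \int[QQ k]_s expeR (- (b%:E * undershoot_time k s)) = below b k.
Proof.
move=> b0; case: k => [|k] /=.
  by under eq_integral do rewrite gt0_muley ?lte_fin//=; rewrite integral0.
rewrite hit_transformE// [RHS]integral_mkcond; apply: eq_integral => s _.
rewrite patchE; case: ifPn => //; rewrite notin_setE => nh.
by rewrite (hitUP nh) gt0_muley ?lte_fin.
Qed.

Let below_ge0 b k : 0 <= below b k.
Proof. by case: k => //= k; exact: hit_transform_ge0. Qed.

Let below_le1 b k : (0 <= b)%R -> below b k <= 1.
Proof. by case: k => [|k] b0 /=; [rewrite lee01|exact: hit_transform_le1]. Qed.

Let after_min1 x (z : \bar R) : 0 <= z ->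
  after_min x (fun=> 1) z + (if z < +oo then expeR (- (q%:E * z)) else 0) = 1.
Proof.
move=> z0; rewrite /after_min.
have t01 : P x [set w | 0%:E < e w] = 1 by rewrite e_tail// mulr0 expR0.
have mgt (t : \bar R) : measurable [set w | t < e w].
  by rewrite -[X in measurable X]setTI; exact: emeasurable_fun_o_infty.
have mle (t : \bar R) : measurable [set w | e w <= t].
  by rewrite -[X in measurable X]setTI; exact: emeasurable_fun_infty_c.
rewrite integral_cst ?mul1e; last exact: (measurableI _ _ (mgt 0) (mle z)).
case: z z0 => [z||]// z0.
- rewrite ltry /= -mulNr -(e_tail x); last by rewrite -lee_fin.
  rewrite -measureU; [|exact: (measurableI _ _ (mgt 0) (mle z%:E))|exact: mgt|]; last first.
    by apply/seteqP; split=> w //= [[_ h1] h2]; move: h1; rewrite leNgt h2.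
  rewrite (_ : _ `|` _ = [set w | 0%:E < e w]); first exact: t01.
  apply/seteqP; split=> w /=; first by case=> [[]//|]; apply: le_lt_trans.
  by move=> ew; have [|] := leP (e w) z%:E; [left|right].
- rewrite ltxx adde0 (_ : [set w | _] = [set w | 0%:E < e w]).
    exact: t01.
  by apply/seteqP; split=> w /=; [case|move=> ?; rewrite leey].
Qed.

(** An exponential time either elapses before the chain goes below [k] or
    survives until then. *)
Lemma after_min1_integral x k :
  \int[QQ k]_s after_min x (fun=> 1) (undershoot_time k s) + below q k = 1.
Proof.
have m1 : measurable_fun setT (fun s : rec => after_min x (fun=> 1) (undershoot_time k s)).
  exact: (measurableT_comp (@measurable_after_min x (fun=> 1) (measurable_cst 1) ge01)
     (measurable_undershoot_time k)).
have a0 z : 0 <= after_min x (fun=> 1) z by apply: integral_ge0.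
have z0 (s : rec) : 0 <= undershoot_time k s.
  case: k {m1} => [|k] //=; apply: le_ereal_inf_tmp => _ [m _ <-]; exact: elapsed_ge0.
have below_int : below q k = \int[QQ k]_s
    (if k is k'.+1 then (fun s => expeR (- (q%:E * hit_time k' s))) \_ (hitU k') else cst 0) s.
  case: (k) => [|k'] /=; first by rewrite integral0.
  by rewrite hit_transformE// [LHS]integral_mkcond.
have mb : measurable_fun setT
    (if k is k'.+1 then (fun s => expeR (- (q%:E * hit_time k' s))) \_ (hitU k') else cst 0 : rec -> \bar R).
  case: (k) => [|k']; first exact: measurable_cst.
  by apply/(measurable_restrictT _ (mhitU k')); exact: measurable_funTS.
have b0 s : 0 <= (if k is k'.+1 then (fun s => expeR (- (q%:E * hit_time k' s))) \_ (hitU k') else cst 0 : rec -> \bar R) s.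
  by case: (k) => [|k'] //; apply: erestrict_ge0 => y _; exact: expeR_ge0.
rewrite below_int -(ge0_integralD (QQ k) measurableT (fun s _ => a0 _) m1 (fun s _ => b0 s) mb).
rewrite ge0_integral_distribution; last 2 first.
- exact: emeasurable_funD.
- by move=> s; rewrite adde_ge0.
transitivity (\int[P k]_w (1 : \bar R)); last by rewrite integral_cst// mul1e; exact: probability_setT.
apply: eq_integral => w _; rewrite /= -[RHS](after_min1 x (z0 (Theta w))); congr (_ + _).
case: (k) => [|k'] //=; rewrite patchE; case: ifPn; rewrite ?inE ?notin_setE => h.
  by rewrite (hitU_finite h).
by rewrite (hitUP h).
Qed.

Let fin01 (a : \bar R) : 0 <= a -> a <= 1 -> a \is a fin_num.
Proof. by move=> a0 a1; rewrite ge0_fin_numE// (le_lt_trans a1)// ltry. Qed.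

Let after_min1_fin x k :
  \int[QQ k]_s after_min x (fun=> 1) (undershoot_time k s) = (1 - fine (below q k))%:E.
Proof.
have bf := fin01 (below_ge0 q k) (below_le1 k q_ge0).
have /esym/eqP := after_min1_integral x k.
by rewrite -sube_eq// ?fin_num_adde_defl// => /eqP <-; rewrite EFinB fineK.
Qed.

Let hit_fine (b : R) k x : (0 <= b)%R -> (fine (hit_transform QQ b k x))%:E = hit_transform QQ b k x.
Proof.
by move=> b0; rewrite fineK// fin01//; [exact: hit_transform_ge0|exact: hit_transform_le1].
Qed.

Let sum_transform (a : R) x k (C : R) : (0 <= a)%R -> (0 <= C)%R ->
  \sum_(0 <= n <oo) (\int[QQ x]_(s in first_hit k n)
     (expeR (- (a%:E * elapsed n s)) * expeR (- (q%:E * elapsed n s)))) * C%:E =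
  (fine (hit_transform QQ (q + a) k x) * C)%:E.
Proof.
move=> a0 C0; have qa0 : (0 <= q + a)%R by rewrite addr_ge0.
rewrite EFinM hit_fine// /hit_transform muleC -nneseriesZl; last first.
  by move=> n _; exact: hit_transform_at_ge0.
apply: eq_eseriesr => n _; rewrite muleC; congr (_ * _).
apply: eq_integral => s _; rewrite -expeRD; congr expeR.
have := elapsed_ge0 n s; case: (elapsed n s) => [u||]//= _.
  by rewrite -EFinD; congr EFin; ring.
move: a0 q_ge0; rewrite !le_eqVlt => /predU1P[<-|a0] /predU1P[<-|q0];
  rewrite ?add0r ?addr0 ?mul0e ?oppe0 ?adde0 ?add0e//.
by rewrite !gt0_muley ?lte_fin ?addr_gt0.
Qed.

Let sum_transform0 x k (C : R) : (0 <= C)%R ->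
  \sum_(0 <= n <oo) (\int[QQ x]_(s in first_hit k n)
     (1 * expeR (- (q%:E * elapsed n s)))) * C%:E =
  (fine (hit_transform QQ q k x) * C)%:E.
Proof.
move=> C0; have := sum_transform x k (lexx 0) C0; rewrite addr0 => <-.
apply: eq_eseriesr => n _; congr (_ * _); apply: eq_integral => s _.
by rewrite mul0e oppe0 expeR0.
Qed.

(** In the next three lemmas the first factor is the transform of the hitting
    time of [k], and the second one accounts for the remaining time, which has to
    elapse before the chain goes below [k]. *)
Lemma XG_law x k : (k <= x)%N ->
  P x [set w | XG w = Some k] =
  (fine (hit_transform QQ q k x) * (1 - fine (below q k)))%:E.
Proof.
move=> kx; have b1 : (0 <= 1 - fine (below q k))%R.
  by rewrite subr_ge0 -lee_fin fineK ?below_le1// fin01 ?below_ge0 ?below_le1.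
have := @last_min_factorization x k (fun=> 1) (fun=> 1) kx (measurable_cst 1)
  (measurable_cst 1) ge01 ge01.
under eq_integral do rewrite mule1.
rewrite integral_cst; last exact: measurable_XG.
rewrite mul1e => ->; rewrite after_min1_fin.
exact: sum_transform0.
Qed.

Lemma XG_time_transform x k (a : R) : (k <= x)%N -> (0 <= a)%R ->
  \int[P x]_(w in [set w | XG w = Some k]) expeR (- (a%:E * G w)) =
  (fine (hit_transform QQ (q + a) k x) * (1 - fine (below q k)))%:E.
Proof.
move=> kx a0; have b1 : (0 <= 1 - fine (below q k))%R.
  by rewrite subr_ge0 -lee_fin fineK ?below_le1// fin01 ?below_ge0 ?below_le1.
have := @last_min_factorization x k (fun u => expeR (- (a%:E * u))) (fun=> 1) kx
  (measurable_expeR_scale a) (measurable_cst 1) (fun=> expeR_ge0 _) ge01.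
by under eq_integral do rewrite mule1; move=> ->; rewrite after_min1_fin sum_transform.
Qed.

Lemma XG_after_transform x k (a : R) : (k <= x)%N -> (0 <= a)%R -> (0 < q)%R ->
  \int[P x]_(w in [set w | XG w = Some k]) expeR (- (a%:E * (e w - G w))) =
  (fine (hit_transform QQ q k x) *
   (q / (q + a) * (1 - fine (below (q + a) k))))%:E.
Proof.
move=> kx a0 q0; have qa0 : (0 < q + a)%R by rewrite ltr_pwDl.
have bf := fin01 (below_ge0 (q + a) k) (below_le1 k (ltW qa0)).
have b1 : (0 <= q / (q + a) * (1 - fine (below (q + a) k)))%R.
  apply: mulr_ge0; first by rewrite divr_ge0// ltW.
  by rewrite subr_ge0 -lee_fin (fineK bf) below_le1// ltW.
have := @last_min_factorization x k (fun=> 1) (fun u => expeR (- (a%:E * u))) kx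
  (measurable_cst 1) (measurable_expeR_scale a) ge01 (fun=> expeR_ge0 _).
under eq_integral do rewrite mul1e; move=> ->.
have mZ := @measurable_undershoot_time R k.
have mez : measurable_fun setT (fun s : rec => expeR (- ((q + a)%:E * undershoot_time k s))).
  exact: (measurableT_comp (measurable_expeR_scale (q + a)) mZ).
have z0 (s : rec) : 0 <= undershoot_time k s.
  by case: (k) => [|k'] //=; apply: le_ereal_inf_tmp => _ [m _ <-]; exact: elapsed_ge0.
have e1 (s : rec) : expeR (- ((q + a)%:E * undershoot_time k s)) <= 1.
  by rewrite -expeR0 lee_expeR oppe_le0 mule_ge0// lee_fin ltW.
have -> : \int[QQ k]_s after_min x (fun u => expeR (- (a%:E * u))) (undershoot_time k s) =
    (q / (q + a) * (1 - fine (below (q + a) k)))%:E.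
  transitivity (\int[QQ k]_s ((q / (q + a))%:E * (1 - expeR (- ((q + a)%:E * undershoot_time k s))))).
    by apply: eq_integral => s _; rewrite /after_min (exp_law_laplace_le q0 me (e_tail x)).
  rewrite ge0_integralZl_EFin//; last 3 first.
  - by move=> s _; rewrite subre_ge0// fin01 ?expeR_ge0.
  - by apply: emeasurable_funB => //; exact: measurable_cst.
  - by rewrite divr_ge0// ltW.
  rewrite [RHS]EFinM; congr (_ * _).
  have : \int[QQ k]_s (1 - expeR (- ((q + a)%:E * undershoot_time k s))) + below (q + a) k = 1.
    rewrite -undershoot_transform// -ge0_integralD//; last 3 first.
    - by move=> s _; rewrite subre_ge0// fin01 ?expeR_ge0.
    - by apply: emeasurable_funB => //; exact: measurable_cst.
    - by move=> s _; exact: expeR_ge0.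
    transitivity (\int[QQ k]_s (1 : \bar R)); last by rewrite integral_cst// mul1e; exact: probability_setT.
    by apply: eq_integral => s _; rewrite subeK// fin01 ?expeR_ge0.
  by move=> /esym/eqP; rewrite -sube_eq// ?fin_num_adde_defl// => /eqP <-; rewrite EFinB fineK.
exact: sum_transform0.
Qed.

(** For indicators both factors of the factorization are at most [1], so that
    every probability in the definition is a product of finite numbers: the
    conditional law of the pair is a product law. *)
Lemma last_min_cond_independent x :
  cond_independent (P x) G (fun w => e w - G w) XG.
Proof.
move=> [k|] P0 A B mA mB; last first.
  move: P0; rewrite (_ : _ @^-1` _ = set0) ?measure0 ?ltxx//.
  by apply/seteqP; split=> w //= /XG_some.
have kx : (k <= x)%N.
  by rewrite leqNgt; apply/negP => /XG_above e0; move: P0; rewrite [X in 0 < X]e0 ltxx.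
have mX := measurable_XG k; rewrite -[XG @^-1` _]/[set w | XG w = Some k].
have mG := measurable_last_min.
have mV : measurable_fun setT (fun w => e w - G w) by exact: emeasurable_funB.
pose S (C : set (\bar R)) := \sum_(0 <= n <oo) \int[QQ x]_(s in first_hit k n)
   ((\1_C (elapsed n s))%:E * expeR (- (q%:E * elapsed n s))).
pose K (C : set (\bar R)) := \int[QQ k]_s after_min x (fun u => (\1_C u)%:E) (undershoot_time k s).
have mI (C : set (\bar R)) : measurable C -> measurable_fun setT (fun u : \bar R => (\1_C u)%:E : \bar R).
  by move=> mC; apply/measurable_EFinP; exact: measurable_indic.
have I0 (C : set (\bar R)) (u : \bar R) : (0 : \bar R) <= (\1_C u)%:E by rewrite lee_fin.
have I1 (C : set (\bar R)) (u : \bar R) : (\1_C u)%:E <= (1 : \bar R).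
  by rewrite lee_fin indicE; case: (_ \in _).
have K0 C : 0 <= K C by apply: integral_ge0 => s _; exact: integral_ge0.
have mafter C : measurable C -> measurable_fun setT
    (fun s : rec => after_min x (fun u => (\1_C u)%:E) (undershoot_time k s)).
  move=> mC; exact: (measurableT_comp (measurable_after_min x (mI C mC) (I0 C))
    (measurable_undershoot_time k)).
have Kfin C : measurable C -> K C \is a fin_num.
  move=> mC; apply: fin01 => //.
  apply: (@le_trans _ _ (\int[QQ k]_s (1 : \bar R))); last by
    rewrite integral_cst// mul1e; exact: probability_le1.
  apply: ge0_le_integral => //; [by move=> s _; exact: integral_ge0|exact: mafter|].
  move=> s _; set z := undershoot_time k s.
  have mD : measurable [set w | 0 < e w /\ e w <= z].
    rewrite (_ : [set _ | _] = (setT `&` [set w | 0 < e w]) `&` (setT `&` [set w | e w <= z])).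
      by apply: measurableI; [exact: emeasurable_fun_o_infty|exact: emeasurable_fun_infty_c].
    by apply/seteqP; split=> w; rewrite !setTI.
  apply: (@le_trans _ _ (\int[P x]_(w in [set w | 0 < e w /\ e w <= z]) 1)).
    apply: ge0_le_integral => //.
    apply: measurable_funTS; exact: (measurableT_comp (mI C mC) me).
  by rewrite integral_cst// mul1e probability_le1.
have mSn C n : measurable C -> measurable_fun setT
    (fun s : rec => (\1_C (elapsed n s))%:E * expeR (- (q%:E * elapsed n s))).
  move=> mC; apply: emeasurable_funM; first exact: (measurableT_comp (mI C mC) (measurable_elapsed n)).
  exact: (measurableT_comp (measurable_expeR_scale q) (measurable_elapsed n)).
have Sn0 (C : set (\bar R)) n : 0 <= \int[QQ x]_(s in first_hit k n)
   ((\1_C (elapsed n s))%:E * expeR (- (q%:E * elapsed n s))).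
  by apply: integral_ge0 => s _; rewrite mule_ge0 ?expeR_ge0.
have Sfin C : measurable C -> S C \is a fin_num.
  move=> mC; apply: fin01; first by apply: nneseries_ge0 => n _ _; exact: Sn0.
  apply: (@le_trans _ _ (hit_transform QQ q k x)); last exact: hit_transform_le1.
  apply: lee_nneseries => n // _; apply: ge0_le_integral.
  - exact: measurable_first_hit.
  - by move=> s _; rewrite mule_ge0 ?expeR_ge0.
  - exact: measurable_funTS (mSn C n mC).
  - apply: measurable_funTS.
    exact: (measurableT_comp (measurable_expeR_scale q) (measurable_elapsed n)).
  - by move=> s _; rewrite -[leRHS]mul1e lee_wpmul2r ?expeR_ge0.
have main C D : measurable C -> measurable D ->
    fine (P x ((G @^-1` C `&` (fun w => e w - G w) @^-1` D) `&` [set w | XG w = Some k])) =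
    (fine (S C) * fine (K D))%R.
  move=> mC mD.
  have := @last_min_factorization x k _ _ kx (mI C mC) (mI D mD) (I0 C) (I0 D).
  have -> : \int[P x]_(w in [set w | XG w = Some k])
      ((\1_C (G w))%:E * (\1_D (e w - G w)%E)%:E) =
      P x ((G @^-1` C `&` (fun w => e w - G w) @^-1` D) `&` [set w | XG w = Some k]).
    rewrite -integral_indic//; last first.
      by apply: measurableI; rewrite -[X in measurable X]setTI; [exact: mG|exact: mV].
    by apply: eq_integral => w _; rewrite indicI.
  move=> ->; rewrite -[\int[QQ k]_s _]/(K D) -fineM ?Sfin ?Kfin//; congr fine.
  rewrite -{2}(fineK (Kfin D mD)) muleC -nneseriesZl//.
  by apply: eq_eseriesr => n _; rewrite muleC fineK ?Kfin.
have mainP C D : measurable C -> measurable D -> cond_proba (P x)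
    (G @^-1` C `&` (fun w => e w - G w) @^-1` D) [set w | XG w = Some k] =
    (fine (S C) * fine (K D) / fine (P x [set w | XG w = Some k]))%R.
  by move=> mC mD; rewrite /cond_proba main.
pose T0 : set (\bar R) := setT.
have mT0 : measurable T0 by exact: measurableT.
have PX : fine (P x [set w | XG w = Some k]) = (fine (S T0) * fine (K T0))%R.
  by rewrite -(main T0 T0 mT0 mT0) /T0 !preimage_setT !setTI.
have p0 : fine (P x [set w | XG w = Some k]) != 0%R.
  rewrite gt_eqF// -lte_fin fineK//; exact: fin_num_measure.
have cA : cond_proba (P x) (G @^-1` A) [set w | XG w = Some k] =
    (fine (S A) * fine (K T0) / fine (P x [set w | XG w = Some k]))%R.
  by rewrite -(mainP A T0 mA mT0) /T0 preimage_setT setIT.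
have cB : cond_proba (P x) ((fun w => e w - G w) @^-1` B) [set w | XG w = Some k] =
    (fine (S T0) * fine (K B) / fine (P x [set w | XG w = Some k]))%R.
  by rewrite -(mainP T0 B mT0 mB) /T0 preimage_setT setTI.
rewrite (mainP A B mA mB) cA cB PX; rewrite PX in p0; move: p0.
generalize (fine (S A)) (fine (S T0)) (fine (K B)) (fine (K T0)) => a b c0 c1.
by rewrite mulf_eq0 negb_or => /andP[b0 c10]; field; rewrite b0 c10.
Qed.

End LastMinimum.

(** * The hitting equation of the branching chain *)

Section ExponentialTime.
Local Open Scope ereal_scope.
Context {R : realType} {d : measure_display} {Omega : measurableType d}.
Variables (e1 : {mfun Omega >-> R}) (q : R).
Hypothesis q_ge0 : (0 <= q)%R.

Let time_of (u : R) : \bar R := if q == 0%R then +oo else (u / q)%:E.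

Let measurable_time_of : measurable_fun setT time_of.
Proof.
rewrite /time_of; case: (q == 0%R); first exact: measurable_cst.
by apply: measurableT_comp; [exact: EFin_measurable|exact: measurable_funM].
Qed.

Let exp_timeE : exp_time e1 q = time_of \o e1.
Proof. by []. Qed.

Lemma measurable_exp_time : measurable_fun setT (exp_time e1 q).
Proof. by rewrite exp_timeE; apply: measurableT_comp. Qed.

Lemma exp_time_tail (P : probability Omega R) (t : R) :
  is_unit_exponential P e1 -> (0 <= t)%R ->
  P [set w | t%:E < exp_time e1 q w] = (expR (- q * t))%:E.
Proof.
move=> e1_exp t0; rewrite /exp_time.
have [->|q0] := eqVneq q 0%R.
  rewrite oppr0 mul0r expR0 (_ : [set _ | _] = setT) ?probability_setT//.
  by apply/seteqP; split=> // w _ /=; rewrite ltry.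
have qp : (0 < q)%R by rewrite lt_neqAle eq_sym q0.
have mI : measurable (`](q * t)%R, +oo[%classic : set R) by exact: measurable_itv.
have -> : [set w | t%:E < (e1 w / q)%:E] = e1 @^-1` `](q * t)%R, +oo[%classic.
  by apply/seteqP; split=> w; rewrite /= in_itv/= andbT lte_fin ltr_pdivlMr// mulrC.
apply: (etrans (e1_exp _ mI)).
have qt0 : (0 <= q * t)%R by rewrite mulr_ge0// ltW.
have mf : measurable_fun (`](q * t)%R, +oo[%classic : set R) (EFin \o (fun s : R => 1 * expR (- 1 * s))%R).
  apply: measurable_funTS; apply: measurableT_comp; first exact: EFin_measurable.
  apply: measurable_funM => //; apply: measurableT_comp; first exact: measurable_expR.
  exact: measurable_funM.
rewrite /exponential_prob mulNr -(mulN1r (q * t)) -integral_exp_ray//.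
rewrite -(integral_itv_obnd_cbnd mf).
apply: eq_integral => s; rewrite inE /= in_itv/= andbT => ts.
by rewrite exponential_pdfE// (le_trans qt0)// ltW.
Qed.

End ExponentialTime.

Section BranchingChain.
Local Open Scope ereal_scope.
Context {R : realType} (lam mu : R) (p : nat -> R) (r : int -> R).
Hypothesis lam_gt0 : (0 < lam)%R.
Hypothesis mu_ge0 : (0 <= mu)%R.
Hypothesis p_ge0 : forall k : nat, (0 <= p k)%R.
Hypothesis p_sum1 : \sum_(0 <= k <oo) (p k)%:E = 1.
Hypothesis p0_gt0 : (0 < p 0%N)%R.
Hypothesis p1_eq0 : p 1%N = 0%R.
Hypothesis r_ge0 : forall k : int, (-1 <= k)%R -> (0 <= r k)%R.
Hypothesis r_sum1 : (r (-1))%:E + \sum_(0 <= k <oo) (r k%:Z)%:E = 1.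
Hypothesis r0_eq0 : r 0 = 0%R.

Local Notation Q := (generator lam mu p r).

(** The rate of the jump from [x > 0] to [x - 1 + j].  Indexing by [j] turns the
    rates into coefficients of power series; [j = 1] would be no jump, and its
    rate vanishes. *)
Definition jump_rate (x j : nat) : R := (p j * lam * x%:R + r (j%:Z - 1) * mu)%R.

Definition total_rate (x : nat) : R := (lam * x%:R + mu)%R.

Lemma r_shift_ge0 (j : nat) : (0 <= r (j%:Z - 1))%R.
Proof. by apply: r_ge0; rewrite lerBrDr addNr. Qed.

Lemma jump_rate_ge0 x j : (0 <= jump_rate x j)%R.
Proof.
by rewrite addr_ge0 ?mulr_ge0// ?r_shift_ge0// ltW.
Qed.

Lemma jump_rate1 x : jump_rate x 1 = 0%R.
Proof. by rewrite /jump_rate p1_eq0 subrr r0_eq0 !mul0r addr0. Qed.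

Lemma r_shift_sum : \sum_(0 <= j <oo) (r (j%:Z - 1))%:E = 1.
Proof.
rewrite nneseries_recl//; last by move=> j _; rewrite lee_fin r_shift_ge0.
rewrite sub0r -r_sum1; congr (_ + _).
rewrite -(nneseries_addn 1); last by move=> j; rewrite lee_fin r_shift_ge0.
by apply: eq_eseriesr => j _; rewrite PoszD addrK.
Qed.

Lemma jump_rate_sum x : \sum_(0 <= j <oo) (jump_rate x j)%:E = (total_rate x)%:E.
Proof.
transitivity (\sum_(0 <= j <oo) ((lam * x%:R)%:E * (p j)%:E + mu%:E * (r (j%:Z - 1))%:E)).
  by apply: eq_eseriesr => j _; rewrite -!EFinM -EFinD; congr EFin; rewrite /jump_rate; ring.
rewrite nneseriesD; last 2 first.
- by move=> j _ _; rewrite -EFinM lee_fin !mulr_ge0// ltW.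
- by move=> j _ _; rewrite -EFinM lee_fin mulr_ge0// r_shift_ge0.
rewrite !nneseriesZl; last 2 first.
- by move=> j _; rewrite lee_fin r_shift_ge0.
- by move=> j _; rewrite lee_fin.
by rewrite p_sum1 r_shift_sum !mule1.
Qed.

Lemma total_rate_gt0 x : (0 < x)%N -> (0 < total_rate x)%R.
Proof. by move=> x0; rewrite ltr_pwDl// mulr_gt0// ltr0n. Qed.

Lemma generator_diag x : (0 < x)%N -> Q x x = (- total_rate x)%R.
Proof. by move=> x0; rewrite /generator gtn_eqF// eqxx. Qed.

Lemma generator_diag_le0 x : (Q x x <= 0)%R.
Proof.
by case: x => [|x]; [rewrite /generator eqxx|rewrite generator_diag// oppr_le0 ltW// total_rate_gt0].
Qed.

Lemma generator_rate x y : (0 < x)%N -> x <> y ->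
  Q x y = if (x <= y.+1)%N then jump_rate x (y.+1 - x) else 0%R.
Proof.
move=> x0 /eqP xy; rewrite /generator gtn_eqF// eq_sym (negbTE xy).
case: ifP => // xy1; rewrite /jump_rate; congr (_ + r _ * _)%R.
by rewrite -subzn// -addn1 PoszD; ring.
Qed.

Lemma generator_offdiag x y : x <> y -> (0 <= Q x y)%R.
Proof.
move=> xy; case: x xy => [|x] xy; first by rewrite /generator eqxx.
by rewrite generator_rate//; case: ifP => // _; exact: jump_rate_ge0.
Qed.

Lemma generator_skipfree x y : (y.+1 < x)%N -> Q x y = 0%R.
Proof.
move=> yx; rewrite /generator; case: ifP => // _.
have -> : (y == x) = false by apply/eqP => e; move: yx; rewrite e ltnNge leqnSn.
by rewrite leqNgt yx.
Qed.

Lemma jump_matrix_rate x y : (0 < x)%N ->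
  (jump_matrix Q x y * total_rate x)%R =
  if (x <= y.+1)%N then jump_rate x (y.+1 - x) else 0%R.
Proof.
move=> x0; have c0 := total_rate_gt0 x0.
rewrite /jump_matrix generator_diag// oppr_eq0 gt_eqF//.
have [<-|/eqP xy] := eqVneq x y; first by rewrite leqnSn subSnn jump_rate1 mul0r.
by rewrite generator_rate// opprK divfK// gt_eqF.
Qed.

(** The first-step equation multiplied by the total rate, with the jumps indexed
    by [j]. *)
Lemma sum_jump_matrix x (c : R) (H : nat -> \bar R) : (0 < x)%N -> (0 <= c)%R ->
  (forall y, 0 <= H y) ->
  (total_rate x + c)%:E *
    \sum_(0 <= y <oo) (jump_matrix Q x y * (total_rate x / (total_rate x + c)))%:E * H y =
  \sum_(0 <= j <oo) (jump_rate x j)%:E * H (x.-1 + j)%N.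
Proof.
move=> x0 c0 H0; have t0 := total_rate_gt0 x0.
have tc0 : (0 < total_rate x + c)%R by rewrite ltr_pwDl.
have J0 := jump_matrix_ge0 (generator_diag_le0) (generator_offdiag).
rewrite -nneseriesZl; last first.
  move=> y _; rewrite mule_ge0// lee_fin; apply: mulr_ge0; first exact: J0.
  by rewrite divr_ge0// ltW.
pose F (y : nat) := (if (x <= y.+1)%N then (jump_rate x (y.+1 - x))%:E else 0) * H y.
have F0 y : 0 <= F y.
  by rewrite /F; case: ifP => _; rewrite ?mul0e// mule_ge0// lee_fin jump_rate_ge0.
transitivity (\sum_(0 <= y <oo) F y).
  apply: eq_eseriesr => y _; rewrite /F muleA -EFinM; congr (_ * _).
  transitivity (jump_matrix Q x y * total_rate x)%:E.
    by congr EFin; field; rewrite gt_eqF.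
  by rewrite jump_matrix_rate//; case: (x <= y.+1)%N.
rewrite (nneseries_split 0 x.-1)// add0n big1_seq ?add0e; last first.
  move=> y; rewrite mem_index_iota => /= yx.
  by rewrite /F leqNgt -ltn_predRL yx mul0e.
rewrite -(nneseries_addn x.-1)//; apply: eq_eseriesr => j _.
rewrite /F addnC -addSn prednK// leq_addr addKn; by [].
Qed.


Section HittingTransform.
Context {d : measure_display} {Omega : measurableType d}.
Variables (P : nat -> probability Omega R) (X : R -> Omega -> option nat).
Hypothesis X_chain : minimal_chain Q P X.
Variables (b : R) (k : nat).
Hypothesis b_ge0 : (0 <= b)%R.

Local Notation h := (hit_transform (chain_law X_chain) b k).
Local Notation h_at := (hit_transform_at (chain_law X_chain) b k).

Let J0 := jump_matrix_ge0 generator_diag_le0 generator_offdiag.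

Lemma hit_transform_at_rate n x : (k < x)%N ->
  (total_rate x + b)%:E * h_at n.+1 x =
  \sum_(0 <= j <oo) (jump_rate x j)%:E * h_at n (x.-1 + j)%N.
Proof.
move=> kx; have x0 : (0 < x)%N by apply: leq_ltn_trans kx.
have c0 : (0 < - Q x x)%R by rewrite generator_diag// opprK total_rate_gt0.
have xk : x <> k by move=> e; rewrite e ltnn in kx.
rewrite (hit_transform_atS J0 (chain_record_law X_chain) b_ge0 n xk c0).
rewrite -(sum_jump_matrix x0 b_ge0); last by move=> y; exact: hit_transform_at_ge0.
by congr (_ * _); apply: eq_eseriesr => y _; rewrite generator_diag// opprK.
Qed.

Lemma hit_transform_rate x : (k < x)%N ->
  (total_rate x + b)%:E * h x =
  \sum_(0 <= j <oo) (jump_rate x j)%:E * h (x.-1 + j)%N.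
Proof.
move=> kx; have xk : (x == k) = false by apply/eqP => e; rewrite e ltnn in kx.
rewrite {1}/hit_transform nneseries_recl//; last by move=> n _; exact: hit_transform_at_ge0.
rewrite (hit_transform_at0 (chain_record_law X_chain)) xk add0e.
rewrite -(nneseries_addn 1); last by move=> n; exact: hit_transform_at_ge0.
rewrite -nneseriesZl; last by move=> n _; exact: hit_transform_at_ge0.
under eq_eseriesr => n _ do rewrite addn1 hit_transform_at_rate//.
rewrite nneseries_interchange; last first.
  by move=> n j; rewrite mule_ge0 ?lee_fin ?jump_rate_ge0//; exact: hit_transform_at_ge0.
apply: eq_eseriesr => j _; rewrite nneseriesZl//.
by move=> n _; exact: hit_transform_at_ge0.
Qed.

(** The hitting transform is the least nonnegative solution of its equation:
    by induction, the contribution of the first [n] jumps stays below any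
    supersolution. *)
Lemma hit_transform_upper (f : nat -> R) : (forall x, 0 <= f x)%R -> (1 <= f k)%R ->
  (forall x, (k < x)%N ->
     \sum_(0 <= j <oo) (jump_rate x j)%:E * (f (x.-1 + j)%N)%:E <=
     ((total_rate x + b) * f x)%:E) ->
  forall x, (k <= x)%N -> h x <= (f x)%:E.
Proof.
move=> f0 fk fsup.
have part n x : (k <= x)%N -> \sum_(0 <= m < n) h_at m x <= (f x)%:E.
  elim: n x => [|n IH] x kx; first by rewrite big_geq// lee_fin.
  rewrite big_nat_recl// (hit_transform_at0 (chain_record_law X_chain)).
  move: kx; rewrite leq_eqVlt => /predU1P[<-|kx].
    rewrite eqxx big1 ?adde0 ?lee_fin// => m _.
    exact: (hit_transform_at_self (chain_record_law X_chain)).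
  have xk : (x == k) = false by apply/eqP => e; rewrite e ltnn in kx.
  have x0 : (0 < x)%N by apply: leq_ltn_trans kx.
  have tb : (0 < total_rate x + b)%R by rewrite ltr_pwDl// total_rate_gt0.
  rewrite xk add0e -(@lee_pmul2l _ (total_rate x + b)%:E) ?lte_fin//.
  rewrite ge0_sume_distrr; last by move=> m _; exact: hit_transform_at_ge0.
  rewrite -EFinM; apply: le_trans (fsup x kx).
  under eq_bigr => m _ do rewrite hit_transform_at_rate//.
  rewrite -nneseries_sum_nat; last first.
    by move=> m j; rewrite mule_ge0 ?lee_fin ?jump_rate_ge0//; exact: hit_transform_at_ge0.
  apply: lee_nneseries => [j _ _|j _].
    by apply: sume_ge0 => m _; rewrite mule_ge0 ?lee_fin ?jump_rate_ge0//; exact: hit_transform_at_ge0.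
  rewrite -ge0_sume_distrr; last by move=> m _; exact: hit_transform_at_ge0.
  apply: lee_wpmul2l; first by rewrite lee_fin jump_rate_ge0.
  by apply: IH; rewrite (leq_trans _ (leq_addr _ _))// -ltnS prednK.
move=> x kx; apply: lime_le; first by apply: is_cvg_nneseries => n _ _; exact: hit_transform_at_ge0.
by apply: nearW => n; exact: part.
Qed.

Let h_fin x : h x \is a fin_num.
Proof.
rewrite ge0_fin_numE; last exact: hit_transform_ge0.
by apply: le_lt_trans (ltry 1); exact: (hit_transform_le1 (chain_law X_chain) k b_ge0 x).
Qed.

(** A maximum principle: where the difference between a subsolution and the
    transform is maximal, a downward jump would strictly decrease it. *)
Lemma hit_transform_lower (f : nat -> R) : (forall x, 0 <= f x)%R -> (f k <= 1)%R ->
  f x @[x --> \oo] --> (0%R : R) ->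
  (forall x, (k < x)%N -> ((total_rate x + b) * f x)%:E <=
     \sum_(0 <= j <oo) (jump_rate x j)%:E * (f (x.-1 + j)%N)%:E) ->
  forall x, (k <= x)%N -> (f x)%:E <= h x.
Proof.
move=> f0 fk flim fsub x1 kx1; rewrite leNgt; apply/negP => hf.
pose H x := fine (h x); have HE x : h x = (H x)%:E by rewrite fineK.
have H0 x : (0 <= H x)%R by apply: fine_ge0; exact: hit_transform_ge0.
pose u x := (f x - H x)%R.
have u1 : (0 < u x1)%R by rewrite subr_gt0 -lte_fin -HE.
have [N _ HN] : \forall x \near \oo, (f x < u x1)%R.
  by move/cvgrPdist_lt : flim => /(_ _ u1); apply: filterS => x;
     rewrite sub0r normrN ger0_norm.
have uN x : (N <= x)%N -> (u x < u x1)%R.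
  move=> Nx; apply: le_lt_trans (HN x Nx); by rewrite gerBl.
have x1N : (x1 < N.+1)%N.
  by rewrite ltnS leqNgt; apply/negP => /ltnW /uN; rewrite ltxx.
have [m km mmax] : exists2 m, (k <= m)%N & forall y, (k <= y)%N -> (u y <= u m)%R.
  pose i0 := Ordinal x1N.
  case: (@arg_maxP _ _ 'I_N.+1 i0 (fun i => (k <= i)%N) (fun i => u i) kx1) => m km mmax.
  exists m => // y ky; have [yN|Ny] := ltnP y N.+1; first exact: (mmax (Ordinal yN)).
  by apply: le_trans (mmax i0 kx1); apply/ltW/uN/ltnW.
have ex : exists m, (k <= m)%N && `[< forall y, (k <= y)%N -> (u y <= u m)%R >].
  by exists m; rewrite km; exact/asboolP.
(* At the least maximizer a jump down strictly decreases the difference. *)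
case: (ex_minnP ex) => x /andP[kx /asboolP xmax] xmin {m km mmax ex}.
have ux : (0 < u x)%R by apply: lt_le_trans u1 _; exact: xmax.
have {}kx : (k < x)%N.
  rewrite ltn_neqAle kx andbT; apply/eqP => e; move: ux.
  rewrite -e /u subr_gt0 /H (hit_transform_self (chain_record_law X_chain))/=.
  by rewrite ltNge fk.
have x0 : (0 < x)%N by apply: leq_ltn_trans kx.
have kx' : (k <= x.-1)%N by rewrite -ltnS prednK.
have ux' : (u x.-1 < u x)%R.
  rewrite lt_neqAle xmax// andbT; apply/eqP => e.
  have : (x <= x.-1)%N.
    by apply: xmin; rewrite kx'; apply/asboolP => y ky; rewrite e; exact: xmax.
  by rewrite leqNgt prednK// leqnn.
pose delta : R := (jump_rate x 0 * (u x - u x.-1))%R.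
have d0 : (0 < delta)%R.
  rewrite mulr_gt0 ?subr_gt0// ltr_pwDl//; first by rewrite !mulr_gt0// ltr0n.
  by rewrite mulr_ge0// r_shift_ge0.
pose D (j : nat) : R := if j == 0%N then delta else 0%R.
have Dsum : \sum_(0 <= j <oo) (D j)%:E = delta%:E.
  rewrite nneseries_recl//; last by move=> j _; rewrite lee_fin /D; case: ifP => // _; exact: ltW.
  by rewrite eseries0 ?adde0// => -[|j].
have fs0 y j : 0 <= (jump_rate x j)%:E * (f y)%:E.
  by rewrite -EFinM lee_fin mulr_ge0// jump_rate_ge0.
have Hs0 y j : 0 <= (jump_rate x j)%:E * h y.
  by rewrite HE -EFinM lee_fin mulr_ge0// jump_rate_ge0.
have : \sum_(0 <= j <oo) ((jump_rate x j)%:E * (f (x.-1 + j)%N)%:E + (D j)%:E) <=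
    \sum_(0 <= j <oo) ((jump_rate x j)%:E * h (x.-1 + j)%N + (u x)%:E * (jump_rate x j)%:E).
  apply: lee_nneseries => [j _ _|j _].
    by rewrite adde_ge0// lee_fin /D; case: ifP => // _; exact: ltW.
  rewrite HE -!EFinM -!EFinD lee_fin /D; case: j => [|j] /=.
    rewrite addn0 /delta mulrBr [X in (_ + (X - _))%R]mulrC /u.
    by rewrite le_eqVlt; apply/orP; left; apply/eqP; ring.
  have := xmax (x.-1 + j.+1)%N (leq_trans kx' (leq_addr _ _)); rewrite {1}/u addr0 => hj.
  have w0 := jump_rate_ge0 x j.+1; rewrite [X in (_ <= _ + X)%R]mulrC -mulrDr.
  by rewrite ler_wpM2l// -lerBlDl.
rewrite nneseriesD//; last by move=> j _ _; rewrite lee_fin /D; case: ifP => // _; exact: ltW.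
rewrite nneseriesD//; last by move=> j _ _; rewrite -EFinM lee_fin mulr_ge0 ?jump_rate_ge0// ltW.
rewrite Dsum -hit_transform_rate// nneseriesZl; last first.
  by move=> j _; rewrite lee_fin jump_rate_ge0.
rewrite jump_rate_sum => le1.
have := le_trans (leeD2r delta%:E (fsub x kx)) le1.
rewrite HE -!EFinM -!EFinD lee_fin leNgt => /negP; apply.
rewrite -subr_gt0 (_ : (_ - _)%R = (b * u x + delta)%R).
  by rewrite ltr_wpDl// mulr_ge0// ltW.
by rewrite /u; ring.
Qed.

End HittingTransform.
End BranchingChain.

(** * Generating functions and their roots *)

Section PowerSeries.
Context {R : realType}.
Variables (a : nat -> R) (A : R).
Hypothesis a_ge0 : forall k, 0 <= a k.
Hypothesis a_sum : (\sum_(0 <= k <oo) (a k)%:E = A%:E)%E.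

Local Notation g z := (limn (pseries a z)).

Let term_ge0 z k : 0 <= z -> (0 <= (a k * z ^+ k)%:E)%E.
Proof. by move=> z0; rewrite lee_fin mulr_ge0// exprn_ge0. Qed.

Lemma gen_sum z : 0 <= z <= 1 -> (\sum_(0 <= k <oo) (a k * z ^+ k)%:E = (g z)%:E)%E.
Proof.
move=> /andP[z0 z1].
have le1 : (\sum_(0 <= k <oo) (a k * z ^+ k)%:E <= A%:E)%E.
  rewrite -a_sum; apply: lee_nneseries => [k _ _|k _]; first exact: term_ge0.
  by rewrite lee_fin ler_piMr// exprn_ile1.
have ge0 : (0 <= \sum_(0 <= k <oo) (a k * z ^+ k)%:E)%E.
  by apply: nneseries_ge0 => k _ _; exact: term_ge0.
have fin : (\sum_(0 <= k <oo) (a k * z ^+ k)%:E)%E \is a fin_num.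
  by rewrite ge0_fin_numE// (le_lt_trans le1)// ltry.
rewrite -(fineK fin); congr EFin; apply/esym/cvg_lim => //.
have := is_cvg_nneseries (u_ := fun k => (a k * z ^+ k)%:E) (N := 0) (P := xpredT)
  (fun k _ _ => term_ge0 k z0).
move=> /cvg_ex[l /= cl]; have El := cvg_lim (@ereal_hausdorff R) cl.
move: cl; rewrite -El -(fineK fin) => cl.
rewrite (_ : pseries a z = fine \o (fun n => \sum_(0 <= k < n) (a k * z ^+ k)%:E)%E).
  exact: (fine_cvg cl).
by apply/funext => n; rewrite /= /pseries /series /= sumEFin.
Qed.

Lemma gen_ge0 z : 0 <= z <= 1 -> 0 <= g z.
Proof.
move=> z01; rewrite -lee_fin -(gen_sum z01); apply: nneseries_ge0 => k _ _.
by case/andP: z01 => z0 _; exact: term_ge0.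
Qed.

Lemma gen_1 : g 1 = A.
Proof.
apply/eqP; rewrite -eqe -gen_sum ?ler01 ?lexx// -a_sum; apply/eqP.
by apply: eq_eseriesr => k _; rewrite expr1n mulr1.
Qed.

Lemma gen_le y z : 0 <= y -> y <= z -> z <= 1 -> g y <= g z.
Proof.
move=> y0 yz z1; rewrite -lee_fin -!gen_sum; last 2 first.
- by rewrite (le_trans y0).
- by rewrite y0 (le_trans yz).
apply: lee_nneseries => [k _ _|k _]; first exact: term_ge0.
by rewrite lee_fin ler_wpM2l// lerXn2r ?nnegrE// (le_trans y0).
Qed.

Lemma gen_ge_first z : 0 <= z <= 1 -> a 0%N <= g z.
Proof.
move=> /andP[z0 z1].
have h0 : a 0%N <= g 0.
  rewrite -lee_fin -gen_sum ?lexx ?ler01//.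
  rewrite nneseries_recl//; last by move=> k _; exact: term_ge0.
  by rewrite expr0 mulr1 leeDl//; apply: nneseries_ge0 => k _ _; exact: term_ge0.
by apply: le_trans h0 _; exact: gen_le.
Qed.

Lemma expr_lipschitz (y z : R) k : 0 <= y -> y <= z -> z <= 1 ->
  (1 - z) * (z ^+ k - y ^+ k) <= z - y.
Proof.
move=> y0 yz z1; have z0 := le_trans y0 yz.
elim: k => [|k IH]; first by rewrite !expr0 subrr mulr0 subr_ge0.
have yk0 : 0 <= y ^+ k by exact: exprn_ge0.
have yk1 : y ^+ k <= 1 by rewrite exprn_ile1// (le_trans yz).
have -> : (1 - z) * (z ^+ k.+1 - y ^+ k.+1) =
  z * ((1 - z) * (z ^+ k - y ^+ k)) + (1 - z) * (z - y) * y ^+ k by rewrite !exprS; ring.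
have h1 : z * ((1 - z) * (z ^+ k - y ^+ k)) <= z * (z - y) by rewrite ler_wpM2l.
have h2 : (1 - z) * (z - y) * y ^+ k <= (1 - z) * (z - y).
  by rewrite ler_piMr// mulr_ge0// subr_ge0.
by apply: le_trans (lerD h1 h2) _; rewrite -mulrDl addrC subrK mul1r.
Qed.

(** A Lipschitz constant that is uniform in the degree on intervals away from
    [1] gives the continuity of the sum. *)
Lemma gen_lipschitz y z : 0 <= y -> y <= z -> z <= 1 ->
  (1 - z) * (g z - g y) <= A * (z - y).
Proof.
move=> y0 yz z1; have z0 := le_trans y0 yz.
rewrite mulrBr lerBlDr -lee_fin EFinD !EFinM -a_sum -!gen_sum ?y0 ?z0 ?(le_trans yz)//.
have zy : (0 : R) <= z - y by rewrite subr_ge0.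
have z1' : (0 : R) <= 1 - z by rewrite subr_ge0.
rewrite (muleC _ (z - y)%:E) -!nneseriesZl; last 3 first.
- by move=> k _; exact: term_ge0.
- by move=> k _; rewrite lee_fin.
- by move=> k _; exact: term_ge0.
rewrite -nneseriesD; last 2 first.
- by move=> k _ _; rewrite -EFinM lee_fin mulr_ge0.
- by move=> k _ _; rewrite -EFinM lee_fin !mulr_ge0// exprn_ge0.
apply: lee_nneseries => [k _ _|k _].
  by rewrite -EFinM lee_fin !mulr_ge0// exprn_ge0.
rewrite -!EFinM -EFinD lee_fin -lerBlDr mulrCA (mulrCA _ (a k)) -mulrBr.
rewrite (mulrC (z - y)) ler_wpM2l// -mulrBr; exact: expr_lipschitz.
Qed.

Lemma A_ge0 : 0 <= A.
Proof. by rewrite -lee_fin -a_sum; apply: nneseries_ge0 => k _ _; rewrite lee_fin. Qed.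

Lemma gen_continuous z : 0 < z < 1 -> {for z, continuous (fun z => g z)}.
Proof.
move=> /andP[z0 z1]; pose c := (z + 1) / 2.
have zc : z < c by rewrite /c; lra.
have c1 : c < 1 by rewrite /c; lra.
have c1' : 0 < 1 - c by rewrite subr_gt0.
have A0 := A_ge0; pose L := (A + 1) / (1 - c).
have L0 : 0 < L by rewrite divr_gt0// ltr_pwDr.
have lip y y' : 0 <= y -> y <= y' -> y' <= c -> `|g y' - g y| <= L * (y' - y).
  move=> y0 yy y'c; have y'1 : y' <= 1 by rewrite (le_trans y'c)// ltW.
  have gg : 0 <= g y' - g y by rewrite subr_ge0 gen_le.
  rewrite ger0_norm// /L mulrAC ler_pdivlMr// mulrC.
  apply: (@le_trans _ _ ((1 - y') * (g y' - g y))); first by rewrite ler_wpM2r// lerD2l lerN2.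
  apply: le_trans (gen_lipschitz y0 yy y'1) _.
  by rewrite ler_wpM2r ?subr_ge0// lerDl.
apply/cvgrPdist_lt => e e0; near=> y.
have y0 : 0 <= y by apply: ltW; near: y; exact: lt_nbhsr.
have yc : y <= c by apply: ltW; near: y; exact: lt_nbhsl.
have yz : `|z - y| < e / L by near: y; apply: cvgr_dist_lt => //; rewrite divr_gt0.
apply: (@le_lt_trans _ _ (L * `|z - y|)); last by rewrite mulrC -ltr_pdivlMr.
have [yz'|zy'] := leP y z.
  by rewrite [X in _ <= _ * X]ger0_norm ?subr_ge0//; apply: lip => //; exact: ltW.
have h := lip z y (ltW z0) (ltW zy') yc.
have -> : `|z - y| = y - z by rewrite distrC ger0_norm// subr_ge0 ltW.
by rewrite distrC.
Unshelve. all: by end_near. Qed.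

End PowerSeries.

(** The least root in [(0, 1]] of a continuous function that is positive near
    [0] and vanishes at [1]. *)
Section LeastRoot.
Context {R : realType}.
Variables (f : R -> R) (del : R).
Hypothesis f_cont : forall z, 0 < z < 1 -> {for z, continuous f}.
Hypothesis f1 : f 1 = 0.
Hypothesis del_gt0 : 0 < del.
Hypothesis f_pos : forall z, 0 < z <= 1 -> z < del -> 0 < f z.

(** A zero below the infimum of the zeros would exist if [f] took a negative
    value there, and the infimum itself is a zero by continuity. *)
Lemma least_root : let z0 := least [set z | 0 < z <= 1 /\ f z = 0] in
  [/\ 0 < z0 <= 1, f z0 = 0 & forall v, 0 < v < z0 -> 0 < f v].
Proof.
pose B := [set z | 0 < z <= 1 /\ f z = 0].
have B1 : B 1 by rewrite /B /= ltr01 lexx.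
have Bdel z : B z -> del <= z.
  by move=> [z01 fz]; rewrite leNgt; apply/negP => /(f_pos z01); rewrite fz ltxx.
have infB : has_inf B by split; [exists 1|exists del => z /Bdel].
pose i := inf B.
have idel : del <= i by apply: lb_le_inf; [exists 1|move=> z /Bdel].
have i1 : i <= 1 by apply: ge_inf => //; case: infB.
have i0 : 0 < i by exact: lt_le_trans idel.
have Bi : B i.
  split; first by rewrite i0.
  move: i1; rewrite le_eqVlt => /predU1P[->//|i1].
  apply/eqP/negP => /negP fi.
  have /f_cont : 0 < i < 1 by rewrite i0.
  move/cvgrPdist_lt => /(_ `|f i|); rewrite normr_gt0 => /(_ fi)[e /= e0 He].
  have [z Bz zi] := inf_adherent e0 infB.
  have iz : i <= z by apply: ge_inf => //; case: infB.
  have := He z; rewrite /= distrC ger0_norm ?subr_ge0// ltrBlDl => /(_ zi).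
  by case: Bz => _ ->; rewrite subr0 ltxx.
have ilb : lbound B i by move=> z Bz; apply: ge_inf => //; case: infB.
have [[z01 fz] zlb] : (B `&` lbound B) (least B) by apply: (getPex (ex_intro _ i (conj Bi ilb))).
rewrite /= -/B; split => // v /andP[v0 vz].
case: ltgtP => // [fv|fv]; last first.
  have : B v by split; [rewrite v0 ltW// (lt_le_trans vz)//; case/andP: z01|].
  by move/zlb; rewrite leNgt vz.
have z1 : least B <= 1 by case/andP: z01.
have v1 : v < 1 by exact: lt_le_trans z1.
pose c := Num.min (del / 2) v.
have c0 : 0 < c by rewrite lt_min v0 divr_gt0.
have cv : c <= v by rewrite ge_min lexx orbT.
have fc : 0 < f c.
  apply: f_pos; first by rewrite c0 (le_trans cv)// ltW.
  have dd : del / 2 < del by move: del_gt0; lra.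
  by rewrite gt_min dd.
have cont : {within `[c, v], continuous f}.
  apply: continuous_in_subspaceT => y; rewrite inE /= in_itv/= => /andP[cy yv].
  by apply: f_cont; rewrite (lt_le_trans c0)// (le_lt_trans yv).
have [|w] := IVT cv cont (v := 0).
  by rewrite ge_min le_max (ltW fv) (ltW fc) orbT.
rewrite in_itv/= => /andP[cw wv] fw.
have : B w by split => //; rewrite (lt_le_trans c0)// (le_trans wv)// ltW.
by move/zlb; rewrite leNgt (le_lt_trans wv).
Qed.

End LeastRoot.

Section BranchingRoot.
Context {R : realType} (p : nat -> R).
Hypothesis p_ge0 : forall k : nat, 0 <= p k.
Hypothesis p_sum1 : (\sum_(0 <= k <oo) (p k)%:E = 1%:E)%E.
Hypothesis p0_gt0 : 0 < p 0%N.

Lemma gen_p1 : gen_p p 1 = 1.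
Proof. exact: gen_1 p_ge0 p_sum1. Qed.

Lemma gen_p_continuous z : 0 < z < 1 -> {for z, continuous (gen_p p)}.
Proof. exact: (gen_continuous p_ge0 p_sum1). Qed.

Lemma varphi_root : [/\ 0 < varphi p <= 1, gen_p p (varphi p) = varphi p &
  forall v, 0 < v < varphi p -> v < gen_p p v].
Proof.
have fc z : 0 < z < 1 -> {for z, continuous (fun z => gen_p p z - z)}.
  by move=> z01; apply: continuousB; [exact: gen_p_continuous|exact: cvg_id].
have fpos z : 0 < z <= 1 -> z < p 0%N -> 0 < gen_p p z - z.
  move=> /andP[z0 z1] zp; rewrite subr_gt0; apply: lt_le_trans zp _.
  by apply: (gen_ge_first p_ge0 p_sum1); rewrite ltW.
have f1 : gen_p p 1 - 1 = 0 by rewrite gen_p1 subrr.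
have := least_root fc f1 p0_gt0 fpos; rewrite /varphi.
rewrite (_ : [set z | 0 < z <= 1 /\ gen_p p z - z = 0] = [set z | 0 < z <= 1 /\ gen_p p z = z]).
  move=> /= [z01 /eqP fz pos]; split => //; first by rewrite subr_eq0 in fz; exact/eqP.
  by move=> v /pos; rewrite subr_gt0.
by apply/seteqP; split=> z /= [z01 h]; split => //;
  [apply/eqP; rewrite -subr_eq0 h|rewrite h subrr].
Qed.

Lemma varphi_gt0 : 0 < varphi p.
Proof. by have [/andP[]] := varphi_root. Qed.

Lemma varphi_le1 : varphi p <= 1.
Proof. by have [/andP[]] := varphi_root. Qed.

Lemma gen_p_gt v : 0 < v < varphi p -> v < gen_p p v.
Proof. by have [_ _] := varphi_root; apply. Qed.

Lemma gen_p_varphi : gen_p p (varphi p) = varphi p.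
Proof. by have [_] := varphi_root. Qed.

(** Monotonicity alone shows that the branching drift vanishes at most linearly
    at its root. *)
Lemma gen_p_sub_le v : 0 <= v <= varphi p -> gen_p p v - v <= varphi p - v.
Proof.
move=> /andP[v0 vv]; rewrite lerD2r -[leRHS]gen_p_varphi.
by apply: (gen_le p_ge0 p_sum1) => //; exact: varphi_le1.
Qed.

Lemma gen_p_ge_p0 v : 0 <= v <= 1 -> p 0%N <= gen_p p v.
Proof. exact: (gen_ge_first p_ge0 p_sum1). Qed.

End BranchingRoot.

Section ImmigrationRoot.
Context {R : realType} (mu : R) (r : int -> R).
Hypothesis mu_ge0 : 0 <= mu.
Hypothesis r_ge0 : forall k : int, -1 <= k -> 0 <= r k.
Hypothesis r_sum1 : ((r (-1))%:E + \sum_(0 <= k <oo) (r k%:Z)%:E = 1%:E)%E.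

Let rp (k : nat) : R := r k%:Z.
Let B : R := 1 - r (-1).

Lemma r_nat_ge0 (k : nat) : 0 <= r k%:Z.
Proof. by apply: r_ge0; apply: (@le_trans _ _ 0) => //; rewrite lerN10. Qed.

Lemma r_nat_sum : (\sum_(0 <= k <oo) (r k%:Z)%:E = (1 - r (-1))%:E)%E.
Proof.
have /esym/eqP := r_sum1; rewrite addeC -sube_eq//.
  by rewrite -EFinB => /eqP.
by rewrite fin_num_adde_defl.
Qed.

Let rp_ge0 : forall k, 0 <= rp k := r_nat_ge0.
Let rp_sum : (\sum_(0 <= k <oo) (rp k)%:E = B%:E)%E := r_nat_sum.

Let rm_ge0 : 0 <= r (-1). Proof. exact: r_ge0. Qed.

Let rm_le1 : r (-1) <= 1.
Proof. by have := A_ge0 rp_ge0 rp_sum; rewrite subr_ge0. Qed.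

Lemma gen_r1 : gen_r r 1 = 1.
Proof. by rewrite /gen_r (gen_1 rp_ge0 rp_sum) divr1 addrC subrK. Qed.

Lemma gen_r_continuous z : 0 < z < 1 -> {for z, continuous (gen_r r)}.
Proof.
move=> z01; apply: continuousD; last exact: (gen_continuous rp_ge0 rp_sum).
apply: continuousM; first exact: cst_continuous.
by apply: inv_continuous; rewrite gt_eqF//; case/andP: z01.
Qed.

Lemma gen_r_ge z : 0 < z <= 1 -> r (-1) / z <= gen_r r z.
Proof.
move=> /andP[z0 z1]; rewrite lerDl; apply: (gen_ge0 rp_ge0 rp_sum).
by rewrite ltW.
Qed.

Lemma gen_r_le z : 0 < z <= 1 -> gen_r r z <= r (-1) / z + (1 - r (-1)).
Proof.
move=> /andP[z0 z1]; rewrite lerD2l.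
by have := gen_le rp_ge0 rp_sum (ltW z0) z1 (lexx 1); rewrite (gen_1 rp_ge0 rp_sum).
Qed.

Lemma expr_convex (a v c : R) k : 0 <= a -> a <= v -> v <= c ->
  (c - a) * v ^+ k <= (c - v) * a ^+ k + (v - a) * c ^+ k.
Proof.
move=> a0 av vc; have v0 := le_trans a0 av.
elim: k => [|k IH]; first by rewrite !expr0; lra.
have ac : a ^+ k <= c ^+ k by rewrite lerXn2r ?nnegrE ?(le_trans av)// (le_trans v0).
have h1 : (c - a) * v ^+ k.+1 <= ((c - v) * a ^+ k + (v - a) * c ^+ k) * v.
  by rewrite exprSr mulrA ler_wpM2r.
apply: le_trans h1 _; rewrite !exprSr -subr_ge0.
have -> : (c - v) * (a ^+ k * a) + (v - a) * (c ^+ k * c) -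
    ((c - v) * a ^+ k + (v - a) * c ^+ k) * v =
    (c - v) * (v - a) * (c ^+ k - a ^+ k) by ring.
by rewrite !mulr_ge0// subr_ge0.
Qed.

Lemma inv_convex (a v c : R) : 0 < a -> a <= v -> v <= c ->
  (c - a) / v <= (c - v) / a + (v - a) / c.
Proof.
move=> a0 av vc; have v0 := lt_le_trans a0 av; have c0 := lt_le_trans v0 vc.
rewrite -subr_ge0.
have -> : (c - v) / a + (v - a) / c - (c - a) / v =
    (c - v) * (v - a) * (c - a) / (a * v * c).
  by field; rewrite !gt_eqF.
by rewrite divr_ge0// ?mulr_ge0 ?subr_ge0 ?(le_trans av)// ltW.
Qed.

Lemma gen_r_convex a v c : 0 < a -> a <= v -> v <= c -> c <= 1 ->
  (c - a) * gen_r r v <= (c - v) * gen_r r a + (v - a) * gen_r r c.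
Proof.
move=> a0 av vc c1.
have va0 : 0 <= v - a by rewrite subr_ge0.
have cv0 : 0 <= c - v by rewrite subr_ge0.
have ca0 : 0 <= c - a by rewrite subr_ge0 (le_trans av).
have v01 : 0 <= v <= 1 by rewrite (le_trans (ltW a0))// (le_trans vc).
have a01 : 0 <= a <= 1 by rewrite ltW// (le_trans av)// (le_trans vc).
have c01 : 0 <= c <= 1 by rewrite c1 (le_trans (ltW a0))// (le_trans av).
have inv_part : (c - a) * (r (-1) / v) <= (c - v) * (r (-1) / a) + (v - a) * (r (-1) / c).
  rewrite !(mulrCA _ (r (-1))) -mulrDr ler_wpM2l//; exact: inv_convex.
suff ser : (c - a) * limn (pseries rp v) <=
    (c - v) * limn (pseries rp a) + (v - a) * limn (pseries rp c).
  rewrite /gen_r !mulrDr; apply: le_trans (lerD inv_part ser) _.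
  by rewrite le_eqVlt; apply/orP; left; apply/eqP; ring.
rewrite -lee_fin EFinD !EFinM -!(gen_sum rp_ge0 rp_sum)//.
have t0 z k : 0 <= z <= 1 -> (0 <= (rp k * z ^+ k)%:E)%E.
  by move=> /andP[z0 _]; rewrite lee_fin mulr_ge0// exprn_ge0.
rewrite -!nneseriesZl; try by move=> k _; exact: t0.
rewrite -nneseriesD; try by move=> k _ _; rewrite -EFinM lee_fin mulr_ge0// -lee_fin t0.
apply: lee_nneseries => [k _ _|k _]; first by rewrite -EFinM lee_fin mulr_ge0// -lee_fin t0.
rewrite -!EFinM -EFinD lee_fin !(mulrCA _ (rp k)) -mulrDr ler_wpM2l//.
by apply: expr_convex => //; case/andP: a01.
Qed.

(** The numerator of [gamma].  It is concave in [v], since [gen_r] is a sum of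
    convex functions. *)
Definition drift (q v : R) : R := q + mu * (1 - gen_r r v).

Lemma drift1 q : drift q 1 = q.
Proof. by rewrite /drift gen_r1 subrr mulr0 addr0. Qed.

Lemma drift_continuous q z : 0 < z < 1 -> {for z, continuous (drift q)}.
Proof.
move=> z01; apply: continuousD; first exact: cst_continuous.
apply: continuousM; first exact: cst_continuous.
by apply: continuousB; [exact: cst_continuous|exact: gen_r_continuous].
Qed.

Lemma drift_concave q a v c : 0 < a -> a <= v -> v <= c -> c <= 1 ->
  (c - v) * drift q a + (v - a) * drift q c <= (c - a) * drift q v.
Proof.
move=> a0 av vc c1; have h := gen_r_convex a0 av vc c1.
rewrite -subr_ge0 /drift.
have -> : (c - a) * (q + mu * (1 - gen_r r v)) -
    ((c - v) * (q + mu * (1 - gen_r r a)) + (v - a) * (q + mu * (1 - gen_r r c))) =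
    mu * ((c - v) * gen_r r a + (v - a) * gen_r r c - (c - a) * gen_r r v) by ring.
by rewrite mulr_ge0// subr_ge0.
Qed.

Variable q : R.
Hypothesis q_ge0 : 0 <= q.
Local Notation ph := (phi mu r q).

Let phi_no_culling : ~~ (0 < mu * r (-1)) -> ph = 0.
Proof. by rewrite /phi => /negbTE ->. Qed.

Let culling_zero : ~~ (0 < mu * r (-1)) -> mu = 0 \/ r (-1) = 0.
Proof.
rewrite -leNgt => h; have : mu * r (-1) == 0 by rewrite eq_le h mulr_ge0.
by rewrite mulf_eq0 => /orP[] /eqP; [left|right].
Qed.

(** Without culling, [mu = 0] or [gen_r] is a power series with nonnegative
    coefficients. *)
Let drift_noninc v c : ~~ (0 < mu * r (-1)) -> 0 < v -> v <= c -> c <= 1 ->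
  drift q c <= drift q v.
Proof.
move=> /culling_zero[m0|r0] v0 vc c1; first by rewrite /drift m0 !mul0r.
rewrite /drift lerD2l ler_wpM2l// lerD2l lerN2 /gen_r r0 !mul0r !add0r.
by apply: (gen_le rp_ge0 rp_sum) => //; exact: ltW.
Qed.

(** With culling [gen_r] has a pole at [0], so that the drift is negative near
    [0].  Its zero comes from the intermediate value theorem if [q > 0], and is a
    least root if [q = 0]. *)
Let phi_culling : 0 < mu * r (-1) ->
  [/\ 0 < ph <= 1, drift q ph = 0, 0 < q -> ph < 1 & forall v, 0 < v -> v <= ph -> drift q v <= 0].
Proof.
move=> mr; have rm0 : 0 < r (-1).
  by rewrite lt_neqAle rm_ge0 andbT eq_sym; apply/eqP => e; move: mr; rewrite e mulr0 ltxx.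
have mu0 : 0 < mu.
  by rewrite lt_neqAle mu_ge0 andbT eq_sym; apply/eqP => e; move: mr; rewrite e mul0r ltxx.
rewrite /phi mr; have [q0|q0] := eqVneq q 0.
  have fc z : 0 < z < 1 -> {for z, continuous (fun z => gen_r r z - 1)}.
    by move=> z01; apply: continuousB; [exact: gen_r_continuous|exact: cst_continuous].
  have fpos z : 0 < z <= 1 -> z < r (-1) -> 0 < gen_r r z - 1.
    move=> /andP[z0 z1] zr; rewrite subr_gt0; apply: lt_le_trans (gen_r_ge _); last by rewrite z0.
    by rewrite ltr_pdivlMr// mul1r.
  have f1 : gen_r r 1 - 1 = 0 by rewrite gen_r1 subrr.
  have := least_root fc f1 rm0 fpos.
  rewrite (_ : [set z | 0 < z <= 1 /\ gen_r r z - 1 = 0] = [set z | 0 < z <= 1 /\ gen_r r z = 1]).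
    set z0 := least _ => /= -[z01 fz pos]; split => //.
    - by rewrite /drift q0 add0r -opprB fz oppr0 mulr0.
    - by rewrite q0 ltxx.
    - move=> v v0; rewrite le_eqVlt => /predU1P[->|vz].
        by rewrite /drift q0 add0r -opprB fz oppr0 mulr0.
      rewrite /drift q0 add0r -opprB mulrN oppr_le0 mulr_ge0// ltW// pos//.
      by rewrite v0.
  by apply/seteqP; split=> z /= [z01 h]; split => //;
  [apply/eqP; rewrite -subr_eq0 h|rewrite h subrr].
have qp : 0 < q by rewrite lt_neqAle eq_sym q0.
set A := [set z | _].
have AE z : A z <-> 0 < z < 1 /\ drift q z = 0.
  rewrite /A /drift /=; split=> -[z01 h]; split => //; first by rewrite {1}h; ring.
  by apply/eqP; rewrite -subr_eq0 -h; apply/eqP; ring.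
(* At [a] culling outweighs [q + mu]; at [c] the bound of the power series by
   its value at [1] leaves a positive drift. *)
have exA : exists z, A z.
  pose m := mu * r (-1).
  pose a := m / (q + mu) / 2.
  pose c := (m / (m + q) + 1) / 2.
  have qm : 0 < q + mu by rewrite addr_gt0.
  have mq : 0 < m + q by rewrite addr_gt0.
  have m1 : m / (q + mu) < 1.
    by rewrite ltr_pdivrMr// mul1r /m (@le_lt_trans _ _ mu)// ?ler_piMr// ltrDr.
  have mq1 : m / (m + q) < 1 by rewrite ltr_pdivrMr// mul1r ltrDl.
  have mq0 : 0 < m / (m + q) by rewrite divr_gt0.
  have mqm : 0 < m / (q + mu) by rewrite divr_gt0.
  have a0 : 0 < a by rewrite /a divr_gt0.
  have ac : a < c by rewrite /a /c; lra.
  have c1 : c < 1 by rewrite /c; lra.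
  have Na : drift q a < 0.
    have := gen_r_ge (z := a); rewrite a0 (le_trans (ltW ac) (ltW c1)) => /(_ isT) ga.
    have : mu * (r (-1) / a) <= mu * gen_r r a by rewrite ler_wpM2l.
    rewrite mulrA -/m (_ : m / a = 2 * (q + mu)); last first.
      by rewrite /a; field; rewrite !gt_eqF.
    rewrite /drift mulrBr mulr1; move: qm; lra.
  have Nc : 0 < drift q c.
    have c0 := lt_trans a0 ac.
    have := gen_r_le (z := c); rewrite c0 (ltW c1) => /(_ isT) gc.
    have h1 : mu * gen_r r c <= m / c + mu - m.
      by apply: le_trans (ler_wpM2l mu_ge0 gc) _; rewrite /m mulrDr mulrBr mulr1 mulrA addrA.
    have h2 : m / c < m + q.
      by rewrite ltr_pdivrMr// mulrC -ltr_pdivrMr// /c; lra.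
    rewrite /drift mulrBr mulr1; lra.
  have cont : {within `[a, c], continuous (drift q)}.
    apply: continuous_in_subspaceT => y; rewrite inE /= in_itv/= => /andP[ay yc].
    by apply: drift_continuous; rewrite (lt_le_trans a0)// (le_lt_trans yc).
  have [|w] := IVT (ltW ac) cont (v := 0).
    by rewrite ge_min le_max (ltW Na) (ltW Nc) orbT.
  rewrite in_itv/= => /andP[aw wc] fw; exists w; apply/AE; split => //.
  by rewrite (lt_le_trans a0)// (le_lt_trans wc).
have := getPex exA; set z := get A => /AE[/andP[z0 z1] dz].
split => //; first by rewrite z0 ltW.
move=> v v0 vz; rewrite leNgt; apply/negP => dv.
have := drift_concave q v0 vz (ltW z1) (lexx 1); rewrite dz mulr0 drift1 leNgt => /negP; apply.
by rewrite ltr_pwDl ?mulr_gt0 ?subr_gt0// mulr_ge0// subr_ge0.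
Qed.

Lemma phi_ge0 : 0 <= ph.
Proof.
have [/phi_culling[/andP[/ltW]]//|/phi_no_culling ->] := boolP (0 < mu * r (-1)).
by [].
Qed.

Lemma phi_le1 : ph <= 1.
Proof.
by have [/phi_culling[/andP[]]//|/phi_no_culling ->] := boolP (0 < mu * r (-1)).
Qed.

Lemma phi_lt1 : 0 < q -> ph < 1.
Proof.
by have [/phi_culling[]//|/phi_no_culling ->] := boolP (0 < mu * r (-1)).
Qed.

Lemma drift_le0 v : 0 < v -> v <= ph -> drift q v <= 0.
Proof.
have [/phi_culling[_ _ _ h]|/phi_no_culling ->] := boolP (0 < mu * r (-1)).
  exact: h.
by move=> v0; rewrite leNgt v0.
Qed.

(** With culling, [drift] vanishes at [phi] and lies above its chords by
    concavity; without it, [phi = 0] and [drift] is nonincreasing. *)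
Lemma drift_chord v c : 0 < v -> ph <= v -> v <= c -> c <= 1 -> 0 <= drift q c ->
  (v - ph) * drift q c <= (c - ph) * drift q v.
Proof.
move=> v0 pv vc c1 dc.
have [/phi_culling[/andP[ph0 ph1] dph _ _]|h] := boolP (0 < mu * r (-1)).
  by have := drift_concave q ph0 pv vc c1; rewrite dph mulr0 add0r.
rewrite phi_no_culling// !subr0.
apply: (@le_trans _ _ (c * drift q c)); first by rewrite ler_wpM2r.
by rewrite ler_wpM2l ?(le_trans (ltW v0))// drift_noninc.
Qed.

Lemma drift_ge0 v : 0 < v -> ph <= v -> v <= 1 -> 0 <= drift q v.
Proof.
move=> v0 pv v1; have [e|ph1] := eqVneq ph 1.
  have -> : v = 1 by apply/eqP; rewrite eq_le v1 -e.
  by rewrite drift1.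
have ph1' : 0 < 1 - ph by rewrite subr_gt0 lt_neqAle ph1 phi_le1.
have := drift_chord v0 pv v1 (lexx 1); rewrite drift1 => /(_ q_ge0).
move=> h; rewrite -(pmulr_rge0 _ ph1'); apply: le_trans h.
by rewrite mulr_ge0// subr_ge0.
Qed.

Lemma drift_gt0 v : 0 < q -> 0 < v -> ph < v -> v <= 1 -> 0 < drift q v.
Proof.
move=> q0 v0 pv v1; have ph1' : 0 < 1 - ph by rewrite subr_gt0 phi_lt1.
have := drift_chord v0 (ltW pv) v1 (lexx 1); rewrite drift1 => /(_ q_ge0).
move=> h; rewrite -(pmulr_rgt0 _ ph1'); apply: lt_le_trans h.
by rewrite mulr_gt0// subr_gt0.
Qed.

Lemma phi_lt_pos v : 0 < v -> 0 < drift q v -> ph < v.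
Proof. by move=> v0 dv; rewrite ltNge; apply/negP => /(drift_le0 v0); rewrite leNgt dv. Qed.

End ImmigrationRoot.

(** * The integrating factor and its moments *)

(** What the construction of the integrating factor uses of the exponent
    [gamma = N / D] on [(0, top)]: the sign change of the numerator at the base
    point [bot], which makes the factor at most [1], the integrability of the
    exponent near [0], and a denominator that vanishes at most linearly at
    [top]. *)
Record exponent_data {R : realType} (top bot slope : R) (N D : R -> R) : Prop := {
  data_top : 0 < top <= 1;
  data_bot : 0 <= bot < top;
  denominator_cont : forall v, 0 < v < top -> {for v, continuous D};
  denominator_gt0 : forall v, 0 < v < top -> 0 < D v;
  denominator_low : forall u, 0 < u < top ->
    exists2 m, 0 < m & forall v, 0 < v <= u -> m <= D v;
  denominator_le : 0 < slope /\ forall v, 0 < v < top -> D v <= slope * (top - v);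
  numerator_cont : forall v, 0 < v < top -> {for v, continuous N};
  numerator_le0 : forall v, 0 < v -> v <= bot -> N v <= 0;
  numerator_ge0 : forall v, 0 < v < top -> bot <= v -> 0 <= N v;
  numerator_bounded : exists C, forall v, 0 < v < top -> N v <= C }.

Section IntegratingFactor.
Context {R : realType}.
Local Notation leb := (@lebesgue_measure R).
Variables (top bot slope : R) (N D : R -> R).
Hypothesis data : exponent_data top bot slope N D.

Let top_gt0 : 0 < top. Proof. by case/andP: (data_top data). Qed.
Let top_le1 : top <= 1. Proof. by case/andP: (data_top data). Qed.
Let bot_ge0 : 0 <= bot. Proof. by case/andP: (data_bot data). Qed.
Let bot_lt : bot < top. Proof. by case/andP: (data_bot data). Qed.
Let slope_gt0 : 0 < slope := (denominator_le data).1.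
Let D_le := (denominator_le data).2.
Let D_cont := denominator_cont data.
Let D_gt0 := denominator_gt0 data.
Let D_low := denominator_low data.
Let N_cont := numerator_cont data.
Let N_le0 := numerator_le0 data.
Let N_ge0 := numerator_ge0 data.

Let gam (v : R) : R := N v / D v.

(** The solution of [E' = - gam E] with [E (bot) = 1]. *)
Definition factor (v : R) : R := expR (- oint bot v gam).

Let gam_cont v : 0 < v < top -> {for v, continuous gam}.
Proof.
move=> v01; apply: continuousM; first exact: N_cont.
by apply: continuousV; [rewrite gt_eqF// D_gt0|exact: D_cont].
Qed.

Let cont_within (f : R -> R) a b : 0 < a -> b < top ->
  (forall v, 0 < v < top -> {for v, continuous f}) -> {within `[a, b], continuous f}.
Proof.
move=> a0 bt fc; apply: continuous_in_subspaceT => y; rewrite inE /= in_itv/= => /andP[ay yb].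
by apply: fc; rewrite (lt_le_trans a0)// (le_lt_trans yb).
Qed.

Let integrable_within (f : R -> R) a b : 0 < a -> b < top ->
  (forall v, 0 < v < top -> {for v, continuous f}) -> leb.-integrable `[a, b] (EFin \o f).
Proof.
move=> a0 bt fc; apply: continuous_compact_integrable; first exact: segment_compact.
exact: cont_within.
Qed.

Lemma measurable_inside (f : R -> R) : (forall v, 0 < v < top -> {for v, continuous f}) ->
  measurable_fun (`]0, top[%classic : set R) f.
Proof.
move=> fc; apply: open_continuous_measurable_fun; first exact: interval_open.
by move=> v; rewrite inE /= in_itv/= => /fc.
Qed.

(** Either the interval stays away from [0], or the exponent is bounded on it. *)
Let gam_integrable a b : 0 < a \/ (a = 0 /\ bot = 0) -> b < top ->
  leb.-integrable `[a, b] (EFin \o gam).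
Proof.
move=> [a0 bt|[-> bot0] bt]; first exact: integrable_within.
have [b0|b0] := leP b 0.
  apply: (@integrableS _ _ _ leb [set 0]) => //.
  - by move=> y /=; rewrite in_itv/= => /andP[y0 yb]; apply/eqP; rewrite eq_le y0 (le_trans yb).
  - apply/integrableP; split; first exact: measurable_fun_set1.
    by rewrite integral_set1.
have [m m0 Dm] := D_low (introT andP (conj b0 bt)).
have [C NC] := numerator_bounded data.
apply: measurable_bounded_integrable => //.
- by apply: compact_finite_measure; exact: segment_compact.
- apply/measurable_fun_itv_obnd_cbndP.
  apply: (measurable_funS (E := `]0, top[%classic)) => //.
    by apply: subset_itvl; rewrite bnd_simp.
  exact: measurable_inside.
- exists (Num.max (C / m) `|gam 0|); split; first exact: num_real.
  move=> M; rewrite gt_max => /andP[CM gM] v /=; rewrite in_itv/= => /andP[v0 vb].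
  move: v0; rewrite le_eqVlt => /predU1P[<-|v0]; first exact: ltW.
  have vt : 0 < v < top by rewrite v0 (le_lt_trans vb).
  have Nv := N_ge0 vt (eq_rect _ (fun z => is_true (z <= v)) (ltW v0) _ (esym bot0)).
  have Dv := D_gt0 vt.
  rewrite ger0_norm; last by rewrite divr_ge0// ltW.
  apply: le_trans (ltW CM).
  rewrite ler_pdivrMr// mulrAC ler_pdivlMr//.
  apply: ler_pM => //; [exact: ltW|exact: NC|by apply: Dm; rewrite v0].
Qed.

Let Rint (a b : R) : R := \int[leb]_(w in `[a, b]) gam w.

Let Rint_split a b c : a <= b -> b <= c -> leb.-integrable `[a, c] (EFin \o gam) ->
  Rint a c = Rint a b + Rint b c.
Proof.
move=> ab bc ig; rewrite /Rint; have := @Rintegral_itvB R gam (BLeft a) (BRight c) b ig.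
rewrite !bnd_simp => /(_ ab bc)/eqP; rewrite subr_eq addrC => /eqP ->.
congr (_ + _); apply: Rintegral_itv_obnd_cbnd.
by apply: integrableS ig => //; apply: subset_itvr; rewrite bnd_simp.
Qed.

(** A base point below both [bot] and [v], at which the oriented integral becomes
    a difference of two ordinary ones. *)
Let base_oint a v : 0 < a \/ (a = 0 /\ bot = 0) -> a <= bot -> a <= v -> v < top ->
  oint bot v gam = Rint a v - Rint a bot.
Proof.
move=> a0 ab av vt; rewrite /oint; case: ifPn => [bv|]; last rewrite -ltNge => vb.
  by rewrite (Rint_split ab bv) ?(addrC (Rint a bot)) ?addrK//; exact: gam_integrable.
by rewrite (Rint_split av (ltW vb)) ?opprD ?addrA ?subrr ?sub0r//; exact: gam_integrable.
Qed.

Let derive_exp_opp (G : R -> R) (v g c : R) : is_derive v 1 G g ->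
  is_derive v 1 (fun w => expR (- (G w - c))) (- (g * expR (- (G v - c)))).
Proof.
move=> DG; have h1 := is_deriveN (is_deriveB DG (is_derive_cst c v 1)).
have h2 := @is_derive1_comp _ expR (fun w => - (G w - c)) _ _ _ (is_derive_expR _) h1.
by apply: (is_derive_eq h2); rewrite subr0 mulrN mulrC.
Qed.

Lemma factor_derive v : 0 < v < top -> is_derive v 1 factor (- (gam v * factor v)).
Proof.
move=> /andP[v0 vt].
(* The base point is interior if [bot > 0], and [0] itself if [bot = 0]. *)
pose a := Num.min bot (v / 2).
have v2 : v / 2 < v by lra.
have av : a < v by rewrite gt_min v2 orbT.
have ab : a <= bot by rewrite ge_min lexx.
have a0 : 0 < a \/ (a = 0 /\ bot = 0).
  move: bot_ge0; rewrite le_eqVlt => /predU1P[b0|b0]; [right|left].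
    by split; rewrite // /a -b0 min_l// divr_ge0// ltW.
  by rewrite lt_min b0 divr_gt0.
pose u := (v + top) / 2.
have vu : v < u by rewrite /u; lra.
have ut : u < top by rewrite /u; lra.
have := continuous_FTC1_closed vu (gam_integrable a0 ut) av (gam_cont (introT andP (conj v0 vt))).
move=> -[dF eF].
have DF : is_derive v 1 (Rint a) (gam v).
  by split; [exact: dF|exact: etrans (esym (derive1E _ _)) eF].
have DG : is_derive v 1 (fun w => expR (- (Rint a w - Rint a bot)))
    (- (gam v * expR (- (Rint a v - Rint a bot)))).
  exact: derive_exp_opp.
have FE w : a <= w -> w < top -> factor w = expR (- (Rint a w - Rint a bot)).
  by move=> aw wt; rewrite /factor (base_oint a0 ab aw wt).
rewrite (FE v (ltW av) vt); apply: near_eq_is_derive DG.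
near=> w; rewrite FE//; last by near: w; exact: lt_nbhsl.
by apply: ltW; near: w; exact: lt_nbhsr.
Unshelve. all: by end_near. Qed.

Lemma factor_gt0 v : 0 < factor v.
Proof. exact: expR_gt0. Qed.

Lemma factor_cont v : 0 < v < top -> {for v, continuous factor}.
Proof.
move=> v01; apply/differentiable_continuous/derivable1_diffP.
by have [] := factor_derive v01.
Qed.

Let Rint_ge0 a b : bot <= a -> 0 <= a -> b < top -> 0 <= Rint a b.
Proof.
move=> ba a0 bt; have [ab|ab] := ltP b a.
  by rewrite /Rint set_itv_ge ?bnd_simp -?ltNge// Rintegral_set0.
have a0' : 0 < a \/ (a = 0 /\ bot = 0).
  move: a0; rewrite le_eqVlt => /predU1P[e|a0]; [right|by left].
  by split => //; apply/eqP; rewrite eq_le bot_ge0 andbT e.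
rewrite /Rint -Rintegral_itv_obnd_cbnd; last first.
  by apply: integrableS (gam_integrable a0' bt) => //; apply: subset_itvr; rewrite bnd_simp.
apply: Rintegral_ge0 => v; rewrite /= in_itv/= => /andP[av vb].
have v01 : 0 < v < top by rewrite (le_lt_trans a0)// (le_lt_trans vb).
by rewrite divr_ge0// ?N_ge0// ?ltW// ?D_gt0// (le_lt_trans ba).
Qed.

Lemma factor_le1 v : 0 < v < top -> factor v <= 1.
Proof.
move=> /andP[v0 vt]; rewrite -expR0 ler_expR oppr_le0 /oint.
case: ifPn => [bv|]; first exact: Rint_ge0.
rewrite -ltNge oppr_ge0 => vb.
have -> : \int[leb]_(w in `[v, bot]) gam w = - \int[leb]_(w in `[v, bot]) (- gam w).
  rewrite -[RHS]mulN1r -RintegralZl//.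
    by apply: eq_Rintegral => w _; rewrite mulN1r opprK.
  apply: (integrable_within (f := fun w => - gam w)) => // w w01.
  by apply: continuousN; exact: gam_cont.
rewrite oppr_le0; apply: Rintegral_ge0 => w; rewrite /= in_itv/= => /andP[vw wb].
have w0 := lt_le_trans v0 vw.
have w01 : 0 < w < top by rewrite w0 (le_lt_trans wb).
by rewrite /gam -mulNr divr_ge0// ?oppr_ge0 ?N_le0// ltW// D_gt0.
Qed.

Lemma factor_noninc s t : bot <= s -> 0 < s -> s <= t -> t < top -> factor t <= factor s.
Proof.
move=> bs s0 st tt; rewrite ler_expR lerN2 /oint bs (le_trans bs st).
rewrite -!/(Rint _ _) (@Rint_split bot s t) ?lerDl//; first by apply: Rint_ge0 => //; exact: ltW.
apply: gam_integrable => //; move: bot_ge0; rewrite le_eqVlt => /predU1P[<-|b0]; [by right|by left].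
Qed.

(** Divided by the denominator, the factor becomes the density against which the
    moments of the solution are taken. *)
Definition dens (v : R) : R := factor v / D v.

Definition weight (S : set R) (x : nat) : \bar R :=
  (\int[leb]_(v in S) (dens v * v ^+ x)%:E)%E.

Let flux (x : nat) (v : R) : R := x%:R * v ^+ x.-1 * D v - N v * v ^+ x.

Lemma dens_gt0 v : 0 < v < top -> 0 < dens v.
Proof. by move=> v01; rewrite divr_gt0 ?factor_gt0// D_gt0. Qed.

Lemma dens_cont v : 0 < v < top -> {for v, continuous dens}.
Proof.
move=> v01; apply: continuousM; first exact: factor_cont.
by apply: continuousV; [rewrite gt_eqF// D_gt0|exact: D_cont].
Qed.

Let dens_mul_cont (f : R -> R) : (forall v, 0 < v < top -> {for v, continuous f}) ->
  forall v, 0 < v < top -> {for v, continuous (fun v => dens v * f v)}.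
Proof. by move=> fc v v01; apply: continuousM; [exact: dens_cont|exact: fc]. Qed.

Let expr_cont (x : nat) (v : R) : 0 < v < top -> {for v, continuous (fun v : R => v ^+ x)}.
Proof. by move=> _; exact: exprn_continuous. Qed.

Let flux_cont x v : 0 < v < top -> {for v, continuous (flux x)}.
Proof.
move=> v01; apply: continuousB.
  apply: continuousM; last exact: D_cont.
  by apply: continuousM; [exact: cst_continuous|exact: expr_cont].
by apply: continuousM; [exact: N_cont|exact: expr_cont].
Qed.

(** The reason for the choice of the factor: up to the diagonal term, the action
    of the generator on powers becomes an exact derivative. *)
Let power_derive x v : 0 < v < top ->
  is_derive v 1 (fun v => factor v * v ^+ x) (dens v * flux x v).
Proof.
move=> v01; have h1 := factor_derive v01.
have h2 : is_derive v 1 (fun v : R => v ^+ x) (x%:R * v ^+ x.-1).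
  by split; [exact: exprn_derivable|rewrite exp_derive /GRing.scale/= mulr1].
have h3 := is_deriveM h1 h2.
apply: (is_derive_eq h3); rewrite /GRing.scale/= /dens /flux /gam.
by field; rewrite gt_eqF// D_gt0.
Qed.

Let flux_integral x a b : 0 < a -> a < b -> b < top ->
  (\int[leb]_(v in `[a, b]) (dens v * flux x v)%:E = (factor b * b ^+ x)%:E - (factor a * a ^+ x)%:E)%E.
Proof.
move=> a0 ab bt; have b0 := lt_trans a0 ab; have at' := lt_trans ab bt.
have Fc v : 0 < v < top -> {for v, continuous (fun v => factor v * v ^+ x)}.
  by move=> v01; apply: continuousM; [exact: factor_cont|exact: expr_cont].
apply: (@continuous_FTC2 _ _ (fun v => factor v * v ^+ x)) => //.
- by apply: cont_within => //; apply: dens_mul_cont; exact: flux_cont.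
- split.
  + move=> v; rewrite in_itv/= => /andP[av vb].
    by have [] := @power_derive x v (introT andP (conj (lt_trans a0 av) (lt_trans vb bt))).
  + by apply: cvg_at_right_filter; apply: Fc; rewrite a0.
  + by apply: cvg_at_left_filter; apply: Fc; rewrite b0.
- move=> v; rewrite in_itv/= => /andP[av vb].
  rewrite derive1E.
  by have [_ ->] := @power_derive x v (introT andP (conj (lt_trans a0 av) (lt_trans vb bt))).
Qed.

(** The fundamental theorem of calculus for [factor v * v ^+ x]. *)
Let source_integral_closed (c : R) x a b : 0 <= c -> 0 < a -> a < b -> b < top ->
  (\int[leb]_(v in `[a, b]) (dens v * (c * v ^+ x + flux x v))%:E + (factor a * a ^+ x)%:E =
   c%:E * weight `[a, b] x + (factor b * b ^+ x)%:E)%E.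
Proof.
move=> c0 a0 ab bt.
pose f1 v := (dens v * v ^+ x)%:E; pose f2 v := (dens v * flux x v)%:E.
have i1 : leb.-integrable `[a, b] f1.
  by apply: (integrable_within a0 bt); apply: dens_mul_cont; exact: expr_cont.
have i2 : leb.-integrable `[a, b] f2.
  by apply: (integrable_within a0 bt); apply: dens_mul_cont; exact: flux_cont.
have i1c : leb.-integrable `[a, b] (fun v => c%:E * f1 v)%E by exact: integrableZl.
rewrite (_ : (\int[leb]_(v in `[a, b]) (dens v * (c * v ^+ x + flux x v))%:E)%E =
  (\int[leb]_(v in `[a, b]) (c%:E * f1 v + f2 v))%E); last first.
  by apply: eq_integral => v _; rewrite /f1 /f2 -EFinM -EFinD mulrDr mulrCA.
rewrite (integralD _ i1c i2)// (integralZl _ i1)// /weight -/f1.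
rewrite -addeA; congr (_ + _)%E; rewrite [X in (X + _)%E]flux_integral//.
by rewrite -EFinB -EFinD subrK.
Qed.

(** Nonnegative integrals over the open ends are limits along geometric
    sequences of end points. *)
Let low (b : R) (n : nat) : R := b / 2 * 2^-1 ^+ n.
Let high (n : nat) : R := top - low top n.

Let low_gt0 b n : 0 < b -> 0 < low b n.
Proof. by move=> b0; rewrite mulr_gt0 ?divr_gt0// exprn_gt0// invr_gt0. Qed.

Let low_lt b n : 0 < b -> low b n < b.
Proof.
move=> b0; apply: (@le_lt_trans _ _ (b / 2)).
  have h : 2^-1 ^+ n <= 1 :> R by rewrite exprn_ile1 ?invr_ge0// invf_le1// ler1n.
  by apply: ler_piMr h; rewrite divr_ge0// ltW.
by rewrite ltr_pdivrMr// ltr_pMr// ltr1n.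
Qed.

Let low_noninc b m n : 0 < b -> (m <= n)%N -> low b n <= low b m.
Proof.
move=> b0 mn; rewrite ler_wpM2l ?divr_ge0 ?(ltW b0)//.
by rewrite ler_wiXn2l// ?invr_ge0// invf_le1// ler1n.
Qed.

Let cvg_low b : low b n @[n --> \oo] --> 0.
Proof.
by apply: (@cvg_geometric R (b / 2) 2^-1); rewrite ger0_norm ?invr_ge0// invf_lt1// ltr1n.
Qed.

Let high_in n : 0 < high n < top.
Proof. by rewrite /high subr_gt0 low_lt// ltrBlDr ltrDl low_gt0. Qed.

Let high_nondec m n : (m <= n)%N -> high m <= high n.
Proof. by move=> mn; rewrite lerD2l lerN2 low_noninc. Qed.

Let cvg_high : high n @[n --> \oo] --> top.
Proof.
by rewrite -[X in _ --> X]subr0; apply: cvgB; [exact: cvg_cst|exact: cvg_low].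
Qed.

Let measurable_EFin_inside (h : R -> R) (S : set R) : S `<=` `]0, top[%classic ->
  (forall v, 0 < v < top -> {for v, continuous h}) -> measurable_fun S (EFin \o h).
Proof.
move=> St hc; apply: (measurable_funS (E := `]0, top[%classic)) => //.
by apply/measurable_EFinP; exact: measurable_inside.
Qed.

Let cvg_integral_low (h : R -> R) b : 0 < b -> b < top ->
  (forall v, 0 < v < top -> {for v, continuous h}) -> (forall v, 0 < v < top -> 0 <= h v) ->
  (\int[leb]_(v in `[low b n, b]) (h v)%:E)%E @[n --> \oo] -->
  (\int[leb]_(v in `]0%R, b]) (h v)%:E)%E.
Proof.
move=> b0 bt hc h0.
have St n : (`[low b n, b] `<=` `]0, top[)%classic.
  by move=> v /=; rewrite !in_itv/= => /andP[lv vb]; rewrite (lt_le_trans (low_gt0 n b0))// (le_lt_trans vb).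
have -> : (`]0%R, b]%classic : set R) = \bigcup_n `[low b n, b]%classic.
  apply/seteqP; split=> v /=; last first.
    by move=> [n _] /=; rewrite !in_itv/= => /andP[lv ->]; rewrite (lt_le_trans (low_gt0 n b0)).
  rewrite in_itv/= => /andP[v0 vb].
  have /(_ _)[] := (cvgr_lt _ (@cvg_low b)) _ v0 => n0 _ H; exists n0 => //=.
  by rewrite in_itv/= vb andbT ltW//; exact: (H n0 (leqnn n0)).
apply: ge0_nondecreasing_set_cvg_integral.
- by move=> m n mn; rewrite subsetEset; apply: subset_itvr; rewrite bnd_simp low_noninc.
- by move=> n; exact: measurable_itv.
- by move=> n; exact: measurable_EFin_inside.
- by move=> n v /St; rewrite /= in_itv/= lee_fin; exact: h0.
Qed.

Let cvg_integral_high (h : R -> R) :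
  (forall v, 0 < v < top -> {for v, continuous h}) -> (forall v, 0 < v < top -> 0 <= h v) ->
  (\int[leb]_(v in `]0%R, high n]) (h v)%:E)%E @[n --> \oo] -->
  (\int[leb]_(v in `]0%R, top[) (h v)%:E)%E.
Proof.
move=> hc h0.
have St n : (`]0%R, high n] `<=` `]0, top[)%classic.
  by apply: subset_itvl; rewrite bnd_simp; case/andP: (high_in n).
have -> : (`]0%R, top[%classic : set R) = \bigcup_n `]0%R, high n]%classic.
  apply/seteqP; split=> v /=; last by move=> [n _ /St].
  rewrite in_itv/= => /andP[v0 vb].
  have /(_ _)[] := (cvgr_gt _ cvg_high) _ vb => n0 _ H; exists n0 => //=.
  by rewrite in_itv/= v0 ltW//; exact: (H n0 (leqnn n0)).
apply: ge0_nondecreasing_set_cvg_integral.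
- by move=> m n mn; rewrite subsetEset; apply: subset_itvl; rewrite bnd_simp high_nondec.
- by move=> n; exact: measurable_itv.
- by move=> n; exact: measurable_EFin_inside.
- by move=> n v /St; rewrite /= in_itv/= lee_fin; exact: h0.
Qed.

Lemma moment_ge0 x v : 0 < v < top -> 0 <= dens v * v ^+ x.
Proof. by move=> /[dup] v01 /andP[v0 _]; rewrite mulr_ge0 ?exprn_ge0 ?ltW// dens_gt0. Qed.

Let moment_cont x v : 0 < v < top -> {for v, continuous (fun v => dens v * v ^+ x)}.
Proof. by apply: dens_mul_cont => w; exact: expr_cont. Qed.

Lemma measurable_moment x (S : set R) : S `<=` `]0, top[%classic ->
  measurable_fun S (fun v => (dens v * v ^+ x)%:E).
Proof. by move=> St; apply: (measurable_EFin_inside St); exact: moment_cont. Qed.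

Lemma weight_ge0 (S : set R) x : S `<=` `]0, top[%classic -> (0 <= weight S x)%E.
Proof.
by move=> St; apply: integral_ge0 => v /St; rewrite /= in_itv/= lee_fin; exact: moment_ge0.
Qed.

Lemma weight_le (S T : set R) x : measurable S -> measurable T ->
  S `<=` T -> T `<=` `]0, top[%classic -> (weight S x <= weight T x)%E.
Proof.
move=> mS mT ST Tt; apply: ge0_subset_integral => //; first exact: measurable_moment.
by move=> v /Tt; rewrite /= in_itv/= lee_fin; exact: moment_ge0.
Qed.

Lemma weight_exp_le (c : R) (S : set R) x : measurable S -> S `<=` `]0, top[%classic ->
  0 <= c -> (forall v, S v -> v <= c) -> (weight S x <= (c ^+ x)%:E * weight S 0)%E.
Proof.
move=> mS St c0 Sc; rewrite /weight -ge0_integralZl_EFin ?exprn_ge0//; last 2 first.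
- by move=> v /St; rewrite /= in_itv/= lee_fin; exact: moment_ge0.
- exact: measurable_moment.
apply: ge0_le_integral => //.
- by move=> v /St; rewrite /= in_itv/= lee_fin; exact: moment_ge0.
- exact: measurable_moment.
- by apply: measurable_funeM; exact: measurable_moment.
move=> v Sv; have /= := St _ Sv; rewrite in_itv/= => v01.
rewrite -EFinM lee_fin expr0 mulr1 mulrC ler_wpM2r ?(ltW (dens_gt0 v01))//.
by case/andP: v01 => v0 _; rewrite lerXn2r ?nnegrE ?(ltW v0)// Sc.
Qed.

Lemma weight_exp_ge (c : R) (S : set R) x : measurable S -> S `<=` `]0, top[%classic ->
  0 <= c -> (forall v, S v -> c <= v) -> ((c ^+ x)%:E * weight S 0 <= weight S x)%E.
Proof.
move=> mS St c0 Sc; rewrite /weight -ge0_integralZl_EFin ?exprn_ge0//; last 2 first.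
- by move=> v /St; rewrite /= in_itv/= lee_fin; exact: moment_ge0.
- exact: measurable_moment.
apply: ge0_le_integral => //.
- move=> v /St; rewrite /= in_itv/= -EFinM lee_fin => v01.
  by rewrite mulr_ge0 ?exprn_ge0// moment_ge0.
- by apply: measurable_funeM; exact: measurable_moment.
- exact: measurable_moment.
move=> v Sv; have /= := St _ Sv; rewrite in_itv/= => v01.
rewrite -EFinM lee_fin expr0 mulr1 mulrC ler_wpM2l ?(ltW (dens_gt0 v01))//.
by rewrite lerXn2r ?nnegrE ?Sc//; case/andP: v01 => v0 _; exact: ltW.
Qed.

Let sub_low b : b < top -> `]0%R, b] `<=` `]0%R, top[%classic.
Proof. by move=> bt; apply: subset_itvl; rewrite bnd_simp. Qed.

Lemma weight_low_fin b x : 0 < b -> b < top -> (weight `]0%R, b] x < +oo)%E.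
Proof.
move=> b0 bt; have [m m0 Dm] := D_low (introT andP (conj b0 bt)).
have b1 : b <= 1 by rewrite (le_trans (ltW bt)).
have fin : (leb `]0%R, b] < +oo)%E.
  apply: (@le_lt_trans _ _ (leb `[0%R, b])).
    by apply: le_measure; rewrite ?inE//; apply: subset_itvr; rewrite bnd_simp.
  by apply: compact_finite_measure; exact: segment_compact.
apply: (@le_lt_trans _ _ (\int[leb]_(v in `]0%R, b]) (cst (m^-1)%:E v))%E).
  apply: ge0_le_integral => //.
  - by move=> v /(sub_low bt); rewrite /= in_itv/= lee_fin; exact: moment_ge0.
  - by apply: measurable_moment; exact: sub_low.
  move=> v /=; rewrite in_itv/= => /andP[v0 vb].
  have v01 : 0 < v < top by rewrite v0 (le_lt_trans vb).
  rewrite lee_fin; apply: (@le_trans _ _ (dens v)).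
    by rewrite ler_piMr ?(ltW (dens_gt0 _))// exprn_ile1 ?(ltW v0)// (le_trans vb).
  have Dv := D_gt0 v01; have Dm' : (D v)^-1 <= m^-1 by rewrite lef_pV2 ?posrE// Dm// v0.
  rewrite /dens -[leRHS]mul1r; apply: ler_pM => //; [exact: ltW (factor_gt0 _)| |exact: factor_le1].
  by rewrite invr_ge0 ltW.
rewrite integral_cst//; apply: lte_mul_pinfty => //.
by rewrite lee_fin invr_ge0 ltW.
Qed.

Let limn_eD_fin (u w : nat -> \bar R) (a : \bar R) (z : R) :
  u n @[n --> \oo] --> a -> w n @[n --> \oo] --> z%:E ->
  limn (fun n => u n + w n)%E = (a + z%:E)%E.
Proof.
move=> ua wz; apply/(cvg_lim (@ereal_hausdorff R)); apply: cvgeD => //.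
exact: fin_num_adde_defl.
Qed.

Let weight_split a b x : 0 < a -> a <= b -> b < top ->
  weight `]0%R, b] x = (weight `]0%R, a] x + weight `]a, b] x)%E.
Proof.
move=> a0 ab bt.
have U : (`]0%R, b]%classic : set R) = `]0%R, a]%classic `|` `]a, b]%classic.
  by apply: itv_bndbnd_setU; rewrite bnd_simp//; exact: ltW.
rewrite /weight U ge0_integral_setU//; rewrite -?U.
- by apply: measurable_moment; exact: sub_low.
- by move=> v /(sub_low bt); rewrite /= in_itv/= lee_fin; exact: moment_ge0.
- by apply/disj_setPS => v [] /=; rewrite !in_itv/= => /andP[_ va] /andP[av _]; have := lt_le_trans av va; rewrite ltxx.
Qed.

(** Where the numerator of the exponent is bounded below, the density is
    dominated by the decrease of the factor. *)
Lemma weight_fin_of_bound c m : 0 < c < top -> 0 < m ->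
  (forall v, c <= v < top -> m <= N v) -> (weight `]0%R, top[ 0 < +oo)%E.
Proof.
move=> /andP[c0 ct] m0 Nm.
apply: (@le_lt_trans _ _ (weight `]0%R, c] 0 + (m^-1)%:E)%E); last first.
  by rewrite lte_add_pinfty ?ltry// weight_low_fin.
have C := cvg_integral_high (@moment_cont 0) (@moment_ge0 0).
apply: (cvge_to_le C).
have [n0 _ H] := (cvgr_gt _ cvg_high) _ ct; exists n0 => // n /H ch.
have /andP[h0 ht] := high_in n.
rewrite -/(weight _ _) (weight_split 0 c0 (ltW ch) ht) leeD2l//.
apply: (@le_trans _ _ (weight `[c, high n] 0)).
  apply: weight_le => //; first by apply: subset_itvr; rewrite bnd_simp.
  by move=> v /=; rewrite !in_itv/= => /andP[cv vh]; rewrite (lt_le_trans c0)// (le_lt_trans vh).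
have it : leb.-integrable `[c, high n] (fun v => (dens v * flux 0 v)%:E).
  by apply: (integrable_within c0 ht); apply: dens_mul_cont; exact: flux_cont.
have E : (\int[leb]_(v in `[c, high n]) (dens v * N v)%:E = (factor c)%:E - (factor (high n))%:E)%E.
  transitivity (\int[leb]_(v in `[c, high n]) ((-1)%:E * (dens v * flux 0 v)%:E))%E.
    by apply: eq_integral => v _; rewrite -EFinM /flux expr0; congr EFin; ring.
  rewrite (@integralZl _ _ R leb _ (measurable_itv _) _ it (-1)) (flux_integral 0 c0 ch ht).
  move: (factor c) (factor (high n)) => y z.
  by rewrite -EFinB -EFinM !expr0 !mulr1 mulN1r opprB.
apply: (@le_trans _ _ ((m^-1)%:E * \int[leb]_(v in `[c, high n]) (dens v * N v)%:E)%E); last first.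
  rewrite E -EFinB -EFinM lee_fin ler_piMr ?invr_ge0 ?(ltW m0)//.
  have h1 := factor_le1 (introT andP (conj c0 ct)); have h2 := factor_gt0 (high n).
  by move: h1 h2; move: (factor c) (factor (high n)) => y z; lra.
have sub : `[c, high n] `<=` `]0, top[%classic.
  by move=> v /=; rewrite !in_itv/= => /andP[cv vh]; rewrite (lt_le_trans c0)// (le_lt_trans vh).
have mN : measurable_fun `[c, high n] (fun v => (dens v * N v)%:E).
  by apply: (measurable_EFin_inside sub); exact: dens_mul_cont.
have ge v : `[c, high n]%classic v -> 0 < dens v /\ m <= N v.
  move=> cv; have := sub _ cv; rewrite /= in_itv/= => v01; split; first exact: dens_gt0.
  by apply: Nm; move: cv; rewrite /= in_itv/= => /andP[-> _]; case/andP: v01.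
rewrite -ge0_integralZl_EFin ?invr_ge0 ?(ltW m0)//; last first.
  by move=> v /ge[d0 Nv]; rewrite lee_fin mulr_ge0 ?(ltW d0)// (le_trans (ltW m0)).
apply: ge0_le_integral => //.
- by move=> v /ge[d0 Nv]; rewrite expr0 mulr1 lee_fin ltW.
- exact: measurable_moment.
- exact: measurable_funeM.
move=> v /ge[d0 Nv]; rewrite expr0 mulr1 -EFinM lee_fin mulrCA ler_peMr ?(ltW d0)//.
by rewrite mulrC ler_pdivlMr// mul1r.
Qed.

Let weight_low_fin_num b x : 0 < b -> b < top -> weight `]0%R, b] x \is a fin_num.
Proof. by move=> b0 bt; rewrite ge0_fin_numE ?weight_low_fin// weight_ge0//; exact: sub_low. Qed.

Lemma weight_exhaust x : weight `]0%R, high n] x @[n --> \oo] --> weight `]0%R, top[ x.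
Proof. exact: (cvg_integral_high (@moment_cont x) (@moment_ge0 x)). Qed.

(** If the density is integrable then its moments tend to [0], and the boundary
    term at [top] disappears. *)
Section FiniteWeight.
Hypothesis weight_fin : (weight `]0%R, top[ 0 < +oo)%E.

Lemma weight_top_fin_num x : weight `]0%R, top[ x \is a fin_num.
Proof.
rewrite ge0_fin_numE ?weight_ge0//; apply: le_lt_trans weight_fin.
have := @weight_exp_le 1 `]0%R, top[%classic x; rewrite expr1n mul1e; apply => //.
by move=> v; rewrite /= in_itv/= => /andP[_ vt]; rewrite (le_trans (ltW vt)).
Qed.

Lemma weight_top_integrable x :
  leb.-integrable `]0%R, top[ (fun v => (dens v * v ^+ x)%:E).
Proof.
apply/integrableP; split; first exact: measurable_moment.
rewrite (_ : (\int[_]_(_ in _) _)%E = weight `]0%R, top[ x).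
  by have := weight_top_fin_num x; rewrite ge0_fin_numE// weight_ge0.
apply: eq_integral => v; rewrite inE/= in_itv/= => v01.
by rewrite ger0_norm// moment_ge0.
Qed.

Lemma weight_top_cvg0 : fine (weight `]0%R, top[ x) @[x --> \oo] --> 0.
Proof.
apply: fine_cvg.
have E0 : (\int[leb]_(v in `]0%R, top[) (cst 0 v) = 0%:E)%E by exact: integral0.
rewrite -E0; apply: (@dominated_cvg _ _ _ leb _ _ (fun x v => (dens v * v ^+ x)%:E) (cst 0%E)
  (fun v => (dens v * v ^+ 0)%:E)) => //.
- by move=> n; exact: measurable_moment.
- move=> v; rewrite /= in_itv/= => /andP[v0 vt]; apply: cvg_EFin; first by near=> n.
  rewrite /comp/= -(mulr0 (dens v)); apply: cvgMr; apply: cvg_expr.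
  by rewrite ger0_norm ?(ltW v0)// (lt_le_trans vt).
- exact: weight_top_integrable.
- move=> n v; rewrite /= in_itv/= => v01; rewrite ger0_norm ?moment_ge0//.
  rewrite lee_fin ler_wpM2l ?(ltW (dens_gt0 v01))// expr0 exprn_ile1//; case/andP: v01 => /ltW//.
  by move=> _ vt; rewrite (le_trans (ltW vt)).
Unshelve. all: by end_near. Qed.

(** On the n-th dyadic layer below [top] the density integrates to at least a
    fixed multiple of the factor, because the denominator is at most linear
    there; finiteness of the total integral forces the factor to vanish. *)
Lemma factor_cvg0 : factor (high n) @[n --> \oo] --> 0.
Proof.
pose w n := fine (weight `]0%R, high n] 0).
have wc : w n @[n --> \oo] --> fine (weight `]0%R, top[ 0).
  by apply: fine_cvg; rewrite fineK ?weight_top_fin_num//; exact: weight_exhaust.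
have dc : 2 * slope * (w n.+1 - w n) @[n --> \oo] --> 0.
  rewrite -(mulr0 (2 * slope)); apply: cvgMr.
  rewrite -(subrr (fine (weight `]0%R, top[ 0))); apply: cvgB => //.
  by rewrite (cvg_shiftS w).
rewrite -(cvg_shiftS (fun n => factor (high n))).
apply: (@squeeze_cvgr _ _ _ _ (cst 0) (fun n => 2 * slope * (w n.+1 - w n))); last 2 first.
- exact: cvg_cst.
- exact: dc.
have [n0 _ H] := (cvgr_gt _ cvg_high) _ bot_lt; exists n0 => // n /H bh /=.
rewrite ltW ?factor_gt0//=.
have /andP[h0 ht] := high_in n; have /andP[h0' ht'] := high_in n.+1.
have hh : high n <= high n.+1 by exact: high_nondec.
have lowE : low top n.+1 = low top n / 2 by rewrite /low exprSr mulrA.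
pose l := factor (high n.+1) / (slope * low top n).
have l0 : 0 < low top n by exact: low_gt0.
have lge0 : 0 <= l by rewrite divr_ge0 ?mulr_ge0 ?ltW// factor_gt0.
have key : (l%:E * (low top n / 2)%:E <= weight `]high n, high n.+1] 0)%E.
  have -> : (low top n / 2)%:E = leb `]high n, high n.+1].
    rewrite lebesgue_measure_itv/= lte_fin ltrD2l ltrN2 lowE.
    rewrite ltr_pdivrMr// ltr_pMr// ltr1n -EFinB; congr EFin.
    by rewrite /high lowE; field.
  rewrite -integral_cst//; apply: ge0_le_integral => //.
  - apply: measurable_moment => v /=; rewrite !in_itv/= => /andP[hv vh].
    by rewrite (lt_trans h0)// (le_lt_trans vh).
  move=> v /=; rewrite !in_itv/= => /andP[hv vh]; rewrite expr0 mulr1 lee_fin.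
  have v01 : 0 < v < top by rewrite (lt_trans h0)// (le_lt_trans vh).
  have vt : v < top by case/andP: v01.
  have v0 : 0 < v by case/andP: v01.
  have bv : bot <= v by rewrite (le_trans (ltW bh))// ltW.
  have fn := factor_noninc bv v0 vh ht'.
  have Dn : (slope * low top n)^-1 <= (D v)^-1.
    rewrite lef_pV2 ?posrE ?mulr_gt0 ?D_gt0//.
    apply: le_trans (D_le v01) _; rewrite ler_pM2l//.
    by rewrite lerBlDr -lerBlDl; exact: ltW hv.
  have l0' : 0 <= (slope * low top n)^-1 by rewrite invr_ge0 mulr_ge0 ?ltW.
  exact: (ler_pM (ltW (factor_gt0 _)) l0' fn Dn).
move: key; rewrite -EFinM -lee_fin.
have := weight_split 0 h0 hh ht'.
have F1 := weight_low_fin_num 0 h0 ht; have F2 := weight_low_fin_num 0 h0' ht'.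
rewrite -(fineK F1) -(fineK F2) -/(w n) -/(w n.+1) => E.
have F3 : weight `]high n, high n.+1] 0 \is a fin_num.
  by move: E; case: (weight `]high n, _] 0).
move: E; rewrite -(fineK F3) -EFinD => -[->] key.
rewrite addrC addKr lee_fin; move: key; rewrite !lee_fin /l => key.
have -> : factor (high n.+1) =
    2 * slope * (factor (high n.+1) / (slope * low top n) * (low top n / 2)).
  by field; rewrite !gt_eqF.
by rewrite ler_pM2l// mulr_gt0.
Qed.

End FiniteWeight.

(** When the total weight is infinite, almost all of the weight of [`]0, b]]
    lies close to [top] as [b] grows, so ratios of moments tend to powers of
    [top]. *)
Lemma weight_ratio z x e : weight `]0%R, top[ 0 = +oo%E -> 0 < z < top -> 0 < e ->
  exists2 b, 0 < b < top &
    z ^+ x - e <= fine (weight `]0%R, b] x) / fine (weight `]0%R, b] 0).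
Proof.
move=> inf /andP[z0 zt] e0.
have Fz := weight_low_fin_num 0 z0 zt; pose C := fine (weight `]0%R, z] 0).
have C0 : 0 <= C by rewrite fine_ge0// weight_ge0//; exact: sub_low.
have := @weight_exhaust 0; rewrite inf => /cvgey_gt/(_ (C / e))[n1 _ H1].
have [n2 _ H2] := (cvgr_gt _ cvg_high) _ zt.
pose n := maxn n1 n2; have /andP[h0 ht] := high_in n.
have Wn := H1 n (leq_maxl _ _); have zh := H2 n (leq_maxr _ _).
exists (high n); first by rewrite h0.
have S0 := weight_split 0 z0 (ltW zh) ht; have Sx := weight_split x z0 (ltW zh) ht.
have F0 := weight_low_fin_num 0 h0 ht; have Fx := weight_low_fin_num x h0 ht.
have sub : `]z, high n] `<=` `]0, top[%classic.
  by move=> v /=; rewrite !in_itv/= => /andP[zv vh]; rewrite (lt_trans z0)// (le_lt_trans vh).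
have zv v : `]z, high n]%classic v -> z <= v by rewrite /= in_itv/= => /andP[/ltW].
have := weight_exp_ge x (measurable_itv _) sub (ltW z0) zv.
have zx0 : (0 <= weight `]0%R, z] x)%E by apply: weight_ge0; exact: sub_low.
move: Wn S0 Sx; rewrite /= -(fineK Fz) -/C -(fineK F0) -(fineK Fx).
set w := fine (weight _ 0); set wx := fine (weight _ x).
rewrite lte_fin => Wn /eqP; rewrite addeC -sube_eq//; last by rewrite fin_num_adde_defl.
  rewrite -EFinB => /eqP <- Sx.
rewrite -EFinM => V; have : ((z ^+ x * (w - C))%:E <= wx%:E)%E.
  by rewrite Sx; apply: le_trans V _; rewrite leeDr.
have w0 : 0 < w by rewrite (le_lt_trans _ Wn)// divr_ge0// ltW.
rewrite lee_fin ler_pdivlMr// => h; apply: le_trans h.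
rewrite mulrBl mulrBr lerD2l lerN2; move: Wn; rewrite ltr_pdivrMr// => Wn.
apply: le_trans (_ : C <= _); last by rewrite ltW// mulrC.
rewrite ler_piMl// exprn_ile1 ?(ltW z0)//.
by rewrite (le_trans (ltW zt)).
Qed.

Section Source.
Variables (c : R) (x : nat).
Hypothesis c_ge0 : 0 <= c.
Hypothesis x_gt0 : (0 < x)%N.
Hypothesis source_ge0 : forall v, 0 < v < top -> 0 <= c * v ^+ x + flux x v.

Let src v := dens v * (c * v ^+ x + flux x v).

Let src_ge0 v : 0 < v < top -> 0 <= src v.
Proof. by move=> v01; rewrite mulr_ge0 ?source_ge0// ltW// dens_gt0. Qed.

Let src_cont v : 0 < v < top -> {for v, continuous src}.
Proof.
apply: dens_mul_cont => w w01; apply: continuousD; last exact: flux_cont.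
by apply: continuousM; [exact: cst_continuous|exact: expr_cont].
Qed.

Let power_ge0 v : 0 < v < top -> 0 <= factor v * v ^+ x.
Proof. by move=> /andP[v0 _]; rewrite mulr_ge0 ?exprn_ge0 ?ltW ?factor_gt0. Qed.

(** The boundary term at [0] vanishes because [x > 0] and the factor is at most
    [1]. *)
Lemma source_integral b : 0 < b -> b < top ->
  (\int[leb]_(v in `]0%R, b]) (src v)%:E =
   c%:E * weight `]0%R, b] x + (factor b * b ^+ x)%:E)%E.
Proof.
move=> b0 bt; have b01 : 0 < b < top by rewrite b0.
have low_in n : 0 < low b n < top by rewrite low_gt0// (lt_trans (low_lt n b0)).
have F0 : (factor (low b n) * low b n ^+ x)%:E @[n --> \oo] --> 0%:E.
  apply: cvg_EFin; first by near=> n.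
  apply: (@squeeze_cvgr _ _ _ _ (cst 0) (low b)); [|exact: cvg_cst|exact: cvg_low].
  near=> n; rewrite power_ge0//=; have /andP[l0 lt] := low_in n.
  apply: (@le_trans _ _ (low b n ^+ x)).
    by rewrite ler_piMl ?factor_le1// exprn_ge0// ltW.
  rewrite -(prednK x_gt0) exprS ler_piMr ?(ltW l0)// exprn_ile1 ?(ltW l0)//.
  by rewrite ltW// (lt_le_trans lt).
rewrite -[LHS]adde0.
have <- := limn_eD_fin (cvg_integral_low b0 bt src_cont src_ge0) F0.
have cc : c%:E \is a fin_num by [].
have Rr := cvgeZl cc (cvg_integral_low b0 bt (@moment_cont x) (@moment_ge0 x)).
have <- := limn_eD_fin Rr (@cvg_cst _ (factor b * b ^+ x)%:E nat \oo _).
apply: congr_lim; apply/funext => n /=.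
by rewrite source_integral_closed ?low_gt0 ?low_lt.
Unshelve. all: by end_near. Qed.

Lemma source_integral_top : (weight `]0%R, top[ 0 < +oo)%E ->
  (\int[leb]_(v in `]0%R, top[) (src v)%:E = c%:E * weight `]0%R, top[ x)%E.
Proof.
move=> fin.
have <- := cvg_lim (@ereal_hausdorff R) (cvg_integral_high src_cont src_ge0).
have cc : c%:E \is a fin_num by [].
have F0 : (factor (high n) * high n ^+ x)%:E @[n --> \oo] --> 0%:E.
  apply: cvg_EFin; first by near=> n.
  apply: (@squeeze_cvgr _ _ _ _ (cst 0) (factor \o high)); [|exact: cvg_cst|exact: factor_cvg0].
  near=> n; rewrite power_ge0//=; have /andP[h0 ht] := high_in n.
  rewrite ler_piMr ?(ltW (factor_gt0 _))// exprn_ile1 ?(ltW h0)//.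
  by rewrite (le_trans (ltW ht)).
rewrite -[RHS]adde0.
have <- := limn_eD_fin (cvgeZl cc (@weight_exhaust x)) F0.
apply: congr_lim; apply/funext => n /=.
by have /andP[h0 ht] := high_in n; rewrite source_integral.
Unshelve. all: by end_near. Qed.

End Source.

End IntegratingFactor.

(** * Solutions of the hitting equation *)

Section Solutions.
Context {R : realType} (lam mu : R) (p : nat -> R) (r : int -> R).
Hypothesis lam_gt0 : 0 < lam.
Hypothesis mu_ge0 : 0 <= mu.
Hypothesis p_ge0 : forall k : nat, 0 <= p k.
Hypothesis p_sum1 : (\sum_(0 <= k <oo) (p k)%:E = 1%:E)%E.
Hypothesis p0_gt0 : 0 < p 0%N.
Hypothesis p1_eq0 : p 1%N = 0.
Hypothesis r_ge0 : forall k : int, -1 <= k -> 0 <= r k.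
Hypothesis r_sum1 : ((r (-1))%:E + \sum_(0 <= k <oo) (r k%:Z)%:E = 1%:E)%E.
Hypothesis r0_eq0 : r 0 = 0.

Local Notation leb := (@lebesgue_measure R).
Local Notation top := (varphi p).
Local Notation rate := (jump_rate lam mu p r).
Local Notation total := (total_rate lam mu).

Let top_gt0 : 0 < top := varphi_gt0 p_ge0 p_sum1 p0_gt0.
Let top_le1 : top <= 1 := varphi_le1 p_ge0 p_sum1 p0_gt0.

Let rate_ge0 x j : 0 <= rate x j. Proof. exact: jump_rate_ge0. Qed.

Let shifted_gen_r v : 0 < v <= 1 ->
  (\sum_(0 <= j <oo) (r (j%:Z - 1) * v ^+ j)%:E = (v * gen_r r v)%:E)%E.
Proof.
move=> /andP[v0 v1]; have v01 : 0 <= v <= 1 by rewrite ltW.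
have rp_ge0 := r_nat_ge0 r_ge0; have rp_sum := r_nat_sum r_sum1.
have t0 j : (0 <= (r (j%:Z - 1) * v ^+ j)%:E)%E.
  by rewrite lee_fin mulr_ge0 ?(r_shift_ge0 r_ge0)// exprn_ge0// ltW.
rewrite nneseries_recl// sub0r expr0 mulr1 -(nneseries_addn 1)//.
have -> : (\sum_(0 <= j <oo) (r ((j + 1)%N%:Z - 1)%R * v ^+ (j + 1))%:E =
    \sum_(0 <= j <oo) v%:E * (r j%:Z * v ^+ j)%:E)%E.
  by apply: eq_eseriesr => j _; rewrite PoszD addrK addn1 exprS -EFinM mulrCA.
rewrite nneseriesZl; last by move=> j _; rewrite lee_fin mulr_ge0// exprn_ge0// ltW.
rewrite (gen_sum rp_ge0 rp_sum v01) -EFinM -EFinD /gen_r; congr EFin.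
by field; rewrite gt_eqF.
Qed.

(** The jump rates are coefficients of the two generating functions, so
    they act on powers by multiplication. *)
Lemma jump_power_sum x v : (0 < x)%N -> 0 < v <= 1 ->
  (\sum_(0 <= j <oo) (rate x j * v ^+ (x.-1 + j))%:E =
   (lam * x%:R * v ^+ x.-1 * gen_p p v + mu * v ^+ x * gen_r r v)%:E)%E.
Proof.
move=> x0 /[dup] v01' /andP[v0 v1]; have v01 : 0 <= v <= 1 by rewrite ltW.
have vx : v ^+ x = v ^+ x.-1 * v by rewrite -exprSr prednK.
transitivity (\sum_(0 <= j <oo) ((lam * x%:R * v ^+ x.-1)%:E * (p j * v ^+ j)%:E +
    (mu * v ^+ x.-1)%:E * (r (j%:Z - 1) * v ^+ j)%:E))%E.
  apply: eq_eseriesr => j _; rewrite -!EFinM -EFinD; congr EFin.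
  by rewrite /jump_rate exprD; ring.
have vp n : 0 <= v ^+ n by rewrite exprn_ge0// ltW.
rewrite nneseriesD; last 2 first.
- by move=> j _ _; rewrite -EFinM lee_fin !mulr_ge0// ltW.
- by move=> j _ _; rewrite -EFinM lee_fin !mulr_ge0// (r_shift_ge0 r_ge0).
rewrite !nneseriesZl; last 2 first.
- by move=> j _; rewrite lee_fin mulr_ge0// (r_shift_ge0 r_ge0).
- by move=> j _; rewrite lee_fin mulr_ge0.
rewrite (gen_sum p_ge0 p_sum1 v01) shifted_gen_r// -!EFinM -EFinD; congr EFin.
by rewrite vx /gen_p; ring.
Qed.

Definition harmonic (b : R) (f : nat -> R) := forall x, (0 < x)%N ->
  (\sum_(0 <= j <oo) (rate x j)%:E * (f (x.-1 + j)%N)%:E = ((total x + b) * f x)%:E)%E.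

(** Positive solutions that vanish at infinity are determined up to a factor by
    the two comparison principles. *)
Lemma hit_transform_solution {d : measure_display} {Omega : measurableType d}
  (P : nat -> probability Omega R) (X : R -> Omega -> option nat)
  (X_chain : minimal_chain (generator lam mu p r) P X) (b : R) (f : nat -> R) (k x : nat) :
  0 <= b -> (forall x, 0 < f x) -> f x @[x --> \oo] --> (0 : R) -> harmonic b f ->
  (k <= x)%N -> hit_transform (chain_law X_chain) b k x = (f x / f k)%:E.
Proof.
move=> b0 f0 f_lim fh kx.
pose g y := f y / f k.
have g0 y : 0 <= g y by rewrite divr_ge0 ?ltW.
have gk : g k = 1 by rewrite /g divff// gt_eqF.
have gh y : (0 < y)%N ->
    (\sum_(0 <= j <oo) (rate y j)%:E * (g (y.-1 + j)%N)%:E = ((total y + b) * g y)%:E)%E.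
  move=> y0; rewrite /g mulrA EFinM -(fh y y0) muleC -nneseriesZl; last first.
    by move=> j _; rewrite -EFinM lee_fin mulr_ge0// ltW.
  by apply: eq_eseriesr => j _; rewrite -!EFinM; congr EFin; ring.
rewrite -/(g x); apply/eqP; rewrite eq_le; apply/andP; split.
- apply: (hit_transform_upper lam_gt0 mu_ge0 p_ge0 p1_eq0 r_ge0 r0_eq0 X_chain b0 (f := g)) => //.
    by rewrite gk.
  by move=> y ky; rewrite gh// (leq_ltn_trans _ ky).
- apply: (hit_transform_lower lam_gt0 mu_ge0 p_ge0 p_sum1 p0_gt0 p1_eq0 r_ge0 r_sum1 r0_eq0 X_chain b0 (f := g)) => //.
  + by rewrite gk.
  + by rewrite -(mul0r (f k)^-1); apply: cvgMl.
  + by move=> y ky; rewrite gh// (leq_ltn_trans _ ky).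
Qed.

(** Where both drifts vanish, the action of the generator on powers reduces to
    the diagonal. *)
Lemma power_harmonic b : drift mu r b top = 0 -> harmonic b (fun x => top ^+ x).
Proof.
move=> d0 x x0; under eq_eseriesr => j _ do rewrite -EFinM.
rewrite jump_power_sum ?top_gt0// gen_p_varphi//; congr EFin.
have -> : b = mu * (gen_r r top - 1).
  by apply/eqP; rewrite -subr_eq0 -[X in _ == X]d0 /drift; apply/eqP; ring.
have -> : top ^+ x = top ^+ x.-1 * top by rewrite -exprSr prednK.
by rewrite /total_rate; ring.
Qed.

Section Weight.
Variable q : R.
Hypothesis q_ge0 : 0 <= q.
Local Notation bot := (phi mu r q).
Local Notation N := (drift mu r q).
Local Notation D := (rho lam p).
Hypothesis bot_lt : bot < top.

Let bot_ge0 : 0 <= bot. Proof. exact: phi_ge0. Qed.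

Let rhoE v : 0 < v < top -> D v = lam * (gen_p p v - v).
Proof. by move=> /gen_p_gt h; rewrite /rho gtr0_norm// subr_gt0 h. Qed.

Let rho_gt0 v : 0 < v < top -> 0 < D v.
Proof. by move=> v01; rewrite rhoE// mulr_gt0// subr_gt0 gen_p_gt. Qed.

Let rho_cont v : 0 < v < top -> {for v, continuous D}.
Proof.
move=> /andP[v0 vt]; apply: continuousM; first exact: cst_continuous.
apply: (@continuous_comp _ _ _ (fun w => gen_p p w - w) Num.norm); last exact: norm_continuous.
apply: continuousB; last exact: cvg_id.
by apply: gen_p_continuous => //; rewrite v0 (lt_le_trans vt).
Qed.

Let rho_low u : 0 < u < top -> exists2 m, 0 < m & forall v, 0 < v <= u -> m <= D v.
Proof.
move=> /andP[u0 ut]; pose lo := Num.min u (p 0%N / 2).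
have lo0 : 0 < lo by rewrite lt_min u0 divr_gt0.
have lou : lo <= u by rewrite ge_min lexx.
have cont : {within `[lo, u], continuous D}.
  apply: continuous_in_subspaceT => y; rewrite inE /= in_itv/= => /andP[ly yu].
  by apply: rho_cont; rewrite (lt_le_trans lo0)// (le_lt_trans yu).
have [c cI cmin] := EVT_min lou cont.
have Dc : 0 < D c.
  apply: rho_gt0; move: cI; rewrite in_itv/= => /andP[lc cu].
  by rewrite (lt_le_trans lo0)// (le_lt_trans cu).
exists (Num.min (D c) (lam * (p 0%N / 2))); first by rewrite lt_min Dc mulr_gt0 ?divr_gt0.
move=> v /andP[v0 vu]; have [lv|vl] := leP lo v.
  by rewrite ge_min cmin// in_itv/= lv.
rewrite ge_min; apply/orP; right; rewrite rhoE; last by rewrite v0 (le_lt_trans vu).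
rewrite ler_pM2l//; have := @gen_p_ge_p0 _ p p_ge0 p_sum1 v.
rewrite (ltW v0) (le_trans vu)//; last by rewrite (le_trans (ltW ut)).
by move=> /(_ isT); move: vl; rewrite lt_min => /andP[_]; lra.
Qed.

Let rho_le v : 0 < v < top -> D v <= lam * (top - v).
Proof.
move=> /[dup] v01 /andP[v0 vt]; rewrite rhoE// ler_pM2l//.
by apply: gen_p_sub_le => //; rewrite !ltW.
Qed.

Let N_cont v : 0 < v < top -> {for v, continuous N}.
Proof. by move=> /andP[v0 vt]; apply: drift_continuous => //; rewrite v0 (lt_le_trans vt). Qed.

Let N_le0 v : 0 < v -> v <= bot -> N v <= 0. Proof. exact: drift_le0. Qed.

Let N_ge0 v : 0 < v < top -> bot <= v -> 0 <= N v.
Proof. by move=> /andP[v0 vt] bv; apply: drift_ge0 => //; rewrite (le_trans (ltW vt)). Qed.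

Let N_bounded : exists C, forall v, 0 < v < top -> N v <= C.
Proof.
exists (q + mu) => v /andP[v0 vt]; rewrite lerD2l ler_piMr// gerBl.
have := @gen_r_ge _ r r_ge0 r_sum1 v; rewrite v0 (le_trans (ltW vt))// => /(_ isT).
by apply: le_trans; rewrite divr_ge0 ?(ltW v0)// r_ge0.
Qed.

Let data : exponent_data top bot lam N D.
Proof. by split; rewrite ?top_gt0 ?bot_ge0. Qed.

Local Notation Wq := (weight bot N D).

(** The exact derivative and the diagonal add up to the action of the generator
    on powers. *)
Let sourceE x v : (0 < x)%N -> 0 < v < top ->
  (total x + q) * v ^+ x + (x%:R * v ^+ x.-1 * D v - N v * v ^+ x) =
  lam * x%:R * v ^+ x.-1 * gen_p p v + mu * v ^+ x * gen_r r v.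
Proof.
move=> x0 v01; rewrite rhoE// /drift /total_rate.
have -> : v ^+ x = v ^+ x.-1 * v by rewrite -exprSr prednK.
by ring.
Qed.

Let source_ge0 x v : (0 < x)%N -> 0 < v < top ->
  0 <= (total x + q) * v ^+ x + (x%:R * v ^+ x.-1 * D v - N v * v ^+ x).
Proof.
move=> x0 v01; rewrite sourceE// -lee_fin -jump_power_sum//; last first.
  by case/andP: v01 => -> vt; rewrite (le_trans (ltW vt)).
apply: nneseries_ge0 => j _ _; rewrite lee_fin mulr_ge0// exprn_ge0//.
by case/andP: v01 => /ltW.
Qed.

Let total_ge0 x : 0 <= total x + q.
Proof. by rewrite !addr_ge0// mulr_ge0// ltW. Qed.

Let weight_jump_sum (S : set R) x : measurable S -> S `<=` `]0, top[%classic -> (0 < x)%N ->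
  (\sum_(0 <= j <oo) (rate x j)%:E * Wq S (x.-1 + j) =
   \int[leb]_(v in S) (dens bot N D v * ((total x + q) * v ^+ x +
     (x%:R * v ^+ x.-1 * D v - N v * v ^+ x)))%:E)%E.
Proof.
move=> mS St x0; have mm n := measurable_moment data n St.
have m0 n v : S v -> (0 <= (dens bot N D v * v ^+ n)%:E)%E.
  by move=> /St; rewrite /= in_itv/= lee_fin; exact: (moment_ge0 data).
transitivity (\int[leb]_(v in S) \sum_(0 <= j <oo) (rate x j)%:E * (dens bot N D v * v ^+ (x.-1 + j))%:E)%E; last first.
  apply: eq_integral => v; rewrite inE => Sv; have := St _ Sv; rewrite /= in_itv/= => v01.
  rewrite sourceE// EFinM -jump_power_sum//; last first.
    by case/andP: v01 => -> vt; rewrite (le_trans (ltW vt)).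
  rewrite -nneseriesZl; last first.
    move=> j _; rewrite lee_fin mulr_ge0// exprn_ge0//.
    by case/andP: v01 => /ltW.
  by apply: eq_eseriesr => j _; rewrite -!EFinM mulrCA.
rewrite (integral_nneseries leb mS); last 2 first.
- by move=> j; apply: measurable_funeM; exact: mm.
- by move=> j v Sv; rewrite mule_ge0// ?lee_fin//; exact: m0.
apply: eq_eseriesr => j _; rewrite (ge0_integralZl leb mS (mm _)) ?lee_fin//.
by move=> v; exact: m0.
Qed.

Let sub_low b : b < top -> `]0%R, b] `<=` `]0%R, top[%classic.
Proof. by move=> bt; apply: subset_itvl; rewrite bnd_simp. Qed.

Let W_fin b x : 0 < b < top -> Wq `]0%R, b] x \is a fin_num.
Proof.
move=> /andP[b0 bt]; rewrite ge0_fin_numE.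
  exact: (weight_low_fin data x b0 bt).
by apply: (weight_ge0 data); exact: sub_low.
Qed.

Let low_equation b x : 0 < b < top -> (0 < x)%N ->
  (\sum_(0 <= j <oo) (rate x j)%:E * Wq `]0%R, b] (x.-1 + j) =
   (total x + q)%:E * Wq `]0%R, b] x + (factor bot N D b * b ^+ x)%:E)%E.
Proof.
move=> /andP[b0 bt] x0; rewrite weight_jump_sum//; last exact: sub_low.
exact: (source_integral data
  (total_ge0 x) x0 (fun v => @source_ge0 x v x0) b0 bt).
Qed.

Let weight_mono (S : set R) x y : measurable S -> S `<=` `]0, top[%classic ->
  (Wq S (x + y) <= Wq S x)%E.
Proof.
move=> mS St; have mm n := measurable_moment data n St.
apply: ge0_le_integral => //.
- by move=> v /St; rewrite /= in_itv/= lee_fin; exact: (moment_ge0 data).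
- exact: mm.
- exact: mm.
move=> v /St; rewrite /= in_itv/= lee_fin => v01.
have := moment_ge0 data x v01; rewrite exprD mulrA => h; rewrite ler_piMr//.
by case/andP: v01 => /ltW v0 vt; rewrite exprn_ile1// (le_trans (ltW vt)).
Qed.

(** If a moment vanished so would all later ones, and the hitting equation would
    reduce to its positive boundary term. *)
Let weight_gt0 b x : 0 < b < top -> (0 < Wq `]0%R, b] x)%E.
Proof.
move=> /[dup] b01 /andP[b0 bt]; have W0 n : (0 <= Wq `]0%R, b] n)%E.
  by apply: (weight_ge0 data); exact: sub_low.
rewrite lt_def W0 andbT; apply/eqP => e.
have z n : Wq `]0%R, b] (x + n) = 0%E.
  apply/eqP; rewrite eq_le W0 andbT -e weight_mono//; exact: sub_low.
have := @low_equation b x.+1 b01 (ltn0Sn x); rewrite eseries0; last first.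
  by move=> j _ _; rewrite /= z mule0.
rewrite -addn1 z mule0 add0e => /esym/eqP; rewrite eqe gt_eqF//.
by rewrite mulr_gt0 ?exprn_gt0// factor_gt0.
Qed.

Let full x : R := fine (Wq `]0%R, top[ x).

Section Finite.
Hypothesis weight_fin : (Wq `]0%R, top[ 0 < +oo)%E.

Let full_fin x : Wq `]0%R, top[ x = (full x)%:E.
Proof.
rewrite fineK//; exact: (weight_top_fin_num data weight_fin).
Qed.

Lemma moments_gt0 x : 0 < full x.
Proof.
pose b := top / 2; have b01 : 0 < b < top by have t0 := top_gt0; rewrite /b; lra.
have bt : b < top by case/andP: b01.
rewrite -lte_fin -full_fin; apply: lt_le_trans (weight_gt0 x b01) _.
apply: (weight_le data) => //.
exact: sub_low.
Qed.

Lemma moments_cvg0 : full x @[x --> \oo] --> (0 : R).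
Proof.
exact: (weight_top_cvg0 data weight_fin).
Qed.

Lemma moments_harmonic : harmonic q full.
Proof.
move=> x x0; under eq_eseriesr => j _ do rewrite -full_fin.
rewrite weight_jump_sum// EFinM -full_fin.
exact: (source_integral_top data (total_ge0 x) x0 (fun v => @source_ge0 x v x0) weight_fin).
Qed.

End Finite.

(** The numerator of the exponent lies above a chord, so it is bounded below
    near [top] as soon as it is positive at [top]. *)
Lemma weight_fin_of_drift : 0 < N top -> (Wq `]0%R, top[ 0 < +oo)%E.
Proof.
move=> Nt; pose c := (bot + top) / 2.
have bc : bot < c by have := bot_lt; rewrite /c; lra.
have ct : c < top by have := bot_lt; rewrite /c; lra.
have c0 : 0 < c by exact: le_lt_trans bc.
have bt : 0 < top - bot by rewrite subr_gt0.
pose m := (c - bot) * N top / (top - bot).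
have m0 : 0 < m by rewrite divr_gt0// mulr_gt0// subr_gt0.
apply: (weight_fin_of_bound data (c := c) (m := m)) => //; first by rewrite c0.
move=> v /andP[cv vt]; rewrite ler_pdivrMr// mulrC [leRHS]mulrC.
apply: le_trans (drift_chord mu_ge0 r_ge0 r_sum1 q_ge0 _ _ (ltW vt) top_le1 (ltW Nt)).
- by rewrite mulrC ler_wpM2r ?(ltW Nt)// lerD2r.
- exact: lt_le_trans cv.
- by rewrite (le_trans (ltW bc)).
Qed.

(** The moments truncated at [b < top] are subsolutions, by the sign of the
    boundary term at [b].  As [b] approaches [top] the infinite mass of the
    density concentrates there, and their normalized values come close to
    powers of [top]. *)
Lemma hit_transform_ge_power {d : measure_display} {Omega : measurableType d}
  (P : nat -> probability Omega R) (X : R -> Omega -> option nat)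
  (X_chain : minimal_chain (generator lam mu p r) P X) (z : R) (k x : nat) :
  Wq `]0%R, top[ 0 = +oo%E -> 0 < z < top -> (k <= x)%N ->
  ((z ^+ x)%:E <= hit_transform (chain_law X_chain) q k x)%E.
Proof.
move=> inf z01 kx; apply/lee_addgt0Pr => e e0.
have [b b01] := weight_ratio data x inf z01 e0.
have /andP[b0 bt] := b01.
pose w y := fine (Wq `]0%R, b] y).
have wE y : Wq `]0%R, b] y = (w y)%:E by rewrite fineK// W_fin.
have w0 y : 0 < w y by rewrite -lte_fin -wE weight_gt0.
rewrite -!/(w _) => ratio.
have wk : w k <= w 0%N by rewrite -lee_fin -!wE -[k]add0n weight_mono//; exact: sub_low.
rewrite -leeBlDr// -EFinB; apply: (@le_trans _ _ (w x / w k)%:E).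
  rewrite lee_fin; apply: le_trans ratio _.
  by rewrite ler_pM2l// lef_pV2 ?posrE.
apply: (hit_transform_lower lam_gt0 mu_ge0 p_ge0 p_sum1 p0_gt0 p1_eq0 r_ge0 r_sum1 r0_eq0 X_chain q_ge0
  (f := fun y => w y / w k)) => //.
- by move=> y; rewrite divr_ge0// ltW.
- by rewrite divff// gt_eqF.
- rewrite -(mul0r (w k)^-1); apply: cvgMl.
  apply: (@squeeze_cvgr _ _ _ _ (cst 0) (fun y => w 0%N * b ^+ y)).
  + apply: nearW => y; rewrite /= ltW//= -lee_fin EFinM -!wE muleC.
    apply: (weight_exp_le data) => //.
    * exact: sub_low.
    * exact: ltW.
    * by move=> v; rewrite /= in_itv/= => /andP[].
  + exact: cvg_cst.
  + rewrite -(mulr0 (w 0%N)); apply: cvgMr; apply: cvg_expr.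
    by rewrite ger0_norm ?(ltW b0)// (lt_le_trans bt).
- move=> y ky; have y0 : (0 < y)%N by exact: leq_ltn_trans ky.
  rewrite mulrA EFinM muleC.
  have -> : (\sum_(0 <= j <oo) (rate y j)%:E * (w (y.-1 + j)%N / w k)%:E =
      ((w k)^-1)%:E * \sum_(0 <= j <oo) (rate y j)%:E * Wq `]0%R, b] (y.-1 + j))%E.
    rewrite -nneseriesZl; last first.
      by move=> j _; rewrite wE -EFinM lee_fin mulr_ge0// ltW.
    by apply: eq_eseriesr => j _; rewrite wE -!EFinM; congr EFin; ring.
  rewrite low_equation// lee_pmul2l ?lte_fin ?invr_gt0// wE -EFinM leeDl//.
  by rewrite lee_fin mulr_ge0 ?exprn_ge0 ?ltW// factor_gt0.
Qed.

End Weight.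

Local Notation W b := (weight (phi mu r b) (drift mu r b) (rho lam p)).

Let drift_formula v : mu * (1 - gen_r r v) = drift mu r 0 v.
Proof. by rewrite /drift add0r. Qed.

(** On [`[0, varphi[] the branching drift is nonnegative, so the absolute value
    that distinguishes the two densities can be dropped. *)
Let density_0E v : phi mu r 0 < top -> 0 < v < top ->
  density_0 lam mu p r v = density_pos lam mu p r 0 v.
Proof.
have E w : 0 <= w -> w < top -> lam * (gen_p p w - w) = rho lam p w.
  move=> w0 wt; rewrite /rho ger0_norm// subr_ge0.
  move: w0; rewrite le_eqVlt => /predU1P[<-|w0]; last by apply/ltW/gen_p_gt => //; rewrite w0.
  by apply: le_trans (ltW p0_gt0) (gen_p_ge_p0 p_ge0 p_sum1 _); rewrite lexx ler01.
have ph0 : 0 <= phi mu r 0 by exact: phi_ge0.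
move=> pht /andP[v0 vt]; rewrite /density_0 /density_pos (E v (ltW v0) vt).
have G w : 0 <= w -> w < top ->
    mu * (1 - gen_r r w) / (lam * (gen_p p w - w)) = gamma lam mu p r 0 w.
  by move=> w0 wt; rewrite (E w w0 wt) /gamma add0r.
have -> // : oint (phi mu r 0) v (fun w => mu * (1 - gen_r r w) / (lam * (gen_p p w - w))) =
  oint (phi mu r 0) v (gamma lam mu p r 0).
move: (phi mu r 0) ph0 pht => ph ph0 pht; rewrite /oint; case: ifPn => _.
  apply: eq_Rintegral => w; rewrite inE/= in_itv/= => /andP[pw wv].
  exact: G (le_trans ph0 pw) (le_lt_trans wv vt).
congr (- _); apply: eq_Rintegral => w; rewrite inE/= in_itv/= => /andP[vw wp].
exact: G (le_trans (ltW v0) vw) (le_lt_trans wp pht).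
Qed.

Let Phi_0_moments x : phi mu r 0 < top ->
  \int[leb]_(v in `]0, top[) (density_0 lam mu p r v * v ^+ x) = fine (W 0 `]0, top[ x).
Proof.
move=> pht; apply: eq_Rintegral => v; rewrite inE/= in_itv/= => v01.
by rewrite density_0E.
Qed.

(** The solution of the hitting equation selected by [Phi]: a moment sequence if
    the density is integrable, the powers of the root [varphi < 1] where the
    two drifts vanish together, or else a constant. *)
Lemma Phi_cases b : 0 <= b -> 0 <= drift mu r b top ->
  [\/ exists c, [/\ 0 < c, phi mu r b < top, (W b `]0%R, top[ 0 < +oo)%E &
        forall x, Phi lam mu p r b x = c * fine (W b `]0, top[ x)],
      [/\ drift mu r b top = 0, top < 1 & forall x, Phi lam mu p r b x = top ^+ x] |
      [/\ b = 0, top = 1, forall x, Phi lam mu p r b x = 1 &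
          (phi mu r 0 < 1 /\ W 0 `]0%R, top[ 0 = +oo%E) \/
          forall z, 0 < z < 1 -> drift mu r 0 z <= 0]].
Proof.
move=> b0 dt; rewrite /Phi; have [bz|bnz] := eqVneq b 0; last first.
  have bp : 0 < b by rewrite lt_neqAle eq_sym bnz.
  rewrite /Phi_pos; have [pt|tp] := ltP (phi mu r b) top.
    constructor 1; exists b; split => //.
    by apply: weight_fin_of_drift => //; apply: drift_gt0.
  constructor 2; split => //.
    by apply/eqP; rewrite eq_le dt andbT; apply: drift_le0.
  by apply: le_lt_trans tp _; exact: phi_lt1.
subst b; rewrite /Phi_0; case: asboolP => [|nP].
  rewrite /Phi_0_integral_case drift_formula => -[d0|[mu0 ph1 t1 fin]].
    have pt : phi mu r 0 < top by exact: phi_lt_pos.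
    constructor 1; exists mu; split => //.
    - rewrite lt_neqAle mu_ge0 andbT eq_sym; apply/eqP => m0.
      by move: d0; rewrite /drift m0 mul0r addr0 ltxx.
    - exact: weight_fin_of_drift.
    - by move=> x; rewrite Phi_0_moments.
  have pt : phi mu r 0 < top by rewrite t1.
  constructor 1; exists mu; split => //; last by move=> x; rewrite Phi_0_moments.
  rewrite -t1 in fin; apply: le_lt_trans fin; rewrite le_eqVlt; apply/orP; left; apply/eqP.
  apply: eq_integral => v; rewrite inE/= in_itv/= => v01.
  by rewrite expr0 mulr1 density_0E.
have d0 : drift mu r 0 top = 0.
  apply/eqP; rewrite eq_le dt andbT leNgt; apply/negP => d0; apply: nP.
  by left; rewrite drift_formula.
move: top_le1; rewrite le_eqVlt => /predU1P[t1|t1]; last by constructor 2.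
constructor 3; split => //; first by move=> x; rewrite t1 expr1n.
have [muz|mup] := eqVneq mu 0.
  by right => z _; rewrite /drift muz mul0r addr0.
have mu0 : 0 < mu by rewrite lt_neqAle eq_sym mup.
have [ph1|ph1] := ltP (phi mu r 0) 1; last first.
  right => z /andP[z0 z1]; apply: drift_le0 => //.
  by rewrite (le_trans (ltW z1)).
left; split => //; apply/eqP; rewrite eq_le leey/= leNgt; apply/negP => fin.
have pt : phi mu r 0 < top by rewrite t1.
apply: nP; right; split => //; apply: le_lt_trans fin.
rewrite -t1 le_eqVlt; apply/orP; left; apply/eqP.
apply: eq_integral => v; rewrite inE/= in_itv/= => v01.
by rewrite expr0 mulr1 density_0E.
Qed.

Lemma Phi_gt0 b x : 0 <= b -> 0 <= drift mu r b top -> 0 < Phi lam mu p r b x.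
Proof.
move=> b0 dt; have [[c [c0 pt fin ->]]|[_ _ ->]|[_ _ -> _]] := Phi_cases b0 dt.
- by rewrite mulr_gt0//; apply: moments_gt0.
- exact: exprn_gt0.
- by [].
Qed.

Let bernoulli (e : R) n : 0 <= e <= 1 -> 1 - n%:R * e <= (1 - e) ^+ n.
Proof.
move=> /andP[e0 e1]; elim: n => [|n IH]; first by rewrite mul0r subr0.
rewrite exprS; apply: le_trans (_ : (1 - e) * (1 - n%:R * e) <= _); last first.
  by rewrite ler_wpM2l// subr_ge0.
rewrite -subr_ge0 -natr1.
have -> : (1 - e) * (1 - n%:R * e) - (1 - (n%:R + 1) * e) = n%:R * (e * e) by ring.
by rewrite mulr_ge0// mulr_ge0.
Qed.

Section Hitting.
Context {d : measure_display} {Omega : measurableType d}.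
Variables (P : nat -> probability Omega R) (X : R -> Omega -> option nat).
Hypothesis X_chain : minimal_chain (generator lam mu p r) P X.

Local Notation h b k x := (hit_transform (chain_law X_chain) b k x).

(** Where the drift is nonpositive and [z] is below the branching root, powers
    of [z] are subsolutions. *)
Let hit_ge_subpower z k x : top = 1 -> 0 < z < 1 -> drift mu r 0 z <= 0 -> (k <= x)%N ->
  ((z ^+ x)%:E <= h 0 k x)%E.
Proof.
move=> t1 /andP[z0 z1] dz kx.
apply: (@le_trans _ _ (z ^+ x / z ^+ k)%:E).
  by rewrite lee_fin ler_peMr ?exprn_ge0 ?(ltW z0)// invf_ge1 ?exprn_gt0// exprn_ile1// ltW.
apply: (hit_transform_lower lam_gt0 mu_ge0 p_ge0 p_sum1 p0_gt0 p1_eq0 r_ge0 r_sum1 r0_eq0 X_chain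
  (lexx 0) (f := fun y => z ^+ y / z ^+ k)) => //.
- by move=> y; rewrite divr_ge0// exprn_ge0// ltW.
- by rewrite divff// expf_eq0 (gt_eqF z0) andbF.
- rewrite -(mul0r (z ^+ k)^-1); apply: cvgMl; apply: cvg_expr.
  by rewrite ger0_norm ?(ltW z0).
- move=> y ky; have y0 : (0 < y)%N by exact: leq_ltn_trans ky.
  have -> : (\sum_(0 <= j <oo) (rate y j)%:E * (z ^+ (y.-1 + j) / z ^+ k)%:E =
      ((z ^+ k)^-1)%:E * \sum_(0 <= j <oo) (rate y j * z ^+ (y.-1 + j))%:E)%E.
    rewrite -nneseriesZl; last first.
      by move=> j _; rewrite lee_fin mulr_ge0 ?exprn_ge0 ?(ltW z0)//; exact: jump_rate_ge0.
    by apply: eq_eseriesr => j _; rewrite -!EFinM; congr EFin; ring.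
  have zz : 0 < z <= 1 by rewrite z0 ltW.
  rewrite (jump_power_sum y0 zz).
  rewrite mulrA addr0 muleC EFinM.
  rewrite lee_pmul2r ?lte_fin ?invr_gt0 ?exprn_gt0// lee_fin /total_rate mulrDl.
  have zy : z ^+ y = z ^+ y.-1 * z by rewrite -exprSr prednK.
  apply: lerD.
    rewrite zy mulrA ler_wpM2l ?mulr_ge0 ?exprn_ge0 ?(ltW z0) ?(ltW lam_gt0)//.
    by apply/ltW/gen_p_gt => //; rewrite z0 t1.
  move: dz; rewrite /drift add0r mulrBr mulr1 subr_le0 => dz.
  by rewrite [leRHS]mulrAC ler_wpM2r// exprn_ge0// ltW.
Qed.

(** In the third case of [Phi_cases] the level [k] is hit almost surely: powers
    of [z < 1] bound the transform from below, and [z] tends to [1]. *)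
Lemma hit_transform_Phi b k x : 0 <= b -> 0 <= drift mu r b top -> (k <= x)%N ->
  h b k x = (Phi lam mu p r b x / Phi lam mu p r b k)%:E.
Proof.
move=> b0 dt kx.
have [[c [c0 pt fin PE]]|[d0 t1 PE]|[bz t1 PE alt]] := Phi_cases b0 dt.
- rewrite !PE (hit_transform_solution X_chain b0 (f := fun y => fine (W b `]0, top[ y)))//.
  + by congr EFin; rewrite -mulf_div divff ?mul1r// gt_eqF.
  + by move=> y; apply: moments_gt0.
  + exact: moments_cvg0.
  + exact: moments_harmonic.
- rewrite !PE (hit_transform_solution X_chain b0 (f := fun y => top ^+ y))//.
  + by move=> y; exact: exprn_gt0.
  + by apply: cvg_expr; rewrite ger0_norm// ltW.
  + exact: power_harmonic.
- rewrite !PE divr1 bz; apply/eqP; rewrite eq_le; apply/andP; split.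
    exact: (hit_transform_le1 (chain_law X_chain) k (lexx 0) x).
  have low z : 0 < z < 1 -> ((z ^+ x)%:E <= h 0 k x)%E.
    move=> z01; case: alt => [[ph1 inf]|alt].
      have pt : phi mu r 0 < top by rewrite t1.
      have z0t : 0 < z < top by rewrite t1.
      by apply: hit_transform_ge_power.
    exact: (hit_ge_subpower t1 z01 (alt z z01) kx).
  apply/lee_addgt0Pr => e e0.
  (* By Bernoulli's inequality [(1 - u) ^+ x] is at least [1 - e]. *)
  pose u := Num.min (1 / 2) (e / (x%:R + 1)).
  have x1 : 0 < x%:R + 1 :> R by rewrite ltr_wpDl.
  have u0 : 0 < u by rewrite lt_min !divr_gt0.
  have u2 : u <= 1 / 2 by rewrite ge_min lexx.
  have u1 : u < 1 by apply: le_lt_trans u2 _; lra.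
  have ue : x%:R * u <= e.
    apply: (@le_trans _ _ (x%:R * (e / (x%:R + 1)))).
      by rewrite ler_wpM2l// ge_min lexx orbT.
    by rewrite mulrA ler_pdivrMr// mulrC ler_wpM2l ?(ltW e0)// lerDl.
  have /low h1 : 0 < 1 - u < 1 by rewrite subr_gt0 u1 gtrBl.
  rewrite -leeBlDr//; apply: le_trans h1; rewrite lee_fin.
  apply: le_trans (bernoulli x (_ : 0 <= u <= 1)); last by rewrite !ltW.
  by rewrite lerD2l lerN2.
Qed.

End Hitting.
End Solutions.

(** * The exponential time and the conclusion *)

Section Independence.
Context {R : realType} {d : measure_display} {Omega : measurableType d}.
Variables (Q : nat -> nat -> R) (P : nat -> probability Omega R).
Variable X : R -> Omega -> option nat.
Hypothesis X_chain : minimal_chain Q P X.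

Let generators : set (set Omega) :=
  [set C | exists t y, 0 <= t /\ C = [set w | X t w = y]].

(** The record of the jumps is a function of the path, hence measurable for the
    sigma-algebra that the process generates. *)
Let record_generated (H : set (@record_space R)) : measurable H ->
  <<s generators >> (chain_record X_chain @^-1` H).
Proof.
move=> mH.
have Xm t n : 0 <= t -> measurable ([set w | X t w = Some n] : set (g_sigma_algebraType generators)).
  by move=> t0; apply: sub_sigma_algebra; exists t, (Some n).
have := @measurable_jump_record R _ (g_sigma_algebraType generators) X (chain_path X_chain) Xm
  measurableT H mH.
by rewrite setTI.
Qed.

Lemma exp_time_independent (e1 : {mfun Omega >-> R}) (q : R) x
    (H : set (@record_space R)) (B : set (\bar R)) :
  independent_of_process (P x) X e1 -> measurable H -> measurable B ->
  P x (chain_record X_chain @^-1` H `&` exp_time e1 q @^-1` B) =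
  (P x (chain_record X_chain @^-1` H) * P x (exp_time e1 q @^-1` B))%E.
Proof.
move=> ind mH mB.
pose tm (u : R) : \bar R := if q == 0 then +oo%E else (u / q)%:E.
have mtm : measurable_fun setT tm.
  rewrite /tm; case: (q == 0); first exact: measurable_cst.
  by apply: measurableT_comp; [exact: EFin_measurable|exact: measurable_funM].
have mB' : measurable (tm @^-1` B) by rewrite -[X in measurable X]setTI; exact: mtm.
exact: ind (record_generated mH) mB'.
Qed.

End Independence.

Theorem corollary5p7 (R : realType) (lam mu : R) (p : nat -> R) (r : int -> R)
  (lam_gt0 : 0 < lam) (mu_ge0 : 0 <= mu)
  (p_ge0 : forall k : nat, 0 <= p k)
  (p_sum1 : (\sum_(0 <= k <oo) (p k)%:E = 1)%E)
  (p0_gt0 : 0 < p 0%N) (p1_eq0 : p 1%N = 0)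
  (r_ge0 : forall k : int, -1 <= k -> 0 <= r k)
  (r_sum1 : ((r (-1))%:E + \sum_(0 <= k <oo) (r k%:Z)%:E = 1)%E)
  (r0_eq0 : r 0 = 0)
  (nontrivial : (exists k : nat, (0 < k)%N /\ 0 < mu * r k%:Z) \/ p 0%N < 1)
  (d : measure_display) (Omega : measurableType d)
  (P : nat -> probability Omega R) (X : R -> Omega -> option nat)
  (X_chain : minimal_chain (generator lam mu p r) P X)
  (e1 : {mfun Omega >-> R})
  (e1_exp : forall x : nat, is_unit_exponential (P x) e1)
  (e1_indep : forall x : nat, independent_of_process (P x) X e1)
  (q : R) (q_ge0 : 0 <= q) (x : nat) :
  cond_independent (P x) (G_e X e1 q) (post_G_e X e1 q) (X_G_e X e1 q) /\
  (mu * (gen_r r (varphi p) - 1) <= q ->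
   forall k : nat, (k <= x)%N ->
   let XGk := [set w | X_G_e X e1 q w = Some k] in
   P x XGk =
     (Phi lam mu p r q x / Phi lam mu p r q k
      - (if (0 < k)%N
         then Phi lam mu p r q x / Phi lam mu p r q k.-1 else 0))%:E /\
   ((0 < P x XGk)%E ->
    forall alpha : R, 0 <= alpha ->
    cond_expect (P x) (fun w => expeR (- (alpha%:E * G_e X e1 q w))%E) XGk =
      Phi lam mu p r (q + alpha) x / Phi lam mu p r q x
      * (Phi lam mu p r q k / Phi lam mu p r (q + alpha) k) /\
    (0 < q ->
     cond_expect (P x) (fun w => expeR (- (alpha%:E * post_G_e X e1 q w))%E) XGk =
       q / (q + alpha)
       * ((1 - (if (0 < k)%N
                then Phi lam mu p r (q + alpha) k
                     / Phi lam mu p r (q + alpha) k.-1 else 0))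
          / (1 - (if (0 < k)%N
                  then Phi lam mu p r q k / Phi lam mu p r q k.-1 else 0)))))).
Proof.
have Q_diag := generator_diag_le0 p r lam_gt0 mu_ge0.
have Q_offdiag := generator_offdiag lam_gt0 mu_ge0 p_ge0 r_ge0.
have Q_skipfree := generator_skipfree lam mu p r.
have e_meas := measurable_exp_time e1 q.
have e_tail y t : 0 <= t -> P y [set w | (t%:E < exp_time e1 q w)%E] = (expR (- q * t))%:E.
  exact: exp_time_tail.
have e_indep y H B := @exp_time_independent _ _ _ _ P X X_chain e1 q y H B (e1_indep y).
split.
  exact: (last_min_cond_independent Q_diag Q_offdiag Q_skipfree q_ge0 e_meas e_tail e_indep).
move=> q_drift k kx XGk.
have drift_top b : q <= b -> 0 <= drift mu r b (varphi p).
  move=> qb; rewrite /drift -opprB mulrN subr_ge0; exact: le_trans qb.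
set F := Phi lam mu p r.
have F_gt0 b y : q <= b -> 0 < F b y.
  by move=> qb; apply: Phi_gt0 => //; [exact: le_trans qb|exact: drift_top].
have hitF b i j : q <= b -> (i <= j)%N -> hit_transform (chain_law X_chain) b i j = (F b j / F b i)%:E.
  by move=> qb ij; apply: hit_transform_Phi => //; [exact: le_trans qb|exact: drift_top].
clearbody F; pose step b : R := if (0 < k)%N then F b k / F b k.-1 else 0.
have belowF b : q <= b -> fine (match k with 0%N => 0%E
    | k'.+1 => hit_transform (chain_law X_chain) b k' k end) = step b.
  by rewrite /step; move=> qb; case: (k) => // k' /=; rewrite hitF.
have PE : P x XGk = (F q x / F q k * (1 - step q))%:E.
  rewrite -(belowF q)// -[F q x / F q k]/(fine (F q x / F q k)%:E) -hitF//.
  exact: (XG_law Q_diag Q_offdiag Q_skipfree q_ge0 e_meas e_tail e_indep kx).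
rewrite -/(step q).
have Fx := F_gt0 q x (lexx q); have Fk := F_gt0 q k (lexx q).
split.
  rewrite PE; congr EFin; rewrite /step; case: ifP => _; last by ring.
  have Fk1 := F_gt0 q k.-1 (lexx q).
  by field; rewrite !gt_eqF.
rewrite PE lte_fin pmulr_rgt0 ?divr_gt0// => s0 a a0; rewrite -/(step (q + a)).
have qa : q <= q + a by rewrite lerDl.
have Fax := F_gt0 (q + a) x qa; have Fak := F_gt0 (q + a) k qa.
split=> [|q0].
  rewrite /cond_expect PE.
  have -> : (\int[P x]_(w in XGk) expeR (- (a%:E * G_e X e1 q w)) =
      (F (q + a) x / F (q + a) k * (1 - step q))%:E)%E.
    rewrite -(belowF q)// -[F (q + a) x / _]/(fine (F (q + a) x / F (q + a) k)%:E) -hitF//.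
    exact: (XG_time_transform Q_diag Q_offdiag Q_skipfree q_ge0 e_meas e_tail e_indep kx a0).
  rewrite /=; field.
  by rewrite !gt_eqF.
rewrite /cond_expect PE.
have -> : (\int[P x]_(w in XGk) expeR (- (a%:E * post_G_e X e1 q w)) =
    (F q x / F q k * (q / (q + a) * (1 - step (q + a))))%:E)%E.
  rewrite -(belowF (q + a))// -[F q x / _]/(fine (F q x / F q k)%:E) -hitF//.
  exact: (XG_after_transform Q_diag Q_offdiag Q_skipfree q_ge0 e_meas e_tail e_indep kx a0 q0).
rewrite /=; field.
by rewrite !gt_eqF// ltr_pwDl.
Qed.
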